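(* There exists a unique map $f:\mathcal S\to\mathcal M$ (extended to finite disjoint unions of graphs from $\mathcal S$ and circles) such that disjoint unions are sent to products, $f(t)=t$ for every $t\in\mathcal T$, and $f$ satisfies the three Kuperberg relations: (i) (loop) $f(\bigcirc)=A^6+1+A^{-6}$; (ii) (bigon) $f(\Gamma)=(A^3+A^{-3})\,f(\Gamma')$ whenever $\Gamma'$ is obtained from $\Gamma$ by resolving a bigon; (iii) (quadrilateral) $f(\Gamma)=f(\Gamma_1)+f(\Gamma_2)$ whenever $\Gamma_1,\Gamma_2$ are the two resolutions of a quadrilateral of $\Gamma$. Moreover, the resulting evaluation yields a topological invariant of oriented virtual links: if $[[K]]=\sum_s w(s)f(K_s)\in\mathcal M$ is obtained by expanding all classical crossings of an oriented virtual link diagram $K$, then $A^{-8wr(K)}[[K]]$ depends only on the virtual link represented by $K$.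
   Context: **Graphs.** $\mathcal S$ is the collection of all finite trivalent bipartite graphs (abstract graphs, multiple edges allowed, up to isomorphism) with every edge oriented from the first part to the second part; thus every vertex is a source or a sink. No planarity and no cyclic order at vertices is assumed. Circles (closed components with no vertices) are also allowed as components. A bigon is a pair of distinct edges joining the same two vertices; a quadrilateral is a $4$-cycle with four distinct vertices. $\mathcal T=\{t_1,t_2,\dots\}\subset\mathcal S$ is the set of connected graphs having neither bigons nor quadrilaterals. $\mathcal M=\mathbb Z[A,A^{-1}][t_1,t_2,\dots]$ consists of formal commutative products of graphs from $\mathcal T$ with Laurent polynomial coefficients; disjoint union corresponds to product. **Resolutions.** Resolving a bigon with vertices $u,v$: delete $u,v$ and the two edges of the bigon, and join the remaining half-edges at $u$ and $v$ into one edge (a circle results if they belong to the same edge). Resolving a quadrilateral with vertices $v_1,v_2,v_3,v_4$ in cyclic order, where $l_i$ is the half-edge at $v_i$ not in the quadrilateral: delete the four vertices and four edges of the quadrilateral and join either $l_1$ with $l_2$ and $l_3$ with $l_4$ (giving $\Gamma_1$), or $l_2$ with $l_3$ and $l_4$ with $l_1$ (giving $\Gamma_2$). Joinings respect orientations; closed curves produced are circles. **Bracket.** A virtual link diagram has classical crossings and virtual crossings; virtual links are equivalence classes of diagrams under the classical Reidemeister moves and detour moves (generalized Reidemeister moves). At a classical crossing with sign $\epsilon=\pm1$, incoming edges $a,b$ and outgoing edges $c,d$, where $a$ continues to $c$ and $b$ to $d$, there are two local states: the oriented one (join $a$ to $d$ and $b$ to $c$), of weight $A^{2\epsilon}$;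 and the unoriented one (replace the crossing by a sink vertex receiving $a,b$, a source vertex emitting $c,d$, and a new edge from the source to the sink), of weight $-A^{-\epsilon}$. A state $s$ is a choice of local state at each classical crossing; $K_s$ is the resulting abstract graph (virtual crossings are ignored), possibly with circles; $w(s)$ is the product of the weights of the chosen local states. $wr(K)$ is the sum of the signs of all classical crossings. *)

(* Defs.v *)
From HB Require Import structures.
From Stdlib Require Import Relations.
From mathcomp Require Import all_boot all_fingroup all_order all_algebra.
From mathcomp Require Import generic_quotient boolp.
From mathcomp.multinomials Require Import monalg.

Set Implicit Arguments.
Unset Strict Implicit.
Unset Printing Implicit Defensive.

Import GRing.Theory.
Local Open Scope ring_scope.
Local Open Scope quotient_scope.

Local Notation "x %:F" := (tofrac x).

(* Z[A, A^-1] is the subring of the fraction field of Z[X] whose elements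
    are the p / X^n. *)

Definition is_laurent : {pred {fraction {poly int}}} :=
  fun x => `[< exists (p : {poly int}) (n : nat), x = p%:F / 'X%:F ^+ n >].

Lemma fracX_neq0 : ('X%:F : {fraction {poly int}}) != 0.
Proof. by rewrite tofrac_eq0 polyX_eq0. Qed.

Lemma is_laurent_subring : subring_closed is_laurent.
Proof.
have X0 n : ('X%:F : {fraction {poly int}}) ^+ n != 0.
  by rewrite expf_neq0 // fracX_neq0.
split=> [|x y|x y].
- by apply/asboolP; exists 1, 0%N; rewrite expr0 divr1 rmorph1.
- move=> /asboolP[p [n ->]] /asboolP[q [m ->]]; apply/asboolP.
  exists (p * 'X^m - q * 'X^n), (n + m)%N.
  rewrite -mulNr addf_div ?X0 // mulNr.
  by rewrite rmorphB !rmorphM !rmorphXn /= exprD.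
- move=> /asboolP[p [n ->]] /asboolP[q [m ->]]; apply/asboolP.
  exists (p * q), (n + m)%N.
  by rewrite rmorphM /= exprD mulf_div.
Qed.

HB.instance Definition _ :=
  GRing.isSubringClosed.Build _ is_laurent is_laurent_subring.

Record laurent :=
  Laurent { lval : {fraction {poly int}}; _ : lval \in is_laurent }.

HB.instance Definition _ := [isSub for lval].
HB.instance Definition _ := [Choice of laurent by <:].
HB.instance Definition _ := [SubChoice_isSubComNzRing of laurent by <:].

Lemma is_laurent_exp (k : int) : ('X%:F : {fraction {poly int}}) ^ k \in is_laurent.
Proof.
apply/asboolP; case: k => n; first by exists 'X^n, 0%N; rewrite expr0 divr1 rmorphXn.
by exists 1, n.+1; rewrite rmorph1 mul1r.
Qed.

Definition Apow (k : int) : laurent := Laurent (is_laurent_exp k).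

(* A list of pairs (tail, head) is a multiset of oriented edges, and the number
   which comes with it counts the circles. *)

Section Join.
Variables S T : eqType.
Implicit Types (E : seq (S * T)) (G : seq (S * T) * nat).

(* Joins the unique edge with head [j.1] to the unique edge with tail [j.2];
   these two ends disappear. *)
Definition join (j : T * S) G : seq (S * T) * nat :=
  let: (w, u) := j in let: (E, k) := G in
  let E' := [seq e <- E | (e.1 != u) && (e.2 != w)] in
  if (u, w) \in E then (E', k.+1)
  else ((head u [seq e.1 | e <- E & e.2 == w],
         head w [seq e.2 | e <- E & e.1 == u]) :: E', k).

Definition joins (js : seq (T * S)) G := foldr join G js.

Lemma count1_split (U : eqType) (f : S * T -> U) E x :
  count_mem x (map f E) = 1%N ->
  exists e R, [/\ perm_eq E (e :: R), f e = x & x \notin map f R].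
Proof.
move=> cE; have /mapP[e eE xe] : x \in map f E by rewrite -has_pred1 has_count cE.
exists e, (rem e E); split=> //; first exact: perm_to_rem.
have := seq.permP (perm_map f (perm_to_rem eE)) (pred1 x).
rewrite cE /= -xe eqxx add1n => -[/esym c0].
by rewrite -has_pred1 has_count c0.
Qed.

Lemma join_perm j E k :
  count_mem j.2 (unzip1 E) = 1%N -> count_mem j.1 (unzip2 E) = 1%N ->
  perm_eq (j.2 :: unzip1 (join j (E, k)).1) (unzip1 E) /\
  perm_eq (j.1 :: unzip2 (join j (E, k)).1) (unzip2 E).
Proof.
case: j => w u /= cu cw.
have filt R : u \notin unzip1 R -> w \notin unzip2 R ->
    [seq e <- R | (e.1 != u) && (e.2 != w)] = R.
  move=> uR wR; apply/all_filterP/allP => e eR; apply/andP; split.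
    by apply: contraNneq uR => <-; rewrite map_f.
  by apply: contraNneq wR => <-; rewrite map_f.
have [[u' b] [R [pR /= ue uR]]] := count1_split cu; subst u'.
case: ifP => uwE /=.
  have pE := perm_to_rem uwE; set R' := rem _ _ in pE.
  have uR' : u \notin unzip1 R'.
    by move: cu; rewrite (seq.permP (perm_map _ pE)) /= eqxx add1n => -[/eqP];
       rewrite -leqn0 leqNgt -has_count has_pred1.
  have wR' : w \notin unzip2 R'.
    by move: cw; rewrite (seq.permP (perm_map _ pE)) /= eqxx add1n => -[/eqP];
       rewrite -leqn0 leqNgt -has_count has_pred1.
  have pf : perm_eq [seq e <- E | (e.1 != u) && (e.2 != w)] R'.
    by rewrite (perm_trans (perm_filter _ pE)) //= !eqxx /= filt.
  rewrite !(perm_sym _ (_ E)); split.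
    by rewrite (perm_trans (perm_map _ pE)) //= perm_cons perm_sym perm_map.
  by rewrite (perm_trans (perm_map _ pE)) //= perm_cons perm_sym perm_map.
have bw : b != w.
  by apply: contraFneq uwE => <-; rewrite (perm_mem pR) mem_head.
have cwR : count_mem w (unzip2 R) = 1%N.
  by move: cw; rewrite (seq.permP (perm_map _ pR)) /= (negPf bw).
have [[a w'] [R' [pR' /= we wR']]] := count1_split cwR; subst w'.
have uR' : u \notin unzip1 R'.
  by move: uR; rewrite (perm_mem (perm_map _ pR')) inE negb_or => /andP[].
have au : a != u.
  by move: uR; rewrite (perm_mem (perm_map _ pR')) inE negb_or eq_sym => /andP[].
have pE : perm_eq E [:: (u, b), (a, w) & R'] by rewrite (perm_trans pR) // perm_cons.
have -> : [seq e.1 | e <- E & e.2 == w] = [:: a].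
  apply/perm_small_eq => //; rewrite (perm_trans (perm_map _ (perm_filter _ pE))) //=.
  rewrite (negPf bw) eqxx /=; suff -> : [seq e <- R' | e.2 == w] = [::] by [].
  apply/eqP; rewrite -[_ == _]negbK -has_filter; apply: contra wR' => /hasP[e eR /eqP <-].
  exact: map_f.
have -> : [seq e.2 | e <- E & e.1 == u] = [:: b].
  apply/perm_small_eq => //; rewrite (perm_trans (perm_map _ (perm_filter _ pE))) //=.
  rewrite (negPf au) eqxx /=; suff -> : [seq e <- R' | e.1 == u] = [::] by [].
  apply/eqP; rewrite -[_ == _]negbK -has_filter; apply: contra uR' => /hasP[e eR /eqP <-].
  exact: map_f.
have pf : perm_eq [seq e <- E | (e.1 != u) && (e.2 != w)] R'.
  by rewrite (perm_trans (perm_filter _ pE)) //= !eqxx /= andbF filt.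
rewrite /= !(perm_sym _ (_ E)); split.
  by rewrite (perm_trans (perm_map _ pE)) //= !perm_cons perm_sym perm_map.
rewrite (perm_trans (perm_map _ pE)) //=.
by rewrite (perm_catCA [:: b] [:: w]) /= !perm_cons perm_sym perm_map.
Qed.

Lemma joins_perm js E k :
  uniq (unzip1 js) -> uniq (unzip2 js) ->
  (forall j, j \in js ->
     count_mem j.2 (unzip1 E) = 1%N /\ count_mem j.1 (unzip2 E) = 1%N) ->
  perm_eq (unzip2 js ++ unzip1 (joins js (E, k)).1) (unzip1 E) /\
  perm_eq (unzip1 js ++ unzip2 (joins js (E, k)).1) (unzip2 E).
Proof.
elim: js => [|j js IH] //= /andP[j1 u1] /andP[j2 u2] cE.
have [|p1 p2] := IH u1 u2; first by move=> i ijs; apply: cE; rewrite inE ijs orbT.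
have [c2 c1] := cE j (mem_head _ _).
move: c2 c1; rewrite -(seq.permP p1) -(seq.permP p2) !count_cat.
rewrite (count_memPn j1) (count_memPn j2) !add0n.
rewrite -/(joins js (E, k)); case: (joins js _) p1 p2 => E' k' /= p1 p2 c2 c1.
have [q1 q2] := join_perm k' c2 c1.
split; [apply: perm_trans p1|apply: perm_trans p2].
  by rewrite -cat1s perm_catCA perm_cat2l.
by rewrite -cat1s perm_catCA perm_cat2l.
Qed.

End Join.

(* The pair (u, v) is an edge from the source named u to the sink named v;
    sources and sinks have separate name spaces, and a vertex is a name which
    occurs in the list. *)

Definition trivalent (E : seq (nat * nat)) : bool :=
  all (fun u => count_mem u (unzip1 E) == 3) (unzip1 E) &&
  all (fun v => count_mem v (unzip2 E) == 3) (unzip2 E).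

Record graph := Graph { web : seq (nat * nat) * nat; _ : trivalent web.1 }.

HB.instance Definition _ := [isSub for web].
HB.instance Definition _ := [Choice of graph by <:].

Definition edges (G : graph) : seq (nat * nat) := (web G).1.
Definition circles (G : graph) : nat := (web G).2.

Definition rename (p q : nat -> nat) (E : seq (nat * nat)) :=
  [seq (p e.1, q e.2) | e <- E].

Definition graph_iso (G H : graph) : Prop :=
  exists p q : nat -> nat,
    [/\ bijective p, bijective q, perm_eq (edges H) (rename p q (edges G)) &
        circles H = circles G].

Definition graph_isob : rel graph := fun G H => `[< graph_iso G H >].

Lemma graph_isob_refl : reflexive graph_isob.
Proof.
move=> G; apply/asboolP; exists id, id; split=> //; try by exists id.
by rewrite /rename (eq_map (g := id)) ?map_id // => -[].
Qed.

Lemma graph_isob_sym : symmetric graph_isob.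
Proof.
suff imp G H : graph_isob G H -> graph_isob H G.
  by move=> G H; apply/idP/idP; apply: imp.
case/asboolP=> p [q] [[p' pK Kp] [q' qK Kq] pE cE]; apply/asboolP.
exists p', q'; split=> //; [by exists p | by exists q | ].
rewrite perm_sym (perm_trans (perm_map _ pE)) // -map_comp.
by rewrite (eq_map (g := id)) ?map_id // => -[u v] /=; rewrite pK qK.
Qed.

Lemma graph_isob_trans : transitive graph_isob.
Proof.
move=> H G K /asboolP[p [q [bp bq pE cE]]] /asboolP[p' [q' [bp' bq' pE' cE']]].
apply/asboolP; exists (p' \o p), (q' \o q).
split; [exact: bij_comp | exact: bij_comp | | by rewrite cE'].
by rewrite (perm_trans pE') // (perm_trans (perm_map _ pE)) // -map_comp.
Qed.

Definition graph_equiv :=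
  EquivRel graph_isob graph_isob_refl graph_isob_sym graph_isob_trans.

Definition graph_class : Type := {eq_quot graph_equiv}.
HB.instance Definition _ := Choice.on graph_class.
HB.instance Definition _ := EqQuotient.on graph_class.

Definition class (G : graph) : graph_class := \pi_graph_class G.

Definition circle_graph (n : nat) : graph := @Graph ([::], n) isT.

Lemma union_trivalent (G H : graph) :
  trivalent (rename double double (edges G) ++
             rename (fun x => x.*2.+1) (fun x => x.*2.+1) (edges H)).
Proof.
have key (U V : seq nat) :
    all (fun u => count_mem u U == 3) U -> all (fun u => count_mem u V == 3) V ->
    all (fun u => count_mem u (map double U ++ map (fun x => x.*2.+1) V) == 3)
      (map double U ++ map (fun x => x.*2.+1) V).
  move=> /allP hU /allP hV; apply/allP => x; rewrite mem_cat count_cat !count_map.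
  case/orP => /mapP[y yU ->].
  - rewrite (eq_count (a2 := pred1 y)); last by move=> z /=; rewrite (inj_eq double_inj).
    rewrite (eqP (hU _ yU)) (eq_count (a2 := pred0)) ?count_pred0 // => z /=.
    by apply/negbTE/eqP => /(congr1 odd); rewrite /= !odd_double.
  - rewrite addnC (eq_count (a2 := pred1 y)); last first.
      by move=> z /=; rewrite eqSS (inj_eq double_inj).
    rewrite (eqP (hV _ yU)) (eq_count (a2 := pred0)) ?count_pred0 // => z /=.
    by apply/negbTE/eqP => /(congr1 odd); rewrite /= !odd_double.
case: G H => [[E k] tE] [[F l] tF]; rewrite /edges /=.
have [/andP[E1 E2] /andP[F1 F2]] := (tE, tF).
rewrite /trivalent /unzip1 /unzip2 !map_cat -!map_comp /=.
by move: (key _ _ E1 F1) (key _ _ E2 F2); rewrite /unzip1 /unzip2 -!map_comp => -> ->.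
Qed.

Definition disjoint_union (G H : graph) : graph :=
  @Graph (_, circles G + circles H)%N (union_trivalent G H).

Definition bigon (G : graph) (u v : nat) : bool :=
  (2 <= count_mem (u, v) (edges G))%N.

(* A 4-cycle u1 w1 u2 w2 with sources u1, u2 and sinks w1, w2. *)
Definition quadrilateral (G : graph) (u1 w1 u2 w2 : nat) : bool :=
  [&& u1 != u2, w1 != w2 &
      all (mem (edges G)) [:: (u1, w1); (u2, w1); (u2, w2); (u1, w2)]].

Definition remove_edges (es E : seq (nat * nat)) :=
  foldr (fun e E' => rem e E') E es.

Definition bigon_web (u v : nat) (G : seq (nat * nat) * nat) :=
  joins [:: (v, u)] (remove_edges [:: (u, v); (u, v)] G.1, G.2).

(* The half-edge left at w1 is joined to the one left at x1, and the one left
   at w2 to the one left at x2, where {x1, x2} = {u1, u2}. *)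
Definition quad_web (u1 w1 u2 w2 x1 x2 : nat) (G : seq (nat * nat) * nat) :=
  joins [:: (w1, x1); (w2, x2)]
    (remove_edges [:: (u1, w1); (u2, w1); (u2, w2); (u1, w2)] G.1, G.2).

Lemma remove_edges_perm es E R :
  perm_eq E (es ++ R) -> perm_eq (remove_edges es E) R.
Proof.
elim: es R => [|e es IH] R //= pE.
have /IH pR : perm_eq E (es ++ e :: R).
  by rewrite (perm_trans pE) // -cat1s (perm_catCA [:: e] es R).
by rewrite -(perm_cons e) (perm_trans _ pR) // perm_sym perm_to_rem // (perm_mem pR) mem_head.
Qed.

Lemma resolution_trivalent (es : seq (nat * nat)) js E k :
  trivalent E -> (forall e, count_mem e es <= count_mem e E)%N ->
  uniq (unzip1 js) -> uniq (unzip2 js) ->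
  perm_eq (unzip1 es) (unzip2 js ++ unzip2 js) ->
  perm_eq (unzip2 es) (unzip1 js ++ unzip1 js) ->
  trivalent (joins js (remove_edges es E, k)).1.
Proof.
move=> /andP[/allP t1 /allP t2] /count_subseqP[es' ses pes] u1 u2 p1 p2.
have [R pE'] := perm_to_subseq ses.
have {es' ses pes pE'} pE : perm_eq E (es ++ R).
  by rewrite (perm_trans pE') // perm_cat2r perm_sym.
have pR := remove_edges_perm pE; move: (remove_edges es E) pR => E' pR.
have c1 x : count_mem x (unzip1 E) =
    ((x \in unzip2 js).*2 + count_mem x (unzip1 E'))%N.
  rewrite (seq.permP (perm_map _ pE)) map_cat count_cat (seq.permP p1) count_cat.
  by rewrite (count_uniq_mem _ u2) addnn (seq.permP (perm_map _ pR)).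
have c2 x : count_mem x (unzip2 E) =
    ((x \in unzip1 js).*2 + count_mem x (unzip2 E'))%N.
  rewrite (seq.permP (perm_map _ pE)) map_cat count_cat (seq.permP p2) count_cat.
  by rewrite (count_uniq_mem _ u1) addnn (seq.permP (perm_map _ pR)).
have d1 x : x \in unzip2 js -> count_mem x (unzip1 E') = 1%N.
  move=> xj; have := c1 x; rewrite xj (eqP (t1 _ _)) => [[]//|].
  by rewrite (perm_mem (perm_map _ pE)) map_cat mem_cat (perm_mem p1) mem_cat xj.
have d2 x : x \in unzip1 js -> count_mem x (unzip2 E') = 1%N.
  move=> xj; have := c2 x; rewrite xj (eqP (t2 _ _)) => [[]//|].
  by rewrite (perm_mem (perm_map _ pE)) map_cat mem_cat (perm_mem p2) mem_cat xj.
have [|q1 q2] := joins_perm (E := E') k u1 u2.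
  by move=> j jjs; rewrite d1 ?d2 // map_f.
move: (joins js (E', k)).1 q1 q2 => F q1 q2.
apply/andP; split; apply/allP => x xF.
  have := c1 x; rewrite -(seq.permP q1) count_cat (count_uniq_mem _ u2).
  case: (boolP (x \in _)) => [xj|_] /=.
    have := d1 x xj; rewrite -(seq.permP q1) count_cat (count_uniq_mem _ u2) xj => -[/eqP].
    by rewrite -leqn0 leqNgt -has_count has_pred1 xF.
  rewrite !add0n => <-; apply: t1.
  by rewrite (perm_mem (perm_map _ pE)) map_cat mem_cat -(perm_mem (perm_map _ pR))
             -(perm_mem q1) mem_cat xF !orbT.
have := c2 x; rewrite -(seq.permP q2) count_cat (count_uniq_mem _ u1).
case: (boolP (x \in _)) => [xj|_] /=.
  have := d2 x xj; rewrite -(seq.permP q2) count_cat (count_uniq_mem _ u1) xj => -[/eqP].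
  by rewrite -leqn0 leqNgt -has_count has_pred1 xF.
rewrite !add0n => <-; apply: t2.
by rewrite (perm_mem (perm_map _ pE)) map_cat mem_cat -(perm_mem (perm_map _ pR))
           -(perm_mem q2) mem_cat xF !orbT.
Qed.

Lemma bigon_trivalent G u v : bigon G u v -> trivalent (bigon_web u v (web G)).1.
Proof.
move=> b; apply: resolution_trivalent => //; first exact: valP G.
move=> e /=; case: eqP => [<-|_]; last exact: leq0n.
by rewrite addn0; apply: b.
Qed.

Lemma quad_trivalent1 G u1 w1 u2 w2 :
  quadrilateral G u1 w1 u2 w2 ->
  trivalent (quad_web u1 w1 u2 w2 u1 u2 (web G)).1.
Proof.
case/and3P=> uu ww /allP sE; apply: resolution_trivalent; first exact: valP G.
- move=> e; rewrite count_uniq_mem.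
    by case: (boolP (e \in _)) => // /sE eE; rewrite -has_count has_pred1; apply: eE.
  by rewrite /= !inE /= !xpair_eqE !eqxx (negPf uu) (negPf ww)
             ?[u2 == u1]eq_sym ?[w2 == w1]eq_sym ?(negPf uu) ?(negPf ww) ?andbF.
- by rewrite /= inE ww.
- by rewrite /= inE uu.
- by apply/seq.permP => p /=; rewrite !addn0; case: (p u1); case: (p u2).
- by apply/seq.permP => p /=; rewrite !addn0; case: (p w1); case: (p w2).
Qed.

Lemma quad_trivalent2 G u1 w1 u2 w2 :
  quadrilateral G u1 w1 u2 w2 ->
  trivalent (quad_web u1 w1 u2 w2 u2 u1 (web G)).1.
Proof.
case/and3P=> uu ww /allP sE; apply: resolution_trivalent; first exact: valP G.
- move=> e; rewrite count_uniq_mem.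
    by case: (boolP (e \in _)) => // /sE eE; rewrite -has_count has_pred1; apply: eE.
  by rewrite /= !inE /= !xpair_eqE !eqxx (negPf uu) (negPf ww)
             ?[u2 == u1]eq_sym ?[w2 == w1]eq_sym ?(negPf uu) ?(negPf ww) ?andbF.
- by rewrite /= inE ww.
- by rewrite /= inE eq_sym uu.
- by apply/seq.permP => p /=; rewrite !addn0; case: (p u1); case: (p u2).
- by apply/seq.permP => p /=; rewrite !addn0; case: (p w1); case: (p w2).
Qed.

Definition resolve_bigon G u v (b : bigon G u v) : graph :=
  Graph (bigon_trivalent b).

Definition resolve_quad1 G u1 w1 u2 w2 (q : quadrilateral G u1 w1 u2 w2) : graph :=
  Graph (quad_trivalent1 q).

Definition resolve_quad2 G u1 w1 u2 w2 (q : quadrilateral G u1 w1 u2 w2) : graph :=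
  Graph (quad_trivalent2 q).

(* [inl u] is the source u and [inr v] the sink v. *)
Definition vertices (G : graph) : seq (nat + nat) :=
  map inl (unzip1 (edges G)) ++ map inr (unzip2 (edges G)).

Definition adjacent (G : graph) : rel (nat + nat) := fun x y =>
  match x, y with
  | inl u, inr v | inr v, inl u => (u, v) \in edges G
  | _, _ => false
  end.

Definition connected (G : graph) : Prop :=
  [/\ circles G = 0%N, vertices G != [::] &
      {in vertices G &, forall x y, exists2 p, path (adjacent G) x p & last x p = y}].

Definition irreducible_graph (G : graph) : Prop :=
  [/\ connected G, forall u v, ~~ bigon G u v &
      forall u1 w1 u2 w2, ~~ quadrilateral G u1 w1 u2 w2].

Definition irreducible_class : pred graph_class :=
  fun x => `[< irreducible_graph (repr x) >].

Definition irreducible : Type := {x : graph_class | irreducible_class x}.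
HB.instance Definition _ := Choice.on irreducible.

(* Polynomials over Z[A, A^-1] whose variables are the irreducible graphs. *)
Notation value := {malg laurent[{cmonom irreducible}]}.

Definition var (t : irreducible) : value := << ucm t >>.

Record kuperberg_evaluation (f : graph_class -> value) : Prop := {
  eval_empty : f (class (circle_graph 0)) = 1;
  eval_union : forall G H : graph,
    f (class (disjoint_union G H)) = f (class G) * f (class H);
  eval_irreducible : forall t : irreducible, f (val t) = var t;
  eval_loop : f (class (circle_graph 1)) = (Apow 6 + 1 + Apow (- 6)) *: 1;
  eval_bigon : forall (G : graph) u v (b : bigon G u v),
    f (class G) = (Apow 3 + Apow (- 3)) *: f (class (resolve_bigon b));
  eval_quad : forall (G : graph) u1 w1 u2 w2 (q : quadrilateral G u1 w1 u2 w2),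
    f (class G) = f (class (resolve_quad1 q)) + f (class (resolve_quad2 q))
}.

(* Every crossing is drawn with both strands going up.  The four half-edges at
    c are (c, (out, right)): [out] tells outgoing (top) from incoming (bottom)
    ones, [right] tells right from left.  The strand which enters on one side
    leaves on the other.  A crossing is positive when the strand going from
    bottom left to top right is over, and negative when the other one is. *)

Inductive crossing := Positive | Negative | Virtual.

Definition classical (k : crossing) : bool :=
  if k is Virtual then false else true.

Definition sign (k : crossing) : int :=
  match k with Positive => 1 | Negative => -1 | Virtual => 0 end.

(* [succ (c, b) = (d, b')] when an edge goes from the outgoing half-edge on side
   b of c to the incoming half-edge on side b' of d; [loose] counts the closed
   components without any crossing. *)
Record diagram := Diagram {
  ncross : nat;
  kind : 'I_ncross -> crossing;
  succ : {perm 'I_ncross * bool};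
  loose : nat
}.

Definition half (D : diagram) : finType := ('I_(ncross D) * (bool * bool))%type.

Definition mate (D : diagram) (h : half D) : half D :=
  let: (c, (out, side)) := h in
  if out then let i := succ D (c, side) in (i.1, (false, i.2))
  else let o := ((succ D)^-1)%g (c, side) in (o.1, (true, o.2)).

(* The next half-edge clockwise around the crossing. *)
Definition turn (D : diagram) (h : half D) : half D :=
  (h.1, (~~ h.2.2, h.2.1)).

Definition opposite (D : diagram) (h : half D) : half D :=
  (h.1, (~~ h.2.1, ~~ h.2.2)).

(* Walks along the boundary of the face on the left of the edge leaving by h. *)
Definition face (D : diagram) (h : half D) : half D := turn (mate h).

Definition neighbour (D : diagram) : rel 'I_(ncross D) := fun c d =>
  [exists h : half D, (h.1 == c) && ((mate h).1 == d)].

(* Euler's formula V - E + F = 2k, where E = 2V and k is the number of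
   connected components having a crossing. *)
Definition planar (D : diagram) : bool :=
  fcard (@face D) (half D) ==
    (ncross D + (n_comp (@neighbour D) 'I_(ncross D)).*2)%N.

Record virtual_diagram := VirtualDiagram { vdiag :> diagram; _ : planar vdiag }.

Section States.
Variable D : diagram.
Notation side := ('I_(ncross D) * bool)%type.

Definition wires : seq (side * side) * nat :=
  ([seq (o, succ D o) | o <- enum {: side}], loose D).

(* A state is given by the set s of the classical crossings which get the
   unoriented local state.  The oriented one joins the half-edges on the same
   side, and the strands of the virtual crossings go through. *)
Definition smoothings (s : {set 'I_(ncross D)}) : seq (side * side) :=
  [seq (i, if classical (kind i.1) then i else (i.1, ~~ i.2))
  | i <- enum {: side} & i.1 \notin s].

Definition state_web (s : {set 'I_(ncross D)}) : seq (nat * nat) * nat :=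
  let: (E, k) := joins (smoothings s) wires in
  (* (c, c) is the new edge from the source to the sink at c *)
  ([seq (val e.1.1, val e.2.1) | e <- E] ++ [seq (val c, val c) | c <- enum s], k).

Lemma state_trivalent s : trivalent (state_web s).1.
Proof.
rewrite /state_web /wires; set js := smoothings s.
pose g (i : side) : side := if classical (kind i.1) then i else (i.1, ~~ i.2).
have gK : involutive g.
  by move=> [c b]; rewrite /g /=; case cl: (classical (kind c)); rewrite /= cl ?negbK.
have j1 : unzip1 js = [seq i <- enum {: side} | i.1 \notin s].
  by rewrite /unzip1 -map_comp map_id.
have j2 : unzip2 js = [seq g i | i <- enum {: side} & i.1 \notin s].
  by rewrite /unzip2 -map_comp.
have u1 : uniq (unzip1 js) by rewrite j1 filter_uniq // enum_uniq.
have u2 : uniq (unzip2 js).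
  by rewrite j2 map_inj_uniq; [rewrite filter_uniq // enum_uniq | exact: inv_inj gK].
set E := [seq _ | o <- _].
have e1 : unzip1 E = enum {: side} by rewrite /unzip1 -map_comp map_id.
have e2 : perm_eq (unzip2 E) (enum {: side}).
  rewrite /unzip2 -map_comp; apply: uniq_perm; rewrite ?enum_uniq //.
    by rewrite map_inj_uniq ?enum_uniq //; exact: perm_inj.
  move=> x; rewrite mem_enum; apply/mapP; exists ((succ D)^-1 x)%g; rewrite ?mem_enum //.
  by rewrite /= permKV.
have [|q1 q2] := joins_perm (E := E) (loose D) u1 u2.
  move=> j _; rewrite e1 (seq.permP e2) !count_uniq_mem ?enum_uniq //.
  by rewrite !mem_enum.
case: (joins js _) q1 q2 => F k /= q1 q2.
have rest U (js' : seq side) : perm_eq (js' ++ U) (enum {: side}) ->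
    (forall x, (x \in js') = (x.1 \notin s)) ->
    all (fun v => count_mem v ([seq val x.1 | x <- U] ++ map val (enum s)) == 3)
      ([seq val x.1 | x <- U] ++ map val (enum s)).
  move=> pU js's.
  have uU : uniq (js' ++ U) by rewrite (perm_uniq pU) enum_uniq.
  have Us x : (x \in U) = (x.1 \in s).
    have := perm_mem pU x; rewrite mem_cat js's mem_enum inE.
    case: (boolP (x.1 \in s)) => //= xs _.
    apply/negbTE; move: uU; rewrite cat_uniq => /and3P[_ /hasPn h _].
    by apply/negP => /h; rewrite /= js's xs.
  have {}uU : uniq U by move: uU; rewrite cat_uniq => /and3P[].
  apply/allP => v vU; have [c cs ->] : exists2 c, c \in s & v = val c.
    move: vU; rewrite mem_cat => /orP[] /mapP[x]; rewrite ?Us ?mem_enum => xs ->.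
      by exists x.1.
    by exists x.
  have -> : 3 = (2 + 1)%N by [].
  rewrite count_cat !count_map; apply/eqP; congr (_ + _)%N; last first.
    rewrite (eq_count (a2 := pred1 c)); last by move=> z /=; rewrite (inj_eq val_inj).
    by rewrite count_uniq_mem ?enum_uniq // mem_enum cs.
  rewrite -size_filter.
  have /perm_size -> // : perm_eq
      [seq x <- U | preim (fun x => val x.1) (pred1 (val c)) x] [:: (c, true); (c, false)].
  apply: uniq_perm => [||[d b]]; [exact: filter_uniq | by rewrite /= inE xpair_eqE andbF | ].
  rewrite mem_filter Us !inE /= !xpair_eqE (inj_eq val_inj).
  by case: eqP => //= ->; rewrite cs; case: b.
rewrite /trivalent /unzip1 /unzip2 !map_cat -!map_comp /=.
have m1 x : (x \in unzip1 js) = (x.1 \notin s) by rewrite j1 mem_filter mem_enum andbT.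
have m2 x : (x \in unzip2 js) = (x.1 \notin s).
  rewrite j2 -[x in x \in _]gK mem_map; last exact: inv_inj gK.
  by rewrite mem_filter mem_enum andbT /g; case: classical.
rewrite e1 in q1.
have := rest _ _ q1 m2; have := rest _ _ (perm_trans q2 e2) m1.
by rewrite -!map_comp => -> ->.
Qed.

Definition state (s : {set 'I_(ncross D)}) : graph := Graph (state_trivalent s).

Definition weight (s : {set 'I_(ncross D)}) : laurent :=
  \prod_(c | classical (kind c))
    (if c \in s then - Apow (- sign (kind c)) else Apow (2 * sign (kind c))).

Definition writhe : int := \sum_(c : 'I_(ncross D) | classical (kind c)) sign (kind c).

Definition bracket (f : graph_class -> value) : value :=
  \sum_(s : {set 'I_(ncross D)} | s \subset [pred c | classical (kind c)])
    weight s *: f (class (state s)).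

Definition normalized_bracket (f : graph_class -> value) : value :=
  Apow (- 8 * writhe) *: bracket f.

End States.

Section Moves.
Implicit Types (D W : diagram) (K : virtual_diagram).

Definition over D (h : half D) : bool :=
  match kind h.1 with
  | Positive => h.2.1 == h.2.2
  | Negative => h.2.1 != h.2.2
  | Virtual => false
  end.

(* The wiring left when the crossings in P are forgotten, their strands going
   through. *)
Definition forget D (P : {set 'I_(ncross D)}) :=
  joins [seq (i, (i.1, ~~ i.2)) | i <- enum {: 'I_(ncross D) * bool} & i.1 \in P]
    (wires D).

(* phi identifies W with the (not necessarily planar) diagram obtained from D by
   forgetting the crossings in P. *)
Definition forgets D (P : {set 'I_(ncross D)}) W
    (phi : 'I_(ncross W) -> 'I_(ncross D)) : Prop :=
  [/\ injective phi, forall c, (c \in P) = (c \notin codom phi),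
      forall c, kind (phi c) = kind c,
      perm_eq (forget P).1
        [seq ((phi e.1.1, e.1.2), (phi e.2.1, e.2.2)) | e <- (wires W).1] &
      loose W = (forget P).2].

Definition isomorphic D W : Prop := exists phi, @forgets D set0 W phi.

(* h starts the boundary of an empty monogon at a classical crossing. *)
Definition move1 D W : Prop :=
  exists (h : half D) phi,
    [/\ face h = h, classical (kind h.1) & @forgets D [set h.1] W phi].

(* h starts the boundary of an empty bigon, whose two sides are on strands of
   which one is over the other twice. *)
Definition move2 D W : Prop :=
  exists (h : half D) phi, let h' := face h in
    [/\ h'.1 != h.1, face h' = h,
        classical (kind h.1) && classical (kind h'.1), over h = over (mate h) &
        @forgets D [set h.1; h'.1] W phi].

(* The strand through the edge of h meets its two ends in the other order. *)
Definition swap_ends D (h : half D) : {perm half D} :=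
  (tperm (opposite h) (mate h) * tperm h (opposite (mate h)))%g.

(* h starts the boundary of an empty triangle, and the strand containing that
   side is over the two others; each strand passes to the other side of the
   crossing of the two others. *)
Definition move3 D W : Prop :=
  exists (h : half D) (phi : 'I_(ncross D) -> 'I_(ncross W)),
    let h' := face h in let h'' := face h' in
    let swap := (swap_ends h * swap_ends h' * swap_ends h'')%g in
    [/\ uniq [:: h.1; h'.1; h''.1] /\ face h'' = h,
        all (fun x : half D => classical (kind x.1)) [:: h; h'; h''],
        over h && over (mate h),
        [/\ bijective phi, forall c, kind (phi c) = kind c & loose W = loose D] &
        forall x : half D,
          mate ((phi x.1, x.2) : half W) =
            (phi (swap (mate (swap x))).1, (swap (mate (swap x))).2)].

(* From an outgoing half-edge to the next one on the same strand. *)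
Definition advance D (o : 'I_(ncross D) * bool) : 'I_(ncross D) * bool :=
  ((succ D o).1, ~~ (succ D o).2).

(* The crossings met in k steps by the arc starting with the edge of o. *)
Definition arc_crossings D (o : 'I_(ncross D) * bool) (k : nat) :
    {set 'I_(ncross D)} :=
  [set (iter j.+1 (@advance D) o).1 | j : 'I_k].

(* P is the set of crossings on some closed component of the link. *)
Definition closed_component D (P : {set 'I_(ncross D)}) : Prop :=
  (P = set0 /\ (0 < loose D)%N) \/
  exists o, P = [set x.1 | x in fconnect (@advance D) o].

(* D and D' differ by the position of an arc which has only virtual crossings,
   P in D and P' in D'; W is the common wiring with this arc drawn without its
   crossings.  The second case moves a whole closed component, which amounts to
   detours of its arcs.

   Diagrams keep the cyclic order at crossings but not the relative position of
   the connected components of their underlying graphs, which detours change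
   arbitrarily. *)
Definition detour D D' : Prop :=
  exists (W : diagram) (P : {set 'I_(ncross D)}) (P' : {set 'I_(ncross D')}) phi phi',
    [/\ @forgets D P W phi, @forgets D' P' W phi',
        forall c, c \in P -> kind c = Virtual,
        forall c, c \in P' -> kind c = Virtual &
        (exists (o : 'I_(ncross W) * bool) k k',
           P = arc_crossings (phi o.1, o.2) k /\
           P' = arc_crossings (phi' o.1, o.2) k') \/
        (closed_component P /\ closed_component P')].

Definition move K K' : Prop :=
  [\/ isomorphic K K', move1 K K', move2 K K' | move3 K K' \/ detour K K'].

Definition virtually_equivalent : virtual_diagram -> virtual_diagram -> Prop :=
  clos_refl_sym_trans _ move.

End Moves.

(* Main.v *)
Require Import Defs.
From mathcomp Require Import all_boot all_fingroup all_order all_algebra zify.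
From mathcomp Require Import boolp generic_quotient.
From mathcomp.multinomials Require Import monalg.
Import Defs.

Set Implicit Arguments.
Unset Strict Implicit.
Unset Printing Implicit Defensive.

Import GRing.Theory.

(** Read from left to right, the bigon and quadrilateral relations lower the
    number of edges, and a web without bigons and quadrilaterals is a disjoint
    union of circles and of graphs of T.  So the relations determine the
    evaluation, by induction on the number of edges, and it exists as soon as
    the result does not depend on the order of the reductions.

    A solution of the relations on the webs with less than n edges
    ([valuation_below]) is extended to the webs with n edges by the value of any
    reduction ([valuation_extend]); two reductions of the same web give the same
    value ([reduction_confluent]).  When one of them splits the web into a
    disjoint union, this is multiplicativity below n; two redexes without common
    vertex can be resolved one after the other ([redex_disjoint]).  Otherwise
    they share an edge, because a vertex of degree 3 cannot have two edges in
    each of two sets of edges without common edge ([shared_source_edge]).  Up to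
    symmetry four overlaps remain: a bigon along a side of a quadrilateral, and
    two quadrilaterals with one side, or two sides ending at a common source or
    sink, in common.

    Each of these is an identity between two combinations of small webs with
    free ends inside an unknown web.  As a function of the small piece, the value
    of the whole web satisfies the relations ([glue_local]), so that the identity
    holds once both sides are reduced to the same combination of irreducible
    pieces, which is decided by computation ([vanishes], [vanishesP]).

    Invariance rests on the same principle.  A state of a diagram is a wiring
    with one of three tangles at each crossing: the oriented smoothing, the two
    strands going through, or the pair of vertices.  Strands which go through a
    crossing can be straightened ([wiring_value_forget]), so virtual crossings do
    not matter and detours change nothing.  For the other moves the sum over the
    states of the crossings involved, in the surrounding made of the rest of the
    diagram ([open_value_local]), is compared with the other side of the move by
    computation ([monogon_vanishes], [bigon_vanishes], [triangle_vanishes]); the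
    kink of the first move contributes the factor A^(8 e) that the writhe
    compensates, where e is the sign of the crossing.  In the third move, both
    diagrams have the same surrounding once the half-edges of the triangle are
    exchanged. *)

(** * Joining the ends of edges *)

Lemma perm_swap_head (X : eqType) (x y : X) s : perm_eq (x :: y :: s) (y :: x :: s).
Proof. by apply/seq.permP => a /=; rewrite addnCA. Qed.

Section JoinAlgebra.
Variables S T : eqType.
Implicit Types (E F R : seq (S * T)) (G H : seq (S * T) * nat) (j : T * S).

(** The order in which edges are listed is immaterial, and [join] is compatible
    with it only up to permutation. *)
Definition same_web G H : Prop := perm_eq G.1 H.1 /\ G.2 = H.2.

Lemma same_web_refl G : same_web G G.
Proof. by split. Qed.

Lemma same_web_sym G H : same_web G H -> same_web H G.
Proof. by case=> p e; split; rewrite 1?perm_sym. Qed.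

Lemma same_web_trans G H K : same_web G H -> same_web H K -> same_web G K.
Proof. by case=> p e [p' e']; split; [exact: perm_trans p'|rewrite e]. Qed.

(** The precondition under which [join] is meaningful: both ends exist and are
    unique. *)
Definition joinable j E :=
  (count_mem j.2 (unzip1 E) == 1) && (count_mem j.1 (unzip2 E) == 1).

Lemma joinable_perm j E F : perm_eq E F -> joinable j E = joinable j F.
Proof. by move=> p; rewrite /joinable !(seq.permP (perm_map _ p)). Qed.

Lemma filter_join u w R : u \notin unzip1 R -> w \notin unzip2 R ->
  [seq e <- R | (e.1 != u) && (e.2 != w)] = R.
Proof.
move=> uR wR; apply/all_filterP/allP => e eR; apply/andP; split.
  by apply: contraNneq uR => <-; rewrite map_f.
by apply: contraNneq wR => <-; rewrite map_f.
Qed.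

Lemma filter_tail u R : u \notin unzip1 R -> [seq e <- R | e.1 == u] = [::].
Proof.
move=> uR; apply/eqP; rewrite -[_ == _]negbK -has_filter.
by apply: contra uR => /hasP[e eR /eqP <-]; exact: map_f.
Qed.

Lemma filter_head w R : w \notin unzip2 R -> [seq e <- R | e.2 == w] = [::].
Proof.
move=> wR; apply/eqP; rewrite -[_ == _]negbK -has_filter.
by apply: contra wR => /hasP[e eR /eqP <-]; exact: map_f.
Qed.

Lemma join_circle u w R k : u \notin unzip1 R -> w \notin unzip2 R ->
  join (w, u) ((u, w) :: R, k) = (R, k.+1).
Proof. by move=> uR wR; rewrite /= mem_head !eqxx /= filter_join. Qed.

Lemma join_link u w x y R k :
  u \notin unzip1 R -> w \notin unzip2 R -> x != u -> y != w ->
  join (w, u) ((x, w) :: (u, y) :: R, k) = ((x, y) :: R, k).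
Proof.
move=> uR wR xu yw; rewrite /= !eqxx (negPf xu) (negPf yw) /= ?andbF /=.
rewrite filter_join // ifN //.
rewrite !inE !xpair_eqE !eqxx (eq_sym u) (negPf xu) (eq_sym w) (negPf yw) /=.
by apply: contra uR => uwR; apply/mapP; exists (u, w).
Qed.

Lemma join_perm_eq j E F k : joinable j E -> perm_eq E F ->
  same_web (join j (E, k)) (join j (F, k)).
Proof.
case: j => w u /andP[/eqP /= cu /eqP cw] pEF; rewrite /= (perm_mem pEF).
case: ifP => _; split=> //=; first exact: perm_filter.
have head_eq (X : eqType) (x0 : X) a b : size a = 1 -> perm_eq a b -> head x0 a = head x0 b.
  by move=> sa pab; rewrite (perm_small_eq _ pab) // -(perm_size pab) sa.
rewrite (head_eq _ _ _ [seq e.1 | e <- F & e.2 == w]); first last.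
- exact/perm_map/perm_filter.
- by rewrite size_map size_filter -cw count_map.
rewrite (head_eq _ w _ [seq e.2 | e <- F & e.1 == u]); first last.
- exact/perm_map/perm_filter.
- by rewrite size_map size_filter -cu count_map.
by rewrite perm_cons perm_filter.
Qed.

Lemma join_cat j E F k : j.2 \notin unzip1 F -> j.1 \notin unzip2 F ->
  join j (E ++ F, k) = ((join j (E, k)).1 ++ F, (join j (E, k)).2).
Proof.
case: j => w u /= uF wF; rewrite !filter_cat.
rewrite (filter_join uF wF) (filter_tail uF) (filter_head wF).
rewrite !cats0 mem_cat.
have /negPf -> : (u, w) \notin F by apply: contra uF => uwF; apply/mapP; exists (u, w).
by rewrite orbF; case: ifP.
Qed.

Lemma join_loops j E k :
  join j (E, k) = ((join j (E, 0)).1, k + (join j (E, 0)).2).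
Proof. by case: j => w u /=; case: ifP; rewrite ?addn0 ?addn1. Qed.

Arguments join : simpl never.
Arguments joins : simpl never.

Lemma joins_loops js E k :
  joins js (E, k) = ((joins js (E, 0)).1, k + (joins js (E, 0)).2).
Proof.
elim: js => [|j js IH]; first by rewrite /joins /= addn0.
rewrite -![joins (j :: js) _]/(join j (joins js _)) IH; case: (joins js (E, 0)) => E' k' /=.
by rewrite join_loops (join_loops _ E' k') /= addnA.
Qed.

Lemma joins_cons j js G : joins (j :: js) G = join j (joins js G).
Proof. by []. Qed.

Lemma joins_catl js js' G : joins (js ++ js') G = joins js (joins js' G).
Proof. exact: foldr_cat. Qed.

(** Either the two ends belong to the same edge, which closes up, or two
    distinct edges become one. *)
Lemma join_unlinked j E : joinable j E ->
  (exists R, [/\ perm_eq E ((j.2, j.1) :: R), j.2 \notin unzip1 R & j.1 \notin unzip2 R])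
  \/ exists x y R, [/\ perm_eq E ((x, j.1) :: (j.2, y) :: R),
       j.2 \notin unzip1 R, j.1 \notin unzip2 R, x != j.2 & y != j.1].
Proof.
case: j => w u /andP[/eqP /= cu /eqP cw].
have [[u' y] [R [pR /= ue uR]]] := count1_split cu; subst u'.
have cw' : count_mem w (unzip2 ((u, y) :: R)) = 1.
  by rewrite -(seq.permP (perm_map _ pR)).
move: cw' => /=; case: (eqVneq y w) => [yw|yw].
  rewrite add1n => -[/eqP]; rewrite -leqn0 leqNgt -has_count has_pred1 => wR.
  by left; exists R; rewrite -yw in wR *.
rewrite add0n => /count1_split[[x w'] [R' [pR' /= we wR']]]; subst w'.
right; exists x, y, R'; split=> //.
- by rewrite (perm_trans pR) // perm_sym (perm_trans (perm_swap_head _ _ _)) // perm_cons perm_sym.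
- by apply: contra uR => uR'; rewrite (perm_mem (perm_map _ pR')) inE uR' orbT.
- by apply: contraNneq uR => <-; rewrite (perm_mem (perm_map _ pR')) mem_head.
Qed.


Lemma join_circle_perm u w E R k : u \notin unzip1 R -> w \notin unzip2 R ->
  perm_eq E ((u, w) :: R) -> same_web (join (w, u) (E, k)) (R, k.+1).
Proof.
move=> uR wR pE; rewrite -(join_circle k uR wR); apply: join_perm_eq => //.
by rewrite (joinable_perm _ pE) /joinable /= !eqxx (count_memPn uR) (count_memPn wR).
Qed.

Lemma join_link_perm u w x y E R k :
  u \notin unzip1 R -> w \notin unzip2 R -> x != u -> y != w ->
  perm_eq E ((x, w) :: (u, y) :: R) -> same_web (join (w, u) (E, k)) ((x, y) :: R, k).
Proof.
move=> uR wR xu yw pE; rewrite -(join_link k uR wR xu yw); apply: join_perm_eq => //.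
rewrite (joinable_perm _ pE) /joinable /= !eqxx (count_memPn uR) (count_memPn wR).
by rewrite (negPf xu) (negPf yw).
Qed.

Lemma join_same_web j G H : joinable j G.1 -> same_web G H ->
  same_web (join j G) (join j H).
Proof. by case: G H => [E k] [F l] /= jE [/= pEF <-]; exact: join_perm_eq. Qed.

Lemma join_step j G H K : same_web G H -> joinable j G.1 -> same_web (join j H) K ->
  same_web (join j G) K.
Proof. by move=> sw jG; apply: same_web_trans; exact: join_same_web. Qed.

Lemma join_tails j E k : joinable j E ->
  perm_eq (j.2 :: unzip1 (join j (E, k)).1) (unzip1 E).
Proof. by move=> /andP[/eqP c1 /eqP c2]; case: (join_perm k c1 c2). Qed.

Lemma join_heads j E k : joinable j E ->
  perm_eq (j.1 :: unzip2 (join j (E, k)).1) (unzip2 E).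
Proof. by move=> /andP[/eqP c1 /eqP c2]; case: (join_perm k c1 c2). Qed.

Lemma joinable_join j j' E k : joinable j E -> joinable j' E ->
  j.1 != j'.1 -> j.2 != j'.2 -> joinable j' (join j (E, k)).1.
Proof.
move=> jE j'E n1 n2; move: (j'E); rewrite /joinable.
rewrite -(seq.permP (join_tails k jE)) -(seq.permP (join_heads k jE)) /=.
by rewrite (negPf n1) (negPf n2).
Qed.

Lemma perm_to_front (X : eqType) (x : X) s : x \in s -> exists r, perm_eq s (x :: r).
Proof. by move=> xs; exists (rem x s); exact: perm_to_rem. Qed.

Lemma join_comm_circle j1 j2 E R k :
  joinable j1 E -> j1.1 != j2.1 -> j1.2 != j2.2 ->
  perm_eq E ((j2.2, j2.1) :: R) -> j2.2 \notin unzip1 R -> j2.1 \notin unzip2 R ->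
  same_web (join j1 (join j2 (E, k))) (join j2 (join j1 (E, k))).
Proof.
case: j1 j2 => w1 u1 [w2 u2] /= j1E n1 n2 pE u2R w2R.
have j1R : joinable (w1, u1) R.
  move: j1E; rewrite (joinable_perm _ pE) /joinable /=.
  by rewrite (eq_sym u2) (eq_sym w2) (negPf n1) (negPf n2).
have c := join_circle_perm k u2R w2R pE.
apply: same_web_trans (_ : same_web _ (join (w1, u1) (R, k.+1))) _.
  apply: join_same_web => //; apply: (joinable_join (j := (w2, u2))) => //=; rewrite 1?eq_sym //.
  by rewrite (joinable_perm _ pE) /joinable /= !eqxx (count_memPn u2R) (count_memPn w2R).
apply: same_web_sym.
have sw : same_web (join (w1, u1) (E, k)) (join (w1, u1) (R ++ [:: (u2, w2)], k)).
  by apply: join_perm_eq => //; rewrite (perm_trans pE) // perm_sym perm_catC.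
move: sw; rewrite join_cat /=; [|by rewrite inE ..].
rewrite -/(join (w1, u1) (E, k)) -/(join (w1, u1) (R, k)) -/(join (w1, u1) (R, k.+1)).
rewrite (join_loops _ R k.+1) (join_loops _ R k).
have := join_tails 0 j1R; have := join_heads 0 j1R.
case: (join (w1, u1) (E, k)) => E' k'; case: (join (w1, u1) (R, 0)) => R' k2 /= pt ph [/= pE' ->].
rewrite addSn; apply: join_circle_perm.
- by apply: contra u2R; rewrite -(perm_mem ph) inE => ->; rewrite orbT.
- by apply: contra w2R; rewrite -(perm_mem pt) inE => ->; rewrite orbT.
- by rewrite (perm_trans pE') // perm_catC.
Qed.


Lemma fresh_count (X : eqType) (x : X) s : (x \notin s) = (count_mem x s == 0).
Proof. by rewrite -has_pred1 has_count -leqNgt leqn0. Qed.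


(** The cases are the possible positions of the four ends: on one or two edges
    that close up, on a path of three edges, or on four distinct edges. *)
Lemma join_comm j1 j2 E k :
  joinable j1 E -> joinable j2 E -> j1.1 != j2.1 -> j1.2 != j2.2 ->
  same_web (join j1 (join j2 (E, k))) (join j2 (join j1 (E, k))).
Proof.
case: j1 j2 => w1 u1 [w2 u2] j1E j2E /= n1 n2.
case: (join_unlinked j2E) => [[R [pE u2R w2R]]|].
  exact: (@join_comm_circle (w1, u1) (w2, u2) E R).
case: (join_unlinked j1E) => [[R [pE u1R w1R]] _|].
  by apply: same_web_sym; apply: (@join_comm_circle (w2, u2) (w1, u1) E R); rewrite // eq_sym.
move=> /= [x1 [y1 [R1 [p1 u1R w1R xu1 yw1]]]] [x2 [y2 [R2 [p2 u2R w2R xu2 yw2]]]].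
(* Three edges forming a path, where both orders give the edge from x to y. *)
have pathE w u w' u' x y R : joinable (w, u) E -> joinable (w', u') E ->
    w != w' -> u != u' -> perm_eq E ((u, w') :: (u', y) :: (x, w) :: R) ->
    same_web (join (w, u) (join (w', u') (E, k))) ((x, y) :: R, k) /\
    same_web (join (w', u') (join (w, u) (E, k))) ((x, y) :: R, k).
  move=> jE jE' nw nu pE.
  have:= jE; rewrite (joinable_perm _ pE) => /andP[/eqP /= c1 /eqP /= c2].
  have:= jE'; rewrite (joinable_perm _ pE) => /andP[/eqP /= c3 /eqP /= c4].
  rewrite eqxx (eq_sym u') (negPf nu) in c1; rewrite eqxx (eq_sym w') (negPf nw) in c2.
  rewrite eqxx (negPf nu) in c3; rewrite eqxx (negPf nw) in c4.
  have [xu uR xu' uR'] : [/\ x != u, u \notin unzip1 R, x != u' & u' \notin unzip1 R].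
    by rewrite !fresh_count; move: c1 c3; clear; split; lia.
  have [yw wR yw' wR'] : [/\ y != w, w \notin unzip2 R, y != w' & w' \notin unzip2 R].
    by rewrite !fresh_count; move: c2 c4; clear; split; lia.
  split.
    have s1 : same_web (join (w', u') (E, k)) ((u, y) :: (x, w) :: R, k).
      by apply: join_link_perm pE; rewrite //= inE negb_or ?wR' ?uR' eq_sym ?xu' ?nw.
    apply: (join_step s1).
      by apply: joinable_join => //; rewrite eq_sym.
    by apply: join_link_perm (perm_swap_head _ _ _).
  have s1 : same_web (join (w, u) (E, k)) ((x, w') :: (u', y) :: R, k).
    apply: join_link_perm; last by rewrite (perm_trans pE) // (perm_catC [:: _; _] (_ :: _)) /= perm_cons; apply/permPl/perm_catC.
    - by rewrite /= inE negb_or nu.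
    - by rewrite /= inE negb_or eq_sym yw.
    - by [].
    - by rewrite eq_sym.
  apply: (join_step s1); first exact: joinable_join.
  by apply: join_link_perm.
have u1E : (u1, y1) \in E by rewrite (perm_mem p1) !inE eqxx ?orbT.
have w1E : (x1, w1) \in E by rewrite (perm_mem p1) !inE eqxx.
move: u1E w1E; rewrite !(perm_mem p2) !inE !xpair_eqE (negPf n1) (negPf n2) /= !andbF ?orbF /=.
have nu' : u2 != u1 by rewrite eq_sym.
have nw' : w2 != w1 by rewrite eq_sym.
have := j1E; rewrite (joinable_perm _ p2) => /andP[/eqP /= c1 /eqP /= c2].
have := j2E; rewrite (joinable_perm _ p2) => /andP[/eqP /= c3 /eqP /= c4].
case/orP => [/andP[/eqP e1 /eqP e2]|u1R2]; case/orP => [/andP[/eqP e3 /eqP e4]|w1R2].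
- rewrite -e1 -e4 in p2 c1 c2.
  have [u1R2 w1R2] : u1 \notin unzip1 R2 /\ w1 \notin unzip2 R2 by rewrite !fresh_count; move: c1 c2; rewrite !eqxx; clear; split; lia.
  have s1 : same_web (join (w2, u2) (E, k)) ((u1, w1) :: R2, k) by apply: join_link_perm p2.
  have s2 : same_web (join (w1, u1) (E, k)) ((u2, w2) :: R2, k).
    by apply: join_link_perm; last by rewrite (perm_trans p2) // perm_swap_head.
  apply: (join_step s1); first exact: joinable_join.
  rewrite join_circle //; apply: same_web_sym.
  apply: (join_step s2); first exact: joinable_join.
  by rewrite join_circle.
- rewrite -e1 in p2.
  have [R pR] := perm_to_front w1R2.
  case: (pathE w1 u1 w2 u2 x1 y2 R) => //.
    by rewrite (perm_trans p2) // !perm_cons.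
  by move=> h1 h2; apply: same_web_trans h1 (same_web_sym h2).
- rewrite -e4 in p2.
  have [R pR] := perm_to_front u1R2.
  case: (pathE w2 u2 w1 u1 x2 y1 R) => //.
    by apply/seq.permP => a; rewrite (seq.permP p2) /= (seq.permP pR) /=; clear; lia.
  by move=> h1 h2; apply: same_web_trans h2 (same_web_sym h1).
have [R' pR'] := perm_to_front u1R2.
have [R pR] : exists R, perm_eq R' ((x1, w1) :: R).
  apply: perm_to_front; move: w1R2; rewrite (perm_mem pR') inE xpair_eqE.
  by rewrite (negPf xu1).
have pE : perm_eq E ((x2, w2) :: (u2, y2) :: (x1, w1) :: (u1, y1) :: R).
  by apply/seq.permP => a; rewrite (seq.permP p2) /= (seq.permP pR') /= (seq.permP pR) /=; clear; lia.
have := j1E; rewrite (joinable_perm _ pE) => /andP[/eqP /= d1 /eqP /= d2].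
have := j2E; rewrite (joinable_perm _ pE) => /andP[/eqP /= d3 /eqP /= d4].
rewrite !eqxx in d1 d2 d3 d4.
(* Four distinct edges. *)
have link w u w' u' x y x' y' :
    [/\ x' != u, x != u', y' != w & y != w'] -> u' != u -> w' != w ->
    u \notin unzip1 R -> w \notin unzip2 R -> u' \notin unzip1 R -> w' \notin unzip2 R ->
    joinable (w, u) E -> joinable (w', u') E -> x != u -> y != w -> x' != u' -> y' != w' ->
    perm_eq E ((x', w') :: (u', y') :: (x, w) :: (u, y) :: R) ->
    same_web (join (w, u) (join (w', u') (E, k))) ((x, y) :: (x', y') :: R, k).
  move=> [n3 n4 n5 n6] uu ww uR wR u'R w'R jE j'E xu yw xu' yw' qE.
  have s1 : same_web (join (w', u') (E, k)) ((x', y') :: (x, w) :: (u, y) :: R, k).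
    apply: join_link_perm qE; rewrite //= !inE !negb_or ?u'R ?w'R ?uu ?ww ?andbT.
      by rewrite eq_sym.
    by rewrite eq_sym.
  apply: (join_step s1).
    exact: joinable_join.
  apply: join_link_perm => //; rewrite /= ?inE ?negb_or ?uR ?wR 1?eq_sym ?n3 ?n5 //.
  by apply/seq.permP => a /=; clear; lia.
have [f1 f2 f3 f4] : [/\ x2 != u1, u1 \notin unzip1 R, x1 != u2 & u2 \notin unzip1 R].
  by rewrite !fresh_count; move: d1 d3; clear; split; lia.
have [f5 f6 f7 f8] : [/\ y2 != w1, w1 \notin unzip2 R, y1 != w2 & w2 \notin unzip2 R].
  by rewrite !fresh_count; move: d2 d4; clear; split; lia.
apply: same_web_trans (_ : same_web _ ((x1, y1) :: (x2, y2) :: R, k)) _.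
  exact: link.
apply: same_web_sym; apply: same_web_trans (_ : same_web _ ((x2, y2) :: (x1, y1) :: R, k)) _.
  apply: link => //.
  by apply/seq.permP => a; rewrite (seq.permP pE) /=; clear; lia.
by split=> //=; exact: perm_swap_head.
Qed.

End JoinAlgebra.

Arguments join : simpl never.
Arguments joins : simpl never.

Section JoinsAlgebra.
Variables S T : eqType.
Implicit Types (E F R : seq (S * T)) (G H : seq (S * T) * nat) (j : T * S) (js : seq (T * S)).

Definition all_joinable js E :=
  [&& uniq (unzip1 js), uniq (unzip2 js) & all (fun j => joinable j E) js].

Lemma all_joinable_perm js E F : perm_eq E F -> all_joinable js E = all_joinable js F.
Proof.
by move=> p; rewrite /all_joinable; do 2 congr (_ && _); apply: eq_all => j; exact: joinable_perm.
Qed.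

Lemma all_joinable_permj js js' E : perm_eq js js' -> all_joinable js E = all_joinable js' E.
Proof.
move=> p; rewrite /all_joinable; rewrite (perm_uniq (perm_map _ p)) (perm_uniq (perm_map _ p)).
by rewrite (perm_all _ p).
Qed.

Lemma joins_ends js E k : all_joinable js E ->
  perm_eq (unzip2 js ++ unzip1 (joins js (E, k)).1) (unzip1 E) /\
  perm_eq (unzip1 js ++ unzip2 (joins js (E, k)).1) (unzip2 E).
Proof.
case/and3P=> u1 u2 /allP h; apply: joins_perm => // j /h /andP[/eqP -> /eqP ->].
by [].
Qed.

Lemma all_joinable_cat js1 js2 E k : all_joinable (js1 ++ js2) E ->
  all_joinable js2 E /\ all_joinable js1 (joins js2 (E, k)).1.
Proof.
case/and3P; rewrite /unzip1 /unzip2 !map_cat !cat_uniq all_cat.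
move=> /and3P[u1 /hasPn d1 u1'] /and3P[u2 /hasPn d2 u2'] /andP[/allP a1 a2].
have ok2 : all_joinable js2 E by rewrite /all_joinable u1' u2'.
split=> //; rewrite /all_joinable u1 u2; apply/allP => j jj.
have := a1 _ jj; case: (joins_ends k ok2) => p1 p2; rewrite /joinable.
rewrite -(seq.permP p1) -(seq.permP p2) !count_cat.
rewrite (count_memPn (_ : j.2 \notin _)) ?add0n; last first.
  by apply/negP => /d2; rewrite /= map_f.
rewrite (count_memPn (_ : j.1 \notin _)) ?add0n //.
by apply/negP => /d1; rewrite /= map_f.
Qed.

Lemma joins_same_web js G H : all_joinable js G.1 -> same_web G H ->
  same_web (joins js G) (joins js H).
Proof.
case: G => E k; elim: js => [|j js IH] //= ok sw.
have [okj okjs] := @all_joinable_cat [:: j] js E k ok.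
apply: join_same_web; last exact: IH.
by case/and3P: okjs => _ _ /=; rewrite andbT.
Qed.

Lemma joins_front a j b G : all_joinable (a ++ j :: b) G.1 ->
  same_web (joins (a ++ j :: b) G) (joins (j :: a ++ b) G).
Proof.
case: G => E k; elim: a => [|x a IH] ok; first exact: same_web_refl.
have [ok1 ok2] := @all_joinable_cat [:: x] (a ++ j :: b) E k ok.
apply: (same_web_trans (H := join x (joins (j :: a ++ b) (E, k)))).
  by apply: join_same_web (IH ok1); case/and3P: ok2 => _ _ /=; rewrite andbT.
have pj : perm_eq (x :: a ++ j :: b) ([:: x; j] ++ (a ++ b)).
  by rewrite /= perm_cons perm_catC /= perm_cons perm_catC.
have ok3 : all_joinable ([:: x; j] ++ (a ++ b)) E by rewrite -(all_joinable_permj _ pj).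
have [_] := all_joinable_cat k ok3.
rewrite !joins_cons; case: (joins _ _) => E' k'; case/and3P=> /= n1 n2 /and3P[h1 h2 _].
by apply: join_comm => //; [move: n1|move: n2]; rewrite /= inE andbT.
Qed.

Lemma joins_perm_eq js js' G : perm_eq js js' -> all_joinable js G.1 ->
  same_web (joins js G) (joins js' G).
Proof.
case: G => E k; elim: js js' => [|j js IH] js' pj ok.
  by have /perm_nilP -> : perm_eq js' [::]; rewrite 1?perm_sym.
have jj' : j \in js' by rewrite -(perm_mem pj) mem_head.
move: pj; case/splitPr: jj' => a b pj.
have pj' : perm_eq js (a ++ b).
  by move: pj; rewrite perm_sym -cat1s perm_catCA /= perm_cons perm_sym.
have ok' : all_joinable (a ++ j :: b) E by rewrite -(all_joinable_permj _ pj).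
have [ok1 ok2] := @all_joinable_cat [:: j] js E k ok.
apply: same_web_trans (same_web_sym (joins_front _)) => //=.
apply: join_same_web; last exact: IH.
by case/and3P: ok2 => _ _ /=; rewrite andbT.
Qed.

(** A frame rule: edges without joined ends are carried along. *)
Lemma joins_cat js E F k :
  (forall j, j \in js -> (j.2 \notin unzip1 F) && (j.1 \notin unzip2 F)) ->
  joins js (E ++ F, k) = ((joins js (E, k)).1 ++ F, (joins js (E, k)).2).
Proof.
elim: js => [|j js IH] // h; rewrite !joins_cons IH; last first.
  by move=> i ij; apply: h; rewrite inE ij orbT.
case: (joins js (E, k)) => E' k'; have /andP[h1 h2] := h j (mem_head _ _).
exact: join_cat.
Qed.

Lemma size_joins js E k : all_joinable js E ->
  size (joins js (E, k)).1 + size js = size E.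
Proof.
move=> ok; case: (joins_ends k ok) => /perm_size + _.
by rewrite size_cat !size_map addnC.
Qed.

End JoinsAlgebra.

Section Relabel.
Variables S T S' T' : eqType.
Implicit Types (p : S -> S') (q : T -> T') (E : seq (S * T)).

Definition relabel p q E := [seq (p e.1, q e.2) | e <- E].
Definition relabel_joins p q (js : seq (T * S)) := [seq (q j.1, p j.2) | j <- js].

Lemma relabel_join p q w u E k :
  (forall x, p x = p u -> x = u) -> (forall x, q x = q w -> x = w) ->
  join (q w, p u) (relabel p q E, k) =
    (relabel p q (join (w, u) (E, k)).1, (join (w, u) (E, k)).2).
Proof.
move=> pu qw; rewrite /join.
have pE x : (p x == p u) = (x == u) by apply/eqP/eqP => [/pu|->].
have qE x : (q x == q w) = (x == w) by apply/eqP/eqP => [/qw|->].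
have -> : ((p u, q w) \in relabel p q E) = ((u, w) \in E).
  apply/mapP/idP => [[[x y] xyE [/esym/pu e1 /esym/qw e2]]|h]; last by exists (u, w).
  by rewrite -e1 -e2.
have fE : [seq e <- relabel p q E | (e.1 != p u) && (e.2 != q w)] =
    relabel p q [seq e <- E | (e.1 != u) && (e.2 != w)].
  by rewrite filter_map; congr map; apply: eq_filter => e /=; rewrite pE qE.
case: ifP => _ /=; rewrite fE //; congr (_ :: _, _); congr (_, _).
  rewrite filter_map -map_comp (eq_filter (a2 := fun e : S * T => e.2 == w)); last first.
    by move=> e /=; rewrite qE.
  by case: [seq e <- E | e.2 == w].
rewrite filter_map -map_comp (eq_filter (a2 := fun e : S * T => e.1 == u)); last first.
  by move=> e /=; rewrite pE.
by case: [seq e <- E | e.1 == u].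
Qed.

(** Names may be identified by p and q, provided that no other name is sent to
    the image of a joined one. *)
Lemma relabel_joins_web p q js E k :
  (forall j, j \in js -> (forall x, p x = p j.2 -> x = j.2) /\
                        (forall y, q y = q j.1 -> y = j.1)) ->
  joins (relabel_joins p q js) (relabel p q E, k) =
    (relabel p q (joins js (E, k)).1, (joins js (E, k)).2).
Proof.
elim: js => [|[w u] js IH] // h; rewrite [relabel_joins _ _ _]/= !joins_cons IH; last first.
  by move=> i ij; apply: h; rewrite inE ij orbT.
case: (joins js (E, k)) => E' k'; have [/= h1 h2] := h (w, u) (mem_head _ _).
exact: relabel_join.
Qed.

End Relabel.

Section Absorb.
Variables S T : eqType.
Implicit Types (E : seq (S * T)).

(** A stub (t, y) whose tail is joined to the end w only replaces the name w by
    y. *)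
Lemma absorb_head w t y E k : t \notin unzip1 E -> count_mem w (unzip2 E) = 1 -> y != w ->
  same_web (join (w, t) ((t, y) :: E, k)) ([seq (e.1, if e.2 == w then y else e.2) | e <- E], k).
Proof.
move=> tE /count1_split[[x w'] [R [pE /= e wR]]] yw; subst w'.
apply: same_web_trans (_ : same_web _ ((x, y) :: R, k)) _.
  apply: join_link_perm => //.
  - by apply: contra tE => tR; rewrite (perm_mem (perm_map _ pE)) inE tR orbT.
  - by apply: contraNneq tE => <-; rewrite (perm_mem (perm_map _ pE)) mem_head.
  - by apply/seq.permP => a /=; rewrite (seq.permP pE) /=; lia.
split=> //=; rewrite perm_sym (perm_trans (perm_map _ pE)) //= eqxx perm_cons.
rewrite (eq_in_map _ id _).1 ?map_id // => -[a b] abR /=.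
by rewrite ifN //; apply: contraNneq wR => <-; apply/mapP; exists (a, b).
Qed.

Lemma absorb_joinable (A : eqType) (s : seq A) (w : A -> T) (t : A -> S) (y : A -> T) E :
  uniq (map w s) -> uniq (map t s) ->
  (forall a, a \in s -> [/\ t a \notin unzip1 E, count_mem (w a) (unzip2 E) = 1 &
      y a \notin map w s]) ->
  all_joinable [seq (w a, t a) | a <- s] ([seq (t a, y a) | a <- s] ++ E).
Proof.
move=> uw ut h; rewrite /all_joinable /unzip1 /unzip2 -!map_comp uw ut /=.
apply/allP => _ /mapP[a as_ ->]; have [tE cE ya] := h a as_.
rewrite /joinable /= /unzip1 /unzip2 !map_cat -!map_comp !count_cat.
rewrite (count_memPn tE) cE (count_uniq_mem _ ut) map_f // (count_memPn _) //.
by apply/mapP => -[b bs /= e]; have [_ _] := h b bs; rewrite -e map_f.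
Qed.

(** Joining a stub to each of the heads w a amounts to renaming w a into y a.
    Webs are cut open and tangles are plugged in through such stubs. *)
Lemma absorb_heads (A : eqType) (s : seq A) (w : A -> T) (t : A -> S) (y : A -> T) (q : T -> T) E k :
  uniq (map w s) -> uniq (map t s) ->
  (forall a, a \in s -> [/\ t a \notin unzip1 E, count_mem (w a) (unzip2 E) = 1,
      y a \notin map w s & q (w a) = y a]) ->
  (forall z, z \notin map w s -> q z = z) ->
  same_web (joins [seq (w a, t a) | a <- s] ([seq (t a, y a) | a <- s] ++ E, k))
    (relabel id q E, k).
Proof.
elim: s q E k => [|a s IH] q E k /=.
  move=> _ _ _ qz; split=> //=; rewrite /relabel (eq_map (g := id)) ?map_id // => -[x z] /=.
  by rewrite qz.
move=> /andP[wa uw] /andP[ta ut] h qz.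
(* The stubs of s are absorbed first, while w a keeps its name. *)
pose q' z := if z == w a then z else q z.
have [tE cE ya qa] := h a (mem_head _ _).
have ih : same_web (joins [seq (w b, t b) | b <- s] ([seq (t b, y b) | b <- s] ++ (t a, y a) :: E, k))
    (relabel id q' ((t a, y a) :: E), k).
  apply: IH => //.
    move=> b bs; have bas : b \in a :: s by rewrite inE bs orbT.
    have [tb cb yb qb] := h b bas; split.
    - by rewrite /= inE negb_or tb andbT; apply: contraNneq ta => <-; exact: map_f.
    - rewrite /= cb; case: eqP => // e; move: ya.
      by rewrite e inE map_f ?orbT.
    - by move: yb; rewrite inE negb_or => /andP[].
    - by rewrite /q' ifN //; apply: contraNneq wa => <-; exact: map_f.
  move=> z zs; rewrite /q'; case: eqP => // /eqP zw.
  by apply: qz; rewrite inE negb_or zw.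
have q'ya : q' (y a) = y a.
  by rewrite /q'; case: eqP => // _; apply: qz.
have cE' : count_mem (w a) (unzip2 (relabel id q' E)) = 1.
  rewrite -cE /unzip2 /relabel !count_map; apply: eq_count => e /=.
  rewrite /q'; case: (eqVneq e.2 (w a)) => [->|ne]; [by rewrite eqxx | apply/negbTE/eqP].
  case: (boolP (e.2 \in map w (a :: s))) => [/mapP[b bs eb]|/qz -> e']; last first.
    by rewrite e' eqxx in ne.
  have [_ _ yb qb] := h b bs; rewrite eb qb => e'.
  by move: yb; rewrite e' mem_head.
have fin : same_web (join (w a, t a) ((t a, y a) :: relabel id q' E, k)) (relabel id q E, k).
  apply: same_web_trans (absorb_head k _ cE' _) _.
  - by rewrite /unzip1 -map_comp; exact: tE.
  - by move: ya; rewrite inE negb_or => /andP[].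
  split=> //=; rewrite /relabel -map_comp (eq_map (g := fun e => (e.1, q e.2))) // => e /=.
  rewrite /q'; case: (eqVneq e.2 (w a)) => [->|ne]; first by rewrite eqxx qa.
  case: eqP => // e'; case: (boolP (e.2 \in map w (a :: s))) => [/mapP[b bs eb]|/qz e2]; last first.
    by rewrite -e2 e' eqxx in ne.
  have [_ _ yb qb] := h b bs; move: yb; rewrite -qb -eb e' mem_head.
  by [].
set st := [seq (t b, y b) | b <- s] ++ (t a, y a) :: E in ih.
have pst : perm_eq ([seq (t b, y b) | b <- a :: s] ++ E) st.
  by rewrite /st /= perm_sym -cat1s perm_catCA.
have ok : all_joinable [seq (w b, t b) | b <- a :: s] st.
  rewrite -(all_joinable_perm _ pst); apply: absorb_joinable; rewrite /= ?wa ?ta //.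
  by move=> b /h[].
apply: same_web_trans (joins_same_web (H := (st, k)) _ _) _ => //.
  by rewrite (all_joinable_perm _ pst).
have [_ /and3P[_ _ /=]] := @all_joinable_cat _ _ [:: (w a, t a)] [seq (w b, t b) | b <- s] st k ok.
rewrite andbT => jo; rewrite joins_cons; apply: (join_step ih) => //.
by rewrite /= q'ya.
Qed.

End Absorb.

(** Exchanges tails and heads, which reduces statements on tails to statements
    on heads. *)
Definition flip (S T : eqType) (E : seq (S * T)) : seq (T * S) := [seq (e.2, e.1) | e <- E].

Section Flip.
Variables S T : eqType.
Implicit Types (E : seq (S * T)).

Lemma flipK E : flip (flip E) = E.
Proof. by rewrite /flip -map_comp map_id_in // => -[]. Qed.

Lemma flip_join w u E k :
  join (u, w) (flip E, k) = (flip (join (w, u) (E, k)).1, (join (w, u) (E, k)).2).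
Proof.
rewrite /join.
have -> : ((w, u) \in flip E) = ((u, w) \in E).
  apply/mapP/idP => [[[x y] xyE [-> ->]] //|h]; by exists (u, w).
have fE : [seq e <- flip E | (e.1 != w) && (e.2 != u)] =
    flip [seq e <- E | (e.1 != u) && (e.2 != w)].
  by rewrite filter_map; congr map; apply: eq_filter => e /=; rewrite andbC.
case: ifP => _ /=; rewrite fE //; congr (_ :: _, _); congr (_, _).
  by rewrite filter_map -map_comp.
by rewrite filter_map -map_comp.
Qed.

Lemma flip_joins js E k :
  joins (flip js) (flip E, k) = (flip (joins js (E, k)).1, (joins js (E, k)).2).
Proof.
elim: js => [|[w u] js IH] //; rewrite [flip _]/= !joins_cons IH.
by case: (joins js (E, k)) => E' k'; exact: flip_join.
Qed.

Lemma flip_joinable js E : all_joinable (flip js) (flip E) = all_joinable js E.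
Proof.
rewrite /all_joinable /unzip1 /unzip2 -!map_comp all_map andbCA; congr [&& _, _ & _].
by apply: eq_all => j; rewrite /joinable /= /unzip1 /unzip2 -!map_comp andbC.
Qed.

Lemma absorb_tails_joinable (A : eqType) (s : seq A) (w : A -> S) (t : A -> T) (y : A -> S) E :
  uniq (map w s) -> uniq (map t s) ->
  (forall a, a \in s -> [/\ t a \notin unzip2 E, count_mem (w a) (unzip1 E) = 1 &
      y a \notin map w s]) ->
  all_joinable [seq (t a, w a) | a <- s] ([seq (y a, t a) | a <- s] ++ E).
Proof.
move=> uw ut h; rewrite -flip_joinable [flip (_ ++ _)]map_cat /flip -!map_comp.
apply: (absorb_joinable (E := flip E)) => // a /h[]; rewrite /unzip1 /unzip2 -!map_comp.
by [].
Qed.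

Lemma absorb_tails (A : eqType) (s : seq A) (w : A -> S) (t : A -> T) (y : A -> S) (p : S -> S) E k :
  uniq (map w s) -> uniq (map t s) ->
  (forall a, a \in s -> [/\ t a \notin unzip2 E, count_mem (w a) (unzip1 E) = 1,
      y a \notin map w s & p (w a) = y a]) ->
  (forall z, z \notin map w s -> p z = z) ->
  same_web (joins [seq (t a, w a) | a <- s] ([seq (y a, t a) | a <- s] ++ E, k))
    (relabel p id E, k).
Proof.
move=> uw ut h pz.
have := absorb_heads k uw ut (E := flip E) _ pz; rewrite /unzip1 /unzip2 -!map_comp => /(_ y h).
have -> : [seq (w a, t a) | a <- s] = flip [seq (t a, w a) | a <- s].
  by rewrite /flip -map_comp.
have -> : [seq (t a, y a) | a <- s] ++ flip E = flip ([seq (y a, t a) | a <- s] ++ E).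
  by rewrite /flip map_cat -!map_comp.
rewrite flip_joins => -[/= /(perm_map (fun e => (e.2, e.1))) pe ke].
split=> //=; move: pe; rewrite -!/(flip _) flipK.
by rewrite /relabel /flip -!map_comp.
Qed.

End Flip.

(** * Open webs and redexes *)

Section Degree.
Variable X : eqType.
Implicit Types (bs ns : seq X).

(** The names in bs are free ends, which occur once, and the other names are
    trivalent vertices. *)
Definition degree_ok bs ns : bool :=
  [&& uniq bs, all (fun x => count_mem x ns == 1) bs &
      all (fun x => (x \in bs) || (count_mem x ns == 3)) ns].

Lemma degree_okP bs ns :
  reflect (uniq bs /\ forall x, count_mem x ns =
             if x \in bs then 1 else if x \in ns then 3 else 0)
          (degree_ok bs ns).
Proof.
apply: (iffP and3P) => [[u /allP h1 /allP h2]|[u h]]; split=> //.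
- move=> x; case: (boolP (x \in bs)) => [/h1/eqP //|xb].
  case: (boolP (x \in ns)) => [xn|/count_memPn //].
  by have := h2 _ xn; rewrite (negPf xb) => /eqP.
- by apply/allP => x xb; rewrite h xb.
- by apply/allP => x xn; rewrite h xn; case: (x \in bs).
Qed.

Lemma degree_ok_perm bs bs' ns ns' : perm_eq bs bs' -> perm_eq ns ns' ->
  degree_ok bs ns = degree_ok bs' ns'.
Proof.
move=> pb pn; rewrite /degree_ok (perm_uniq pb) (perm_all _ pb) (perm_all _ pn).
congr [&& _, _ & _]; apply: eq_all => x; first by rewrite (seq.permP pn).
by rewrite (perm_mem pb) (seq.permP pn).
Qed.

Lemma degree_ok_joined b1 b2 ns ns' : degree_ok (b1 ++ b2) ns ->
  perm_eq (b2 ++ ns') ns -> degree_ok b1 ns'.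
Proof.
move=> /degree_okP[]; rewrite cat_uniq => /and3P[u1 /hasPn d u2] h p.
apply/degree_okP; split=> // x; have := h x.
rewrite -(seq.permP p) -(perm_mem p) !mem_cat count_cat (count_uniq_mem _ u2).
case: (boolP (x \in b1)) => x1 /=; case: (boolP (x \in b2)) => x2 //=.
- by have := d x x2; rewrite /= x1.
- rewrite add1n => -[/count_memPn/negPf xn]; rewrite xn.
  by apply/count_memPn; rewrite xn.
Qed.

(** Removing two of the three edges at each vertex of bs' turns it into a free
    end. *)
Lemma degree_ok_resolve bs bs' ts ns : uniq bs' -> perm_eq ts (bs' ++ bs') ->
  degree_ok bs (ts ++ ns) -> degree_ok (bs' ++ bs) ns.
Proof.
move=> u' pt /degree_okP[u h]; apply/degree_okP.
have h' x : (x \in bs').*2 + count_mem x ns =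
    if x \in bs then 1 else if (x \in bs') || (x \in ns) then 3 else 0.
  have := h x; rewrite count_cat (seq.permP pt) count_cat (count_uniq_mem _ u') addnn => ->.
  by rewrite mem_cat (perm_mem pt) mem_cat orbb.
split.
  rewrite cat_uniq u' u andbT; apply/hasPn => x xb /=; apply/negP => xb'.
  by have := h' x; rewrite xb xb'.
move=> x; have := h' x; rewrite mem_cat; case: (x \in bs') => /= [|<-]; last by [].
case: (x \in bs) => // -[].
by case: (x \in ns).
Qed.

Lemma degree_ok_fresh bs ts ns x : degree_ok bs (ts ++ ns) -> 2 <= count_mem x ts ->
  x \notin bs.
Proof.
case/degree_okP=> _ /(_ x); rewrite count_cat => h c; apply/negP => xb.
by move: h c; rewrite xb; clear; lia.
Qed.

End Degree.

Lemma degree_ok_map (X Y : eqType) (f : X -> Y) (bs ns : seq X) : injective f ->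
  degree_ok (map f bs) (map f ns) = degree_ok bs ns.
Proof.
move=> fi; rewrite /degree_ok (map_inj_uniq fi) !all_map; congr [&& _, _ & _].
  apply: eq_all => x /=; rewrite count_map; congr (_ == _); apply: eq_count => y /=.
  by rewrite inj_eq.
apply: eq_all => x /=; rewrite (mem_map fi) count_map; congr (_ || (_ == _)).
by apply: eq_count => y /=; rewrite inj_eq.
Qed.


Section OpenWeb.
Variables S T : eqType.
Implicit Types (E R : seq (S * T)) (js : seq (T * S)).

(** A web whose free ends are exactly those to be joined; joining them gives a
    trivalent web. *)
Definition open_web E js :=
  degree_ok (unzip2 js) (unzip1 E) && degree_ok (unzip1 js) (unzip2 E).

Lemma open_web_perm E E' js js' : perm_eq E E' -> perm_eq js js' ->
  open_web E js = open_web E' js'.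
Proof.
by move=> pE pj; rewrite /open_web; congr (_ && _); apply: degree_ok_perm; exact: perm_map.
Qed.

Lemma open_web_joinable E js : open_web E js -> all_joinable js E.
Proof.
move=> /andP[/and3P[u1 /allP h1 _] /and3P[u2 /allP h2 _]].
rewrite /all_joinable u1 u2; apply/allP => j jj; rewrite /joinable.
by rewrite h1 ?map_f // h2 ?map_f.
Qed.

Lemma open_web_joins E js js' k : open_web E (js ++ js') ->
  open_web (joins js' (E, k)).1 js.
Proof.
move=> o; have [ok _] := all_joinable_cat k (open_web_joinable o).
have [p1 p2] := joins_ends k ok; case/andP: o; rewrite /unzip1 /unzip2 !map_cat => d1 d2.
by apply/andP; split; [apply: degree_ok_joined d1 p1 | apply: degree_ok_joined d2 p2].
Qed.

End OpenWeb.

Lemma trivalent_open E : trivalent E = open_web E [::].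
Proof. by rewrite /trivalent /open_web /degree_ok /=; congr (_ && _); apply: eq_all. Qed.

Local Open Scope ring_scope.

Section Coefficients.
Variables (K : comNzRingType) (A : int -> K).

Definition loop_value : K := A 6 + 1 + A (- 6).
Definition bigon_value : K := A 3 + A (- 3).

(** The edges of a bigon or of a quadrilateral, with the linear combination of
    joinings that replaces them: the remaining edge at each of its vertices
    becomes a free end. *)
Inductive redex (S T : eqType) : seq (S * T) -> seq (K * seq (T * S)) -> Prop :=
| BigonRedex u v : redex [:: (u, v); (u, v)] [:: (bigon_value, [:: (v, u)])]
| QuadRedex u1 w1 u2 w2 of u1 != u2 & w1 != w2 :
    redex [:: (u1, w1); (u2, w1); (u2, w2); (u1, w2)]
      [:: (1, [:: (w1, u1); (w2, u2)]); (1, [:: (w1, u2); (w2, u1)])].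

End Coefficients.

Section Redex.
Variables (K : comNzRingType) (A : int -> K) (S T : eqType).
Implicit Types (E R es : seq (S * T)) (js : seq (T * S)) (outs : seq (K * seq (T * S))).

Lemma redex_ends es outs o : redex A es outs -> o \in outs ->
  [/\ uniq (unzip1 o.2), uniq (unzip2 o.2), perm_eq (unzip1 es) (unzip2 o.2 ++ unzip2 o.2) &
      perm_eq (unzip2 es) (unzip1 o.2 ++ unzip1 o.2)].
Proof.
case=> [u v|u1 w1 u2 w2 uu ww]; rewrite !inE; first by move/eqP->; split; rewrite /=.
case/orP => /eqP-> /=; rewrite !inE ?uu ?ww 1?eq_sym ?uu //; split=> //;
  apply/seq.permP => a /=; clear; lia.
Qed.

Lemma redex_count_tail es outs x : redex A es outs -> x \in unzip1 es -> (2 <= count_mem x (unzip1 es))%N.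
Proof.
case=> [u v|u1 w1 u2 w2 uu ww]; rewrite /= !inE; first by rewrite orbb => /eqP ->; rewrite eqxx.
by case/or4P => /eqP->; rewrite !eqxx; clear; lia.
Qed.

Lemma redex_count_head es outs x : redex A es outs -> x \in unzip2 es -> (2 <= count_mem x (unzip2 es))%N.
Proof.
case=> [u v|u1 w1 u2 w2 uu ww]; rewrite /= !inE; first by rewrite orbb => /eqP ->; rewrite eqxx.
by case/or4P => /eqP->; rewrite !eqxx; clear; lia.
Qed.

Lemma open_web_redex es outs o R js : redex A es outs -> o \in outs ->
  open_web (es ++ R) js -> open_web R (o.2 ++ js).
Proof.
move=> r oo; have [u1 u2 p1 p2] := redex_ends r oo.
rewrite /open_web /unzip1 /unzip2 !map_cat => /andP[d1 d2].
by apply/andP; split; [exact: degree_ok_resolve d1 | exact: degree_ok_resolve d2].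
Qed.

Lemma redex_fresh es outs R js : redex A es outs -> open_web (es ++ R) js ->
  forall j, j \in js -> (j.2 \notin unzip1 es) && (j.1 \notin unzip2 es).
Proof.
move=> r; rewrite /open_web /unzip1 /unzip2 !map_cat => /andP[d1 d2] j jj.
apply/andP; split; apply/negP.
  by move/(redex_count_tail r)/(degree_ok_fresh d1); rewrite map_f.
by move/(redex_count_head r)/(degree_ok_fresh d2); rewrite map_f.
Qed.

End Redex.

Lemma redex_relabel (K : comNzRingType) (A : int -> K) (S T S' T' : eqType) (p : S -> S') (q : T -> T')
    (es : seq (S * T)) outs : injective p -> injective q -> redex A es outs ->
  redex A (relabel p q es) [seq (o.1, relabel_joins p q o.2) | o <- outs].
Proof.
move=> pI qI [u v|u1 w1 u2 w2 uu ww] /=; first exact: BigonRedex.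
by apply: QuadRedex; rewrite (inj_eq pI, inj_eq qI).
Qed.

(** Isomorphisms of graphs are given by bijections of all names, but renamings
    are only injective on the names in use: a finite injection of natural
    numbers extends to a bijection, by composing with transpositions. *)
Lemma extend_to_bijection (X : eqType) (s : seq X) (a b : X -> nat) :
  {in s &, injective a} -> {in s &, injective b} ->
  exists2 h : nat -> nat, bijective h & {in s, forall x, h (a x) = b x}.
Proof.
elim: s => [|x s IH] ai bi; first by exists id => //; exists id.
have [||h [h' hK Kh] hE] := IH.
- by move=> y z ys zs; apply: ai; rewrite inE ?ys ?zs orbT.
- by move=> y z ys zs; apply: bi; rewrite inE ?ys ?zs orbT.
case: (boolP (x \in s)) => xs.
  by exists h; [exists h'|move=> y; rewrite inE => /predU1P[->|/hE //]; exact: hE].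
pose c := h (a x); pose d := b x.
(* The transposition of c and d corrects the value at x and touches no other
   prescribed value. *)
pose sw y := if y == c then d else if y == d then c else y.
have swK : involutive sw.
  by move=> y; rewrite /sw; case: (eqVneq y c) => [->|yc]; rewrite ?eqxx;
    [case: eqP => // -> | case: (eqVneq y d) => [->|yd]; rewrite ?eqxx // (negPf yc) (negPf yd)].
exists (sw \o h); first exact: bij_comp (inv_bij swK) (Bijective hK Kh).
move=> y; rewrite inE => /predU1P[->|ys]; first by rewrite /sw /= eqxx.
rewrite /sw /= hE // ifN ?ifN //.
- by apply: contraNneq xs => e; rewrite -(bi y x) ?inE ?ys ?eqxx ?orbT.
- rewrite -hE // (can_eq hK); apply: contraNneq xs => e.
  by rewrite -(ai y x) ?inE ?ys ?eqxx ?orbT.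
Qed.

(** * Valuations of webs with a bounded number of edges *)

Definition disjoint_names (X : eqType) (s t : seq X) := all (fun x => x \notin s) t.

Section Valuation.
Variables (K : comNzRingType) (A : int -> K) (M : comAlgType K).

Definition web_value (g : seq (nat * nat) -> M) (G : seq (nat * nat) * nat) : M :=
  loop_value A ^+ G.2 *: g G.1.

Variable (irr : graph_class -> M).

(** The Kuperberg relations restricted to webs with less than n edges, circles
    being counted by [web_value]. Coefficients and values are abstract, which
    also keeps Laurent polynomials from being unfolded. *)
Record valuation_below (n : nat) (g : seq (nat * nat) -> M) : Prop := {
  valuation_nil : g [::] = 1;
  valuation_iso : forall E E' p q, trivalent E -> (size E < n)%N ->
    injective p -> injective q -> perm_eq E' (relabel p q E) -> g E' = g E;
  valuation_redex : forall es outs R, redex A es outs -> trivalent (es ++ R) ->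
    (size (es ++ R) < n)%N ->
    g (es ++ R) = \sum_(o <- outs) o.1 *: web_value g (joins o.2 (R, 0%N));
  valuation_union : forall E F, trivalent E -> trivalent F ->
    disjoint_names (unzip1 E) (unzip1 F) -> disjoint_names (unzip2 E) (unzip2 F) ->
    (size (E ++ F) < n)%N -> g (E ++ F) = g E * g F;
  valuation_irreducible : forall G, irreducible_graph G -> (size (edges G) < n)%N ->
    g (edges G) = irr (class G)
}.

End Valuation.

Lemma scaler_swap (K : comNzRingType) (M : lmodType K) (a b : K) (x : M) :
  a *: (b *: x) = b *: (a *: x).
Proof. by rewrite !scalerA [a * b]mulrC. Qed.

Lemma size_relabel (S T S' T' : eqType) (p : S -> S') (q : T -> T') E :
  size (relabel p q E) = size E.
Proof. exact: size_map. Qed.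

Lemma relabel_tails (S T S' T' : eqType) (p : S -> S') (q : T -> T') E :
  unzip1 (relabel p q E) = map p (unzip1 E).
Proof. by rewrite /unzip1 -!map_comp. Qed.

Lemma relabel_heads (S T S' T' : eqType) (p : S -> S') (q : T -> T') E :
  unzip2 (relabel p q E) = map q (unzip2 E).
Proof. by rewrite /unzip2 -!map_comp. Qed.

Lemma relabel_comp (S T S' T' S'' T'' : eqType) (p : S -> S') (q : T -> T')
    (p' : S' -> S'') (q' : T' -> T'') E :
  relabel p' q' (relabel p q E) = relabel (p' \o p) (q' \o q) E.
Proof. by rewrite /relabel -map_comp. Qed.

Lemma relabel_cat (S T S' T' : eqType) (p : S -> S') (q : T -> T') E F :
  relabel p q (E ++ F) = relabel p q E ++ relabel p q F.
Proof. exact: map_cat. Qed.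

Lemma open_web_relabel (S T S' T' : eqType) (p : S -> S') (q : T -> T') E js :
  injective p -> injective q ->
  open_web (relabel p q E) (relabel_joins p q js) = open_web E js.
Proof.
move=> pI qI; rewrite /open_web relabel_tails relabel_heads.
have -> : unzip1 (relabel_joins p q js) = map q (unzip1 js) by rewrite /unzip1 -!map_comp.
have -> : unzip2 (relabel_joins p q js) = map p (unzip2 js) by rewrite /unzip2 -!map_comp.
by rewrite !degree_ok_map.
Qed.

Lemma relabel_in (S T S' T' : eqType) (p p' : S -> S') (q q' : T -> T') E :
  {in unzip1 E, p =1 p'} -> {in unzip2 E, q =1 q'} -> relabel p q E = relabel p' q' E.
Proof.
move=> hp hq; apply/eq_in_map => e eE.
by rewrite hp ?hq //; exact: map_f.
Qed.

Section OpenValue.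
Variables (K : comNzRingType) (A : int -> K) (M : comAlgType K) (irr : graph_class -> M).
Variables (n : nat) (g : seq (nat * nat) -> M).
Hypothesis gP : valuation_below A irr n g.

Definition code (S T : countType) (E : seq (S * T)) : seq (nat * nat) :=
  relabel pickle pickle E.

(** Names in any countable type are allowed, through their codes, so that names
    can be tagged freely in constructions. *)
Definition open_value (S T : countType) (E : seq (S * T)) (js : seq (T * S)) : M :=
  web_value A g (code (joins js (E, 0%N)).1, (joins js (E, 0%N)).2).

(** Each joining removes one edge, so the joined web has less than n edges. *)
Definition fits (S T : countType) (E : seq (S * T)) (js : seq (T * S)) : bool :=
  open_web E js && (size E < n + size js)%N.

Lemma fits_relabel (S T S' T' : countType) (p : S -> S') (q : T -> T') E js :
  injective p -> injective q -> fits (relabel p q E) (relabel_joins p q js) = fits E js.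
Proof. by move=> pI qI; rewrite /fits open_web_relabel // !size_map. Qed.

Lemma trivalent_relabel (S T : countType) (E : seq (S * T)) (p : S -> nat) (q : T -> nat) :
  injective p -> injective q -> trivalent (relabel p q E) = open_web E [::].
Proof. by move=> pI qI; rewrite trivalent_open -(open_web_relabel E [::] pI qI). Qed.

Lemma pickle_inj (X : countType) : injective (@pickle X).
Proof. exact: pcan_inj pickleK. Qed.

(** The value does not depend on the chosen injective coding of the names. *)
Lemma valuation_relabel (S T : countType) (E : seq (S * T)) (p p' : S -> nat) (q q' : T -> nat) E' :
  open_web E [::] -> (size E < n)%N ->
  {in unzip1 E &, injective p} -> {in unzip1 E &, injective p'} ->
  {in unzip2 E &, injective q} -> {in unzip2 E &, injective q'} ->
  perm_eq E' (relabel p' q' E) -> g E' = g (relabel p q E).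
Proof.
move=> oE sE pI p'I qI q'I pE.
have [h0 [h0' h0K _] h0E] := extend_to_bijection (in2W (@pickle_inj S)) pI.
have [h1 [h1' h1K _] h1E] := extend_to_bijection (in2W (@pickle_inj S)) p'I.
have [k0 [k0' k0K _] k0E] := extend_to_bijection (in2W (@pickle_inj T)) qI.
have [k1 [k1' k1K _] k1E] := extend_to_bijection (in2W (@pickle_inj T)) q'I.
have tc : trivalent (code E) by rewrite trivalent_relabel //; exact: pickle_inj.
have sc : (size (code E) < n)%N by rewrite size_relabel.
rewrite (valuation_iso gP tc sc (can_inj h1K) (can_inj k1K)); last first.
  by rewrite (perm_trans pE) // relabel_comp (relabel_in (p' := p') (q' := q')).
rewrite (valuation_iso (E' := relabel p q E) gP tc sc (can_inj h0K) (can_inj k0K)) //.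
by rewrite relabel_comp (relabel_in (p' := p) (q' := q)).
Qed.

Lemma fits_joins (S T : countType) (E : seq (S * T)) js js' k : fits E (js ++ js') ->
  fits (joins js' (E, k)).1 js.
Proof.
case/andP=> o s; rewrite /fits open_web_joins //=.
have [ok _] := all_joinable_cat k (open_web_joinable o).
by move: s; rewrite -(size_joins k ok) size_cat addnA ltn_add2r.
Qed.

Lemma same_web_value (S T : countType) (G H : seq (S * T) * nat) : fits G.1 [::] ->
  same_web G H -> web_value A g (code G.1, G.2) = web_value A g (code H.1, H.2).
Proof.
case/andP=> o s [pG eG]; rewrite /web_value /= eG; congr (_ *: _).
apply: esym; apply: (valuation_relabel (p := pickle) (q := pickle) o).
- by move: s; rewrite addn0.
- exact: in2W (@pickle_inj S).
- exact: in2W (@pickle_inj S).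
- exact: in2W (@pickle_inj T).
- exact: in2W (@pickle_inj T).
- by apply: perm_map; rewrite perm_sym.
Qed.

Lemma open_value_perm (S T : countType) (E E' : seq (S * T)) js js' :
  fits E js -> perm_eq E E' -> perm_eq js js' -> open_value E js = open_value E' js'.
Proof.
move=> fE pE pj; rewrite /open_value.
have ok : all_joinable js E by case/andP: fE => /open_web_joinable.
rewrite (@same_web_value _ _ (joins js (E, 0%N)) (joins js' (E', 0%N))) //.
  exact: fits_joins.
apply: same_web_trans (_ : same_web (joins js' (E, 0%N)) _).
  exact: joins_perm_eq.
by apply: joins_same_web; rewrite //= -(all_joinable_permj _ pj).
Qed.

Lemma open_value_relabel (S T S' T' : countType) (p : S -> S') (q : T -> T') E js :
  injective p -> injective q -> fits E js ->
  open_value (relabel p q E) (relabel_joins p q js) = open_value E js.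
Proof.
move=> pI qI fE; rewrite /open_value relabel_joins_web; last first.
  by move=> j _; split=> x; [move/pI|move/qI].
have := fits_joins (js := [::]) 0 fE; case: (joins js (E, 0%N)) => F k /= /andP[oF sF].
rewrite /web_value /=; congr (_ *: _); rewrite /code relabel_comp.
apply: (valuation_relabel oF) => //.
- by move: sF; rewrite addn0.
- exact: in2W (@pickle_inj S).
- by apply: in2W; apply: inj_comp => //; exact: pickle_inj.
- exact: in2W (@pickle_inj T).
- by apply: in2W; apply: inj_comp => //; exact: pickle_inj.
Qed.

Lemma open_value_joins (S T : countType) (E : seq (S * T)) js js' :
  open_value E (js ++ js') =
    loop_value A ^+ (joins js' (E, 0%N)).2 *: open_value (joins js' (E, 0%N)).1 js.
Proof.
rewrite /open_value joins_catl; case: (joins js' (E, 0%N)) => F k /=.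
by rewrite joins_loops /web_value /= scalerA exprD.
Qed.

(** The joinings js take place away from the redex, so the relation may be
    applied before them. *)
Lemma open_value_redex (S T : countType) (es R : seq (S * T)) outs js :
  redex A es outs -> fits (es ++ R) js ->
  open_value (es ++ R) js = \sum_(o <- outs) o.1 *: open_value R (o.2 ++ js).
Proof.
move=> r fE; have fr : forall j, j \in js -> (j.2 \notin unzip1 es) && (j.1 \notin unzip2 es).
  by case/andP: fE => o _; exact: redex_fresh r o.
have pE : perm_eq (es ++ R) (R ++ es) by apply/permPl/perm_catC.
rewrite (open_value_perm fE pE (perm_refl js)).
have fE' : fits (R ++ es) js.
  case/andP: fE => o s; apply/andP; split; last by rewrite size_cat addnC -size_cat.
  by rewrite -(open_web_perm pE (perm_refl js)).
have := fits_joins (js := [::]) 0 fE'.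
rewrite {1}/open_value joins_cat //.
under eq_bigr => o _ do rewrite /open_value joins_catl.
case: (joins js (R, 0%N)) => F k /= /andP[oF sF].
have oF' : open_web (es ++ F) [::].
  by rewrite (open_web_perm (E' := F ++ es) (js' := [::])) //; apply/permPl/perm_catC.
have rc := redex_relabel (@pickle_inj S) (@pickle_inj T) r.
rewrite /web_value /= (_ : g (code (F ++ es)) = g (code es ++ code F)); last first.
  rewrite -[code es ++ code F]map_cat.
  apply: (valuation_relabel (p := pickle) (q := pickle) oF').
  - by move: sF; rewrite addn0 !size_cat addnC.
  - exact: in2W (@pickle_inj S).
  - exact: in2W (@pickle_inj S).
  - exact: in2W (@pickle_inj T).
  - exact: in2W (@pickle_inj T).
  - by apply/perm_map/permPl/perm_catC.
rewrite (valuation_redex gP rc); first last.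
- by move: sF; rewrite addn0 !size_cat !size_relabel addnC.
- by rewrite -[_ ++ _]map_cat -[map _ _]/(code _) trivalent_relabel //; exact: pickle_inj.
rewrite big_map scaler_sumr; apply: eq_bigr => o _ /=.
rewrite relabel_joins_web; last by move=> j _; split=> x; exact: pickle_inj.
rewrite (joins_loops o.2 F k) /web_value /= -/(code _) exprD.
move: (g _) (loop_value A ^+ k) => x a.
rewrite -[in RHS]scalerA; exact: scaler_swap.
Qed.

End OpenValue.

(** * Pieces of a web in a fixed surrounding *)

Section Lefts.
Variables X Y : eqType.
Implicit Types (s : seq (X + Y)).

Definition lefts s := pmap (fun x : X + Y => if x is inl a then Some a else None) s.
Definition rights s := pmap (fun x : X + Y => if x is inr a then Some a else None) s.

Lemma mem_lefts s x : (x \in lefts s) = (inl x \in s).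
Proof. by elim: s => [|[a|b] s IH] //=; rewrite !inE IH. Qed.

Lemma mem_rights s x : (x \in rights s) = (inr x \in s).
Proof. by elim: s => [|[a|b] s IH] //=; rewrite !inE IH. Qed.

Lemma uniq_sum s : uniq s = uniq (lefts s) && uniq (rights s).
Proof.
elim: s => [|[a|b] s IH] //=; rewrite IH; first by rewrite mem_lefts andbA.
by rewrite mem_rights andbCA.
Qed.

Lemma count_inl (a : seq X) (b : seq Y) x :
  count_mem (inl x) (map inl a ++ map inr b) = count_mem x a.
Proof.
rewrite count_cat !count_map [X in (_ + X)%N](eq_count (a2 := pred0)) ?count_pred0 ?addn0 //.
Qed.

Lemma count_inr (a : seq X) (b : seq Y) x :
  count_mem (inr x) (map inl a ++ map inr b) = count_mem x b.
Proof.
rewrite count_cat !count_map [X in (X + _)%N](eq_count (a2 := pred0)) ?count_pred0 //.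
Qed.

Lemma degree_ok_sum s (a : seq X) (b : seq Y) :
  degree_ok s (map inl a ++ map inr b) = degree_ok (lefts s) a && degree_ok (rights s) b.
Proof.
have mi x : (inl x \in map inl a ++ map inr b) = (x \in a).
  by rewrite -!has_pred1 !has_count count_inl.
have mr x : (inr x \in map inl a ++ map inr b) = (x \in b).
  by rewrite -!has_pred1 !has_count count_inr.
apply/degree_okP/andP => [[]|[/degree_okP[u1 h1] /degree_okP[u2 h2]]].
  rewrite uniq_sum => /andP[u1 u2] h; split; apply/degree_okP; split=> // x.
    by have := h (inl x); rewrite count_inl mi mem_lefts.
  by have := h (inr x); rewrite count_inr mr mem_rights.
rewrite uniq_sum u1 u2; split=> // -[x|x].
  by rewrite count_inl h1 mi mem_lefts.
by rewrite count_inr h2 mr mem_rights.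
Qed.

End Lefts.

Definition local_web (m : nat) (BT BH : seq nat) (L : seq (nat * nat)) : bool :=
  [&& (size L < m)%N, degree_ok BT (unzip1 L) & degree_ok BH (unzip2 L)].

(** What a function of a piece with free ends BT (tails) and BH (heads) must
    satisfy for the relations to be usable inside the piece. *)
Record local_value (K : comNzRingType) (A : int -> K) (M : comAlgType K) m BT BH
    (V : seq (nat * nat) -> M) : Prop := {
  local_perm : forall L L', local_web m BT BH L -> perm_eq L L' -> V L = V L';
  local_relabel : forall L p q, local_web m BT BH L -> injective p -> injective q ->
    {in BT, p =1 id} -> {in BH, q =1 id} -> V (relabel p q L) = V L;
  local_redex : forall es R outs, redex A es outs -> local_web m BT BH (es ++ R) ->
    V (es ++ R) = \sum_(o <- outs) o.1 *: web_value A V (joins o.2 (R, 0%N))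
}.

Section Glue.
Variables (K : comNzRingType) (A : int -> K) (M : comAlgType K) (irr : graph_class -> M).
Variables (n : nat) (g : seq (nat * nat) -> M).
Hypothesis gP : valuation_below A irr n g.
Variables (S T : countType) (R : seq (S * T)) (js : seq ((nat + T) * (nat + S))).
Variables (m : nat) (BT BH : seq nat).
Hypothesis BTP : perm_eq (lefts (unzip2 js)) BT.
Hypothesis BHP : perm_eq (lefts (unzip1 js)) BH.
Hypothesis RT : degree_ok (rights (unzip2 js)) (unzip1 R).
Hypothesis RH : degree_ok (rights (unzip1 js)) (unzip2 R).
Hypothesis mP : (m + size R <= n + size js)%N.

(** The piece L, whose names are tagged by inl, placed in its surrounding R; the
    joinings js connect the free ends of both. *)
Definition glue (L : seq (nat * nat)) : seq ((nat + S) * (nat + T)) :=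
  relabel inl inl L ++ relabel inr inr R.

Definition local_open (L : seq (nat * nat)) (jo : seq (nat * nat)) : bool :=
  [&& (size L < m + size jo)%N, degree_ok (BT ++ unzip2 jo) (unzip1 L) &
      degree_ok (BH ++ unzip1 jo) (unzip2 L)].

Notation inner jo := (relabel_joins inl inl jo : seq ((nat + T) * (nat + S))).

Lemma fits_glue_open L jo : local_open L jo -> fits n (glue L) (js ++ inner jo).
Proof.
case/and3P=> s d1 d2; apply/andP; split; last first.
  rewrite size_cat !size_relabel size_cat size_map addnA.
  by apply: leq_trans (leq_add mP (leqnn _)); rewrite addnAC -addSn leq_add2r.
have e1 : unzip1 (glue L) = map inl (unzip1 L) ++ map inr (unzip1 R).
  by rewrite /glue /unzip1 map_cat -!map_comp.
have e2 : unzip2 (glue L) = map inl (unzip2 L) ++ map inr (unzip2 R).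
  by rewrite /glue /unzip2 map_cat -!map_comp.
have e3 : unzip1 (js ++ inner jo) = unzip1 js ++ map inl (unzip1 jo).
  by rewrite /unzip1 map_cat -!map_comp.
have e4 : unzip2 (js ++ inner jo) = unzip2 js ++ map inl (unzip2 jo).
  by rewrite /unzip2 map_cat -!map_comp.
rewrite /open_web e1 e2 e3 e4 !degree_ok_sum.
have l_inl (X Y : eqType) (s1 : seq (X + Y)) (s2 : seq X) :
    lefts (s1 ++ map inl s2) = lefts s1 ++ s2 /\ rights (s1 ++ map inl s2) = rights s1.
  elim: s1 => [|[a|a] s1 [IH1 IH2]] /=; rewrite ?IH1 ?IH2 //.
  by elim: s2 => [|x s2 [IH1 IH2]] //=; rewrite IH1 IH2.
rewrite !(proj1 (l_inl _ _ _ _)) !(proj2 (l_inl _ _ _ _)) RT RH !andbT.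
rewrite (degree_ok_perm (_ : perm_eq _ (BT ++ unzip2 jo)) (perm_refl _)) ?perm_cat2r // d1.
by rewrite (degree_ok_perm (_ : perm_eq _ (BH ++ unzip1 jo)) (perm_refl _)) ?perm_cat2r.
Qed.

Lemma fits_glue L : local_web m BT BH L -> fits n (glue L) js.
Proof.
move=> lL; rewrite -[js]cats0; apply: (@fits_glue_open L [::]).
by rewrite /local_open /= !cats0 addn0.
Qed.

Lemma open_value_glue L jo :
  open_value A g (glue L) (js ++ inner jo) =
    web_value A (fun L => open_value A g (glue L) js) (joins jo (L, 0%N)).
Proof.
rewrite open_value_joins joins_cat; last first.
  move=> _ /mapP[j _ ->] /=; rewrite relabel_tails relabel_heads.
  by apply/andP; split; apply/mapP => -[].
by rewrite relabel_joins_web //; move=> j _; split=> x; exact: inl_inj.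
Qed.

(** All relations of g hold for the glued web, and those which concern L alone
    do not see R. *)
Lemma glue_local : local_value A m BT BH (fun L => open_value A g (glue L) js).
Proof.
split=> [L L' lL pL|L p q lL pI qI pB qB|es R0 outs r lL].
- apply: (open_value_perm gP (fits_glue lL)) => //.
  by rewrite perm_cat2r; exact: perm_map.
- pose p' (x : nat + S) := if x is inl a then inl (p a) else x.
  pose q' (x : nat + T) := if x is inl a then inl (q a) else x.
  have p'I : injective p' by move=> [a|a] [b|b] //= [] // /pI ->.
  have q'I : injective q' by move=> [a|a] [b|b] //= [] // /qI ->.
  rewrite -(open_value_relabel gP p'I q'I (fits_glue lL)).
  rewrite {2}/glue [relabel p' q' _]map_cat -![map _ (relabel _ _ _)]/(relabel p' q' _).
  rewrite !relabel_comp; congr (open_value A g (_ ++ _) _); first by rewrite relabel_comp.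
  apply/esym; rewrite -[RHS]map_id; apply/eq_in_map => -[w u] wu /=; congr (_, _).
    case: w wu => //= a wu; rewrite qB // -(perm_mem BHP) mem_lefts.
    by apply/mapP; exists (inl a, u).
  case: u wu => //= a wu; rewrite pB // -(perm_mem BTP) mem_lefts.
  by apply/mapP; exists (w, inl a).
- have r' := redex_relabel (@inl_inj nat S) (@inl_inj nat T) r.
  have fE := fits_glue lL.
  have eE : glue (es ++ R0) = relabel inl inl es ++ glue R0.
    by rewrite /glue /relabel map_cat catA.
  rewrite eE in fE *; rewrite (open_value_redex gP r' fE) big_map.
  apply: eq_big_seq => o oo.
  pose jo : seq ((nat + T) * (nat + S)) := relabel_joins inl inl o.2.
  suff -> : open_value A g (glue R0) (jo ++ js) =
      web_value A (fun L => open_value A g (glue L) js) (joins o.2 (R0, 0%N)) by [].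
  have fR : fits n (glue R0) (jo ++ js).
    case/andP: fE => oE sE; apply/andP; split.
      by apply: (open_web_redex (o := (o.1, jo)) r' _ oE); apply/mapP; exists o.
    by move: sE; rewrite !size_cat; clear; lia.
  rewrite (open_value_perm gP fR (perm_refl _) (js' := js ++ jo)); last first.
    by apply/permPl/perm_catC.
  exact: open_value_glue.
Qed.

End Glue.

(** * Deciding linear relations between pieces *)

(** A term (b, e, L) stands for A^e L if b holds, and for - A^e L otherwise. *)
Definition term := (bool * int * seq (nat * nat))%type.

Definition shift (d : int) (t : term) : term := (t.1.1, t.1.2 + d, t.2).

(** Multiplication by the k-th power of the loop value A^6 + 1 + A^(-6). *)
Definition with_circles k (ts : seq term) : seq term :=
  iter k (fun ts => map (shift 6) ts ++ ts ++ map (shift (- 6)) ts) ts.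

Definition quads (L : seq (nat * nat)) : seq ((nat * nat) * (nat * nat)) :=
  [seq q <- [seq (e, e') | e <- L, e' <- L] |
    [&& q.1.1 != q.2.1, q.1.2 != q.2.2, (q.2.1, q.1.2) \in L & (q.1.1, q.2.2) \in L]].

Definition resolved (b : bool) (e : int) (G : seq (nat * nat) * nat) : seq term :=
  with_circles G.2 [:: (b, e, G.1)].

Definition opposite_term (t : term) : term := (~~ t.1.1, t.1.2, t.2).

Definition rename_list (X Y : seq nat) (x : nat) : nat :=
  if x \in X then nth 0%N Y (index x X) else x.

Lemma submultiset (X : eqType) (s E : seq X) :
  (forall e, count_mem e s <= count_mem e E)%N -> exists R, perm_eq E (s ++ R).
Proof.
move=> /count_subseqP[s' ss ps]; have [R pR] := perm_to_subseq ss.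
by exists R; rewrite (perm_trans pR) // perm_cat2r perm_sym.
Qed.

Lemma submultiset_uniq (X : eqType) (s E : seq X) : uniq s -> {subset s <= E} ->
  exists R, perm_eq E (s ++ R).
Proof.
move=> us sE; apply: submultiset => e; rewrite count_uniq_mem //.
by case: (boolP (e \in s)) => // /sE eE; rewrite -has_count has_pred1.
Qed.

Lemma bigon_front u v (L : seq (nat * nat)) : (1 < count_mem (u, v) L)%N ->
  perm_eq L ([:: (u, v); (u, v)] ++ remove_edges [:: (u, v); (u, v)] L).
Proof.
move=> c; have [|R pR] := @submultiset _ [:: (u, v); (u, v)] L.
  by move=> e /=; case: eqP => [<-|_] //; rewrite addn0.
by rewrite (perm_trans pR) // perm_cat2l perm_sym; exact: remove_edges_perm.
Qed.

Lemma quad_front u1 w1 u2 w2 (L : seq (nat * nat)) : u1 != u2 -> w1 != w2 ->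
  let es := [:: (u1, w1); (u2, w1); (u2, w2); (u1, w2)] in
  all (mem L) es -> perm_eq L (es ++ remove_edges es L).
Proof.
move=> uu ww es /allP sL; have [|R pR] := @submultiset_uniq _ es L _ sL.
  by rewrite /= !inE !xpair_eqE !eqxx ?(eq_sym u2) ?(eq_sym w2) (negPf uu) (negPf ww) ?andbF.
by rewrite (perm_trans pR) // perm_cat2l perm_sym; exact: remove_edges_perm.
Qed.

Section Normalize.
Variables (m : nat) (BT BH : seq nat).

(** One step of reduction, at the first bigon, or else at the first
    quadrilateral. The test that L is a piece with the given free ends makes
    soundness unconditional. *)
Definition expand (t : term) : seq term :=
  let: (b, e, L) := t in
  if ~~ local_web m BT BH L then [:: t] else
  if [seq x <- L | (1 < count_mem x L)%N] is (u, v) :: _ then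
    let G := bigon_web u v (L, 0%N) in resolved b (e + 3) G ++ resolved b (e - 3) G
  else if quads L is ((u1, w1), (u2, w2)) :: _ then
    resolved b e (quad_web u1 w1 u2 w2 u1 u2 (L, 0%N)) ++
    resolved b e (quad_web u1 w1 u2 w2 u2 u1 (L, 0%N))
  else [:: t].

Definition normalize fuel (ts : seq term) : seq term :=
  iter fuel (fun ts => flatten (map expand ts)) ts.

Definition internal_names (B X : seq nat) : seq nat := [seq x <- undup X | x \notin B].

Definition renames (X X' Y Y' : seq nat) (L L' : seq (nat * nat)) : bool :=
  let p := rename_list X X' in let q := rename_list Y Y' in
  [&& uniq (map p (undup (BT ++ unzip1 L))), uniq (map q (undup (BH ++ unzip2 L))),
      all (fun x => p x == x) BT, all (fun y => q y == y) BH &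
      perm_eq (rename p q L) L'].

(** Searches an isomorphism fixing the free ends; the pieces that occur have
    very few internal vertices. *)
Definition same_local (L L' : seq (nat * nat)) : bool :=
  has (fun X => has (fun Y => renames (internal_names BT (unzip1 L)) X
                                      (internal_names BH (unzip2 L)) Y L L')
                    (permutations (internal_names BH (unzip2 L'))))
      (permutations (internal_names BT (unzip1 L'))).

Definition cancels (t t' : term) : bool :=
  [&& t.1.1 != t'.1.1, t.1.2 == t'.1.2, local_web m BT BH t.2 & same_local t.2 t'.2].

(** The fuel bounds the number of terms, since each step removes a pair of
    opposite terms. *)
Fixpoint all_cancel fuel (ts : seq term) : bool :=
  if ts is t :: ts' then
    if fuel is fuel'.+1 then
      let i := find (cancels t) ts' in
      (i < size ts')%N && all_cancel fuel' (take i ts' ++ drop i.+1 ts')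
    else false
  else true.

Variables (K : comNzRingType) (A : int -> K) (M : comAlgType K).
Hypothesis AD : {morph A : x y / x + y >-> x * y}.
Variable V : seq (nat * nat) -> M.
Hypothesis VP : local_value A m BT BH V.

Definition term_value (t : term) : M := (-1) ^+ (~~ t.1.1) *: (A t.1.2 *: V t.2).

Definition terms_value (ts : seq term) : M := \sum_(t <- ts) term_value t.

Lemma terms_value_cat ts ts' : terms_value (ts ++ ts') = terms_value ts + terms_value ts'.
Proof. exact: big_cat. Qed.

Lemma terms_value_opposite ts : terms_value (map opposite_term ts) = - terms_value ts.
Proof.
rewrite /terms_value big_map -sumrN; apply: eq_bigr => -[[b e] X] _.
by rewrite /term_value /= -scaleNr; case: b; rewrite ?expr0 ?expr1 ?opprK.
Qed.

Lemma terms_value_shift d ts : terms_value (map (shift d) ts) = A d *: terms_value ts.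
Proof.
rewrite /terms_value big_map scaler_sumr; apply: eq_bigr => t _.
rewrite /term_value /= AD; move: ((-1) ^+ _) (A t.1.2) (A d) (V t.2) => c a b x.
rewrite -scalerA (scaler_swap a) [RHS]scaler_swap.
by [].
Qed.

Lemma terms_value_circles k ts : terms_value (with_circles k ts) = loop_value A ^+ k *: terms_value ts.
Proof.
elim: k => [|k IH]; first by rewrite expr0 scale1r.
rewrite [with_circles _ _]/= !terms_value_cat !terms_value_shift -/(with_circles k ts) IH.
rewrite exprS -scalerA /loop_value !scalerDl scale1r addrA.
by [].
Qed.

Lemma terms_value_resolved b e G : terms_value (resolved b e G) =
  (-1) ^+ (~~ b) *: (A e *: web_value A V G).
Proof.
rewrite terms_value_circles /terms_value big_seq1 /term_value /web_value /=.
move: ((-1) ^+ _) (A e) (loop_value A ^+ _) (V _) => c a l x.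
by rewrite (scaler_swap l) (scaler_swap l).
Qed.

Lemma local_web_perm L L' : perm_eq L L' -> local_web m BT BH L = local_web m BT BH L'.
Proof.
by move=> p; rewrite /local_web (perm_size p) !(degree_ok_perm (perm_refl _) (perm_map _ p)).
Qed.

Lemma local_bigon u v L : local_web m BT BH L -> (1 < count_mem (u, v) L)%N ->
  V L = bigon_value A *: web_value A V (bigon_web u v (L, 0%N)).
Proof.
move=> lL /bigon_front pR; have lL' := lL; rewrite (local_web_perm pR) in lL'.
by rewrite (local_perm VP lL pR) (local_redex VP (BigonRedex A u v) lL') big_seq1.
Qed.

Lemma local_quad u1 w1 u2 w2 L : local_web m BT BH L -> u1 != u2 -> w1 != w2 ->
  all (mem L) [:: (u1, w1); (u2, w1); (u2, w2); (u1, w2)] ->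
  V L = web_value A V (quad_web u1 w1 u2 w2 u1 u2 (L, 0%N)) +
        web_value A V (quad_web u1 w1 u2 w2 u2 u1 (L, 0%N)).
Proof.
move=> lL uu ww sL; have pR := quad_front uu ww sL; have lL' := lL; rewrite (local_web_perm pR) in lL'.
rewrite (local_perm VP lL pR) (local_redex VP (QuadRedex A uu ww) lL') big_cons big_seq1.
by congr (_ + _); exact: scale1r.
Qed.

Lemma terms_value_expand t : terms_value (expand t) = term_value t.
Proof.
have t1 : terms_value [:: t] = term_value t by rewrite /terms_value big_seq1.
case: t t1 => -[b e] L t1; rewrite /expand; case: ifP => // /negbFE lL.
case eb: [seq x <- L | _] => [|[u v] s].
  case eq: (quads L) => [|[[u1 w1] [u2 w2]] s] //.
  have : ((u1, w1), (u2, w2)) \in quads L by rewrite eq mem_head.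
  rewrite mem_filter => /andP[/and4P[/= uu ww e1 e2] /allpairsP[[x y] /= [xL yL [ex ey]]]].
  rewrite terms_value_cat !terms_value_resolved -!scalerDr /term_value /=; congr (_ *: (_ *: _)).
  rewrite -local_quad //=; subst x y.
  by rewrite xL yL e1 e2.
have : (u, v) \in [seq x <- L | (1 < count_mem x L)%N] by rewrite eb mem_head.
rewrite mem_filter => /andP[c _].
rewrite terms_value_cat !terms_value_resolved /term_value [(_, _).1]/= [(_, _).2]/= (local_bigon lL c) /bigon_value.
rewrite -scalerDr !AD -!(scalerA (A e)) -scalerDr scalerDl.
by [].
Qed.

Lemma terms_value_normalize fuel ts : terms_value (normalize fuel ts) = terms_value ts.
Proof.
elim: fuel ts => [|f IH] ts //; rewrite [normalize _ _]/= -/(normalize f ts) -[RHS]IH.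
elim: (normalize f ts) => [|t ts' IH'] //=.
by rewrite terms_value_cat terms_value_expand IH' /terms_value big_cons.
Qed.

Lemma uniq_injective (f : nat -> nat) (s : seq nat) : uniq (map f s) -> {in s &, injective f}.
Proof.
elim: s => [|x s IH] //= /andP[fx /IH us] y z; rewrite !inE.
case/predU1P=> [->|ys]; case/predU1P=> [->|zs] // e.
- by rewrite e map_f in fx.
- by rewrite -e map_f in fx.
- exact: us.
Qed.

Lemma same_local_value L L' : local_web m BT BH L -> same_local L L' -> V L = V L'.
Proof.
move=> lL /hasP[X _ /hasP[Y _ /and5P[]]]; set p := rename_list _ X; set q := rename_list _ Y.
have ext (f : nat -> nat) B N : uniq (map f (undup (B ++ N))) -> all (fun x => f x == x) B ->
    exists2 h : nat -> nat, injective h & {in B, h =1 id} /\ {in N, h =1 f}.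
  move=> /uniq_injective uf /allP fB.
  have [h hb hE] := extend_to_bijection (in2W (@inj_id nat)) (s := undup (B ++ N)) uf.
  exists h; first exact: bij_inj.
  split=> x xB; rewrite hE ?mem_undup ?mem_cat ?xB ?orbT //.
  exact/eqP/fB.
move=> up uq pB qB pL.
have [p' p'I [p'B p'E]] := ext _ _ _ up pB; have [q' q'I [q'B q'E]] := ext _ _ _ uq qB.
rewrite -(local_relabel VP lL p'I q'I p'B q'B) (relabel_in p'E q'E).
apply: (local_perm VP (L := relabel p q L) _ pL).
move: lL; rewrite /local_web -(relabel_in p'E q'E) size_relabel relabel_tails relabel_heads.
rewrite -(degree_ok_map BT (unzip1 L) p'I) -(degree_ok_map BH (unzip2 L) q'I).
have fixed (h : nat -> nat) B : {in B, h =1 id} -> map h B = B.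
  by move=> hB; rewrite -[RHS]map_id; apply/eq_in_map.
by rewrite (fixed p') // (fixed q').
Qed.

Lemma all_cancel_value fuel ts : all_cancel fuel ts -> terms_value ts = 0.
Proof.
elim: fuel ts => [|f IH] [|t ts] //=; try by rewrite /terms_value big_nil.
set i := find _ _ => /andP[i_lt /IH <-].
have := i_lt; rewrite -has_find => /(nth_find t); rewrite -/i.
set t' := nth t ts i => /and4P[/= sg /eqP e l sl].
rewrite -{1}(cat_take_drop i ts) (drop_nth t) // -/t' /terms_value.
rewrite big_cons !big_cat big_cons /= [term_value t](_ : _ = - term_value t').
  by rewrite addrCA addKr.
rewrite /term_value -(same_local_value l sl) e -scaleNr; congr (_ *: _).
by case: t.1.1 t'.1.1 sg => -[] //= _; rewrite ?expr0 ?expr1 ?opprK.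
Qed.

(** The bounds on the numbers of steps are arbitrary: [vanishesP] holds for any
    values. *)
Definition vanishes (ts : seq term) : bool := all_cancel 1000 (normalize 100 ts).

Lemma vanishesP ts : vanishes ts -> terms_value ts = 0.
Proof. by move=> /all_cancel_value; rewrite terms_value_normalize. Qed.

End Normalize.

(** * Cutting a web around a cluster of vertices *)

Local Close Scope ring_scope.






(** The vertices of the piece, numbered below k, which have only two edges
    inside: each has one leg to the rest of the web. *)
Definition legs (ns : seq nat) (k : nat) : seq nat := [seq i <- iota 0 k | count_mem i ns == 2].

Section Cut.
Variables (us ws : seq nat) (lt lh : seq nat) (R L : seq (nat * nat)).

(** The leg of vertex i of the piece is cut into a stub inside the piece, with
    free end 10 + i, and an edge outside; 10 exceeds the numbers of vertices
    that occur. *)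
Definition leg_stubs (lt lh : seq nat) : seq (nat * nat) :=
  [seq (i, 10 + i) | i <- lt] ++ [seq (10 + i, i) | i <- lh].

Definition leg_joins : seq ((nat + nat) * (nat + nat)) :=
  [seq (inl (10 + i), inr (nth 0 us i)) | i <- lt] ++
  [seq (inr (nth 0 ws i), inl (10 + i)) | i <- lh].

Definition split_name (ns : seq nat) (x : nat) : nat + nat :=
  if x \in ns then inl (index x ns) else inr x.

Lemma split_name_inj ns : injective (split_name ns).
Proof.
move=> x y; rewrite /split_name; case: ifP => [xs|_]; case: ifP => // ys [] //.
by move=> e; rewrite -(nth_index 0 xs) e nth_index.
Qed.

Definition cut_ok (ns : seq nat) (ls : seq nat) (A : seq nat) (B : seq nat) :=
  [/\ uniq ns, size ns <= 10, uniq ls, all (fun i => i < size ns) A /\ all (fun i => i < size ns) ls &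
      forall i, i < size ns -> count_mem (nth 0 ns i) B = (i \in ls)].

Hypothesis usP : cut_ok us lt (unzip1 L) (unzip1 R).
Hypothesis wsP : cut_ok ws lh (unzip2 L) (unzip2 R).

(** The effect of the leg joinings on the names of R: the end of a cut leg gets
    back the name of the vertex in the piece. *)
Definition absorbed (ns ls : seq nat) (z : nat + nat) : nat + nat :=
  if z is inr x then if (x \in ns) && (index x ns \in ls) then inl (index x ns) else z else z.

Lemma absorbed_split ns ls A B x : cut_ok ns ls A B -> x \in B ->
  absorbed ns ls (inr x) = split_name ns x.
Proof.
move=> [_ _ _ _ h] xB; rewrite /absorbed /split_name; case: (boolP (x \in ns)) => //= xs.
have := h (index x ns); rewrite index_mem nth_index // => /(_ xs).
by case: (_ \in ls) => // /count_memPn; rewrite xB.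
Qed.

(** A web made of a placed copy of L and of R is the piece L with its stubs,
    joined to R along the legs. *)
Lemma cut_legs : same_web (joins leg_joins (glue R (L ++ leg_stubs lt lh), 0))
  (relabel (split_name us) (split_name ws) (relabel (nth 0 us) (nth 0 ws) L ++ R), 0).
Proof.
have [uu su ut [/allP Lu /allP tu] cu] := usP; have [uw sw uh [/allP Lw /allP hw] cw] := wsP.
set T1 : seq ((nat + nat) * (nat + nat)) := [seq (inl i, inl (10 + i)) | i <- lt].
set T2 : seq ((nat + nat) * (nat + nat)) := [seq (inl (10 + i), inl i) | i <- lh].
set L' : seq ((nat + nat) * (nat + nat)) := relabel inl inl L.
set R' : seq ((nat + nat) * (nat + nat)) := relabel inr inr R.
set J1 : seq ((nat + nat) * (nat + nat)) := [seq (inl (10 + i), inr (nth 0 us i)) | i <- lt].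
set J2 : seq ((nat + nat) * (nat + nat)) := [seq (inr (nth 0 ws i), inl (10 + i)) | i <- lh].
have pG : perm_eq (T2 ++ (T1 ++ L' ++ R')) (glue R (L ++ leg_stubs lt lh)).
  have eT1 : relabel inl inl [seq (i, 10 + i) | i <- lt] = T1 by rewrite /relabel -map_comp.
  have eT2 : relabel inl inl [seq (10 + i, i) | i <- lh] = T2 by rewrite /relabel -map_comp.
  rewrite /glue /leg_stubs !relabel_cat eT1 eT2 -/L' -/R'.
  by apply/seq.permP => a; rewrite !count_cat; clear; lia.
have l1 x : x \in L -> x.1 < 10 /\ x.2 < 10.
  by move=> xL; split; [apply: leq_trans su; apply: Lu | apply: leq_trans sw; apply: Lw]; exact: map_f.
have T1E : unzip1 T1 = map inl lt by rewrite /unzip1 -map_comp.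
have T2E : unzip2 T1 = [seq inl (10 + i) | i <- lt] by rewrite /unzip2 -map_comp.
have nth_uniq (ns ls : seq nat) : uniq ns -> uniq ls -> {in ls, forall i, i < size ns} ->
    uniq [seq (inr (nth 0 ns i) : nat + nat) | i <- ls].
  move=> un ul hl; rewrite map_inj_in_uniq // => i j il jl [] /eqP.
  by rewrite nth_uniq ?hl // => /eqP.
have count_inr_R (i : nat) (X : seq (nat + nat)) (f : nat * nat -> nat) :
   all (fun x => if x is inl _ then true else false) X ->
   count_mem (inr i) (X ++ map inr (map f R)) = count_mem i (map f R).
  move=> /allP hX; rewrite count_cat (count_memPn _); last by apply/negP => /hX.
  by rewrite add0n count_map; apply: eq_count.
have hJ2 i : i \in lh -> [/\ (inl (10 + i) : nat + nat) \notin unzip1 (T1 ++ L' ++ R'),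
      count_mem (inr (nth 0 ws i)) (unzip2 (T1 ++ L' ++ R')) = 1,
      inl i \notin [seq (inr (nth 0 ws j) : nat + nat) | j <- lh] &
      absorbed ws lh (inr (nth 0 ws i)) = inl i].
  move=> il; have iw := hw _ il; split.
  + rewrite /unzip1 !map_cat !mem_cat -!/(unzip1 _) T1E relabel_tails relabel_tails.
    apply/negP => /or3P[] /mapP[x] xs // [e].
      by have := leq_trans (tu _ xs) su; rewrite -e; clear; lia.
    by move/mapP: xs => [y /l1[+ _] ey]; rewrite -ey -e; clear; lia.
  + rewrite /unzip2 !map_cat -!/(unzip2 _) T2E relabel_heads relabel_heads catA.
    rewrite count_inr_R; first by rewrite -/(unzip2 R) cw // il.
    by rewrite all_cat !all_map; apply/andP; split; apply/allP.
  + by apply/mapP => -[].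
  + by rewrite /absorbed mem_nth // index_uniq // il.
have uJ2 : uniq [seq (inr (nth 0 ws j) : nat + nat) | j <- lh] by exact: nth_uniq.
have uJ2' : uniq [seq (inl (10 + j) : nat + nat) | j <- lh].
  by rewrite map_inj_uniq // => i j [] /eqP; rewrite eqn_add2l => /eqP.
have okJ2 : all_joinable J2 (T2 ++ (T1 ++ L' ++ R')) by apply: absorb_joinable => // i /hJ2[].
have abs2 : same_web (joins J2 (T2 ++ (T1 ++ L' ++ R'), 0)) (relabel id (absorbed ws lh) (T1 ++ L' ++ R'), 0).
  apply: absorb_heads => // [[x|x]] //=.
  case: ifP => // /andP[xs xl] /mapP[]; exists (index x ws) => //.
  by rewrite nth_index.
set R2 : seq ((nat + nat) * (nat + nat)) := relabel inr (fun x => absorbed ws lh (inr x)) R.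
have E3 : relabel id (absorbed ws lh) (T1 ++ L' ++ R') = T1 ++ (L' ++ R2).
  rewrite !relabel_cat !relabel_comp; congr (_ ++ (_ ++ _)).
  by rewrite /relabel -map_comp.
rewrite E3 in abs2.
have J1P : all_joinable J1 (T1 ++ (L' ++ R2)) /\
    same_web (joins J1 (T1 ++ (L' ++ R2), 0)) (relabel (absorbed us lt) id (L' ++ R2), 0).
  have hJ i : i \in lt -> [/\ (inl (10 + i) : nat + nat) \notin unzip2 (L' ++ R2),
      count_mem (inr (nth 0 us i)) (unzip1 (L' ++ R2)) = 1,
      inl i \notin [seq (inr (nth 0 us j) : nat + nat) | j <- lt] &
      absorbed us lt (inr (nth 0 us i)) = inl i].
    move=> il; have iu := tu _ il; split.
    + rewrite /unzip2 map_cat mem_cat -!/(unzip2 _) !relabel_heads.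
      apply/negP => /orP[] /mapP[x] xs.
        by case=> e; move/mapP: xs => [y /l1[_ +] ey]; rewrite -ey -e; clear; lia.
      rewrite /absorbed; case: ifP => // /andP[xw _] [e].
      have xs10 : index x ws < 10 by apply: leq_trans sw; rewrite index_mem.
      by move: xs10; rewrite -e; clear; lia.
    + rewrite /unzip1 map_cat -!/(unzip1 _) !relabel_tails.
      by rewrite count_inr_R -/(unzip1 R) ?cu ?il // !all_map; apply/allP.
    + by apply/mapP => -[].
    + by rewrite /absorbed mem_nth // index_uniq // il.
  have uJ : uniq [seq (inr (nth 0 us j) : nat + nat) | j <- lt] by exact: nth_uniq.
  have uJ' : uniq [seq (inl (10 + j) : nat + nat) | j <- lt].
    by rewrite map_inj_uniq // => i j [] /eqP; rewrite eqn_add2l => /eqP.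
  split; last first.
    apply: absorb_tails => // [[x|x]] //=; case: ifP => // /andP[xs xl] /mapP[]; exists (index x us) => //.
    by rewrite nth_index.
  by apply: absorb_tails_joinable => // i /hJ[].
have [okJ1 abs1] := J1P.
rewrite /leg_joins joins_catl -/J1 -/J2.
have sw2 : same_web (joins J2 (glue R (L ++ leg_stubs lt lh), 0)) (T1 ++ (L' ++ R2), 0).
  apply: same_web_trans abs2; apply: same_web_sym; apply: joins_same_web => //.
apply: same_web_trans (same_web_sym (joins_same_web _ (same_web_sym sw2))) _ => //.
apply: same_web_trans abs1 _; split=> //=.
rewrite !relabel_cat /L' !relabel_comp; apply: perm_cat.
  rewrite (relabel_in (p' := split_name us \o nth 0 us) (q' := split_name ws \o nth 0 ws)) //.
    by move=> i /Lu iu /=; rewrite /split_name mem_nth // index_uniq.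
  by move=> i /Lw iw /=; rewrite /split_name mem_nth // index_uniq.
rewrite (relabel_in (p' := split_name us) (q' := split_name ws)) //.
  by move=> x xR /=; exact: absorbed_split usP xR.
by move=> x xR /=; exact: absorbed_split wsP xR.
Qed.

End Cut.

(** * Overlaps of two redexes *)

Local Open Scope ring_scope.

Inductive shape := BigonShape of nat & nat | QuadShape of nat & nat & nat & nat.

Definition shape_edges s : seq (nat * nat) :=
  match s with
  | BigonShape u v => [:: (u, v); (u, v)]
  | QuadShape u1 w1 u2 w2 => [:: (u1, w1); (u2, w1); (u2, w2); (u1, w2)]
  end.

Definition shape_ok s : bool :=
  if s is QuadShape u1 w1 u2 w2 then (u1 != u2) && (w1 != w2) else true.

Definition shape_joins s : seq (seq (nat * nat)) :=
  match s with
  | BigonShape u v => [:: [:: (v, u)]]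
  | QuadShape u1 w1 u2 w2 => [:: [:: (w1, u1); (w2, u2)]; [:: (w1, u2); (w2, u1)]]
  end.

Definition shape_terms s (L : seq (nat * nat)) : seq term :=
  match s with
  | BigonShape u v => let G := joins [:: (v, u)] (L, 0%N) in
      resolved true 3 G ++ resolved true (- 3) G
  | QuadShape u1 w1 u2 w2 =>
      resolved true 0 (joins [:: (w1, u1); (w2, u2)] (L, 0%N)) ++
      resolved true 0 (joins [:: (w1, u2); (w2, u1)] (L, 0%N))
  end.

(** The redexes s1 and s2 of L give the same combination of pieces; a and b are
    the numbers of sources and sinks of L. *)
Definition overlap_check (a b : nat) (L : seq (nat * nat)) (s1 s2 : shape) : bool :=
  let lt := legs (unzip1 L) a in let lh := legs (unzip2 L) b in
  let m := (size L + size (leg_stubs lt lh))%N in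
  let BT := [seq (10 + i)%N | i <- lh] in let BH := [seq (10 + i)%N | i <- lt] in
  let rest s := remove_edges (shape_edges s) L in
  let ok s := [&& shape_ok s, perm_eq L (shape_edges s ++ rest s) &
    all (local_open m BT BH (rest s ++ leg_stubs lt lh)) (shape_joins s)] in
  [&& (a <= 10)%N, (b <= 10)%N, all (fun i => i < a)%N (unzip1 L), all (fun i => i < b)%N (unzip2 L),
      all (fun i => 2 <= count_mem i (unzip1 L) <= 3)%N (iota 0 a),
      all (fun i => 2 <= count_mem i (unzip2 L) <= 3)%N (iota 0 b), ok s1, ok s2 &
      vanishes m BT BH (shape_terms s1 (rest s1 ++ leg_stubs lt lh) ++
        map opposite_term (shape_terms s2 (rest s2 ++ leg_stubs lt lh)))].


Section Overlap.
Variables (K : comNzRingType) (A : int -> K) (M : comAlgType K) (irr : graph_class -> M).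
Hypothesis (AD : {morph A : x y / x + y >-> x * y}) (A0 : A 0 = 1).
Variables (n : nat) (g : seq (nat * nat) -> M).
Hypothesis gP : valuation_below A irr n g.

(** The value obtained by resolving a redex whose complement is R. *)
Definition resolution_value (outs : seq (K * seq (nat * nat))) (R : seq (nat * nat)) : M :=
  \sum_(o <- outs) o.1 *: open_value A g R o.2.

Definition shape_outs s : seq (K * seq (nat * nat)) :=
  match s with
  | BigonShape u v => [:: (bigon_value A, [:: (v, u)])]
  | QuadShape u1 w1 u2 w2 =>
      [:: (1, [:: (w1, u1); (w2, u2)]); (1, [:: (w1, u2); (w2, u1)])]
  end.

Lemma shape_redex s : shape_ok s -> redex A (shape_edges s) (shape_outs s).
Proof. by case: s => [u v _|u1 w1 u2 w2 /andP[uu ww]]; [exact: BigonRedex|exact: QuadRedex]. Qed.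

Lemma shape_outs_joins s o : o \in shape_outs s -> o.2 \in shape_joins s.
Proof. by case: s => [u v|u1 w1 u2 w2]; rewrite !inE; [move/eqP->|case/orP=> /eqP->]; rewrite eqxx ?orbT. Qed.

Lemma shape_terms_value (V : seq (nat * nat) -> M) s L :
  terms_value A V (shape_terms s L) =
    \sum_(o <- shape_outs s) o.1 *: web_value A V (joins o.2 (L, 0%N)).
Proof.
case: s => [u v|u1 w1 u2 w2]; rewrite /shape_terms /shape_outs terms_value_cat !terms_value_resolved //.
  by rewrite big_seq1 !expr0 !scale1r /bigon_value scalerDl.
by rewrite big_cons big_seq1 !A0 !expr0 !scale1r.
Qed.

Lemma shape_joins_ends s js j : js \in shape_joins s -> j \in js ->
  j.2 \in unzip1 (shape_edges s) /\ j.1 \in unzip2 (shape_edges s).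
Proof.
case: s => [u v|u1 w1 u2 w2]; rewrite !inE; first by move/eqP->; rewrite inE => /eqP-> /=; rewrite ?inE ?eqxx.
by case/orP=> /eqP->; rewrite !inE => /orP[] /eqP-> /=; rewrite ?inE ?eqxx ?orbT.
Qed.

Section Check.
Variables (us ws : seq nat) (L R : seq (nat * nat)).
Notation lt := (legs (unzip1 L) (size us)).
Notation lh := (legs (unzip2 L) (size ws)).
Notation m := (size L + size (leg_stubs lt lh))%N.
Notation BT := [seq (10 + i)%N | i <- lh].
Notation BH := [seq (10 + i)%N | i <- lt].
Notation place := (relabel (nth 0%N us) (nth 0%N ws)).
Notation js := (leg_joins us ws lt lh).
Notation V := (fun X => open_value A g (glue R X) js).
Hypotheses (uus : uniq us) (uws : uniq ws) (su : (size us <= 10)%N) (sw : (size ws <= 10)%N).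
Hypothesis Lu : all (fun i => i < size us)%N (unzip1 L).
Hypothesis Lw : all (fun i => i < size ws)%N (unzip2 L).
Hypothesis cu : all (fun i => 2 <= count_mem i (unzip1 L) <= 3)%N (iota 0 (size us)).
Hypothesis cw : all (fun i => 2 <= count_mem i (unzip2 L) <= 3)%N (iota 0 (size ws)).
Hypothesis tLR : trivalent (place L ++ R).
Hypothesis sLR : size (place L ++ R) = n.

Lemma count_place (ns X Y : seq nat) : uniq ns -> all (fun i => i < size ns)%N X ->
  all (fun i => 2 <= count_mem i X <= 3)%N (iota 0 (size ns)) ->
  degree_ok [::] (map (nth 0%N ns) X ++ Y) ->
  forall i, (i < size ns)%N -> count_mem (nth 0%N ns i) Y = (i \in legs X (size ns)).
Proof.
move=> un /allP lX /allP cX /degree_okP[_ h] i il.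
have cM : count_mem (nth 0%N ns i) (map (nth 0%N ns) X) = count_mem i X.
  rewrite count_map; apply: eq_in_count => j /lX jl /=; exact: nth_uniq.
have := h (nth 0%N ns i); rewrite in_nil count_cat cM mem_cat.
have := cX i; rewrite mem_iota il => /(_ isT) /andP[c2 c3].
rewrite -has_pred1 has_count cM (leq_trans _ c2) //= /legs mem_filter mem_iota il /= andbT.
by move: c2 c3; case: eqP => /= [->|]; clear; lia.
Qed.

Lemma degree_ok_legs (ns X Y : seq nat) : uniq ns -> all (fun i => i < size ns)%N X ->
  all (fun i => 2 <= count_mem i X <= 3)%N (iota 0 (size ns)) ->
  degree_ok [::] (map (nth 0%N ns) X ++ Y) ->
  degree_ok [seq nth 0%N ns i | i <- legs X (size ns)] Y.
Proof.
move=> un lX cX d; have c := count_place un lX cX d.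
have lL i : i \in legs X (size ns) -> (i < size ns)%N by rewrite mem_filter mem_iota => /andP[].
apply/degree_okP; split.
  rewrite map_inj_in_uniq ?filter_uniq ?iota_uniq // => i j /lL il /lL jl /eqP.
  by rewrite nth_uniq // => /eqP.
move=> x; case: mapP => [[i /[dup] iL /lL il ->]|xL]; first by rewrite c // iL.
have [xs|xs] := boolP (x \in ns).
  have := c (index x ns); rewrite index_mem nth_index // => /(_ xs).
  case: (boolP (index x ns \in _)) => [iL|_ c0]; first by case: xL; exists (index x ns); rewrite ?nth_index.
  by rewrite c0; move/count_memPn/negPf: c0 => ->.
have [_ /(_ x)] := degree_okP _ _ d; rewrite count_cat mem_cat.
have xX : x \notin map (nth 0%N ns) X.
  by apply/mapP => -[i iX e]; move: xs; rewrite e mem_nth // (allP lX).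
by rewrite (count_memPn xX) (negPf xX).
Qed.

Let dT : degree_ok [::] (map (nth 0%N us) (unzip1 L) ++ unzip1 R).
Proof.
by move: tLR; rewrite trivalent_open => /andP[+ _]; rewrite /unzip1 map_cat -!/(unzip1 _) relabel_tails.
Qed.

Let dH : degree_ok [::] (map (nth 0%N ws) (unzip2 L) ++ unzip2 R).
Proof.
by move: tLR; rewrite trivalent_open => /andP[_]; rewrite /unzip2 map_cat -!/(unzip2 _) relabel_heads.
Qed.

(** The hypotheses of the gluing lemmas, for the complement of the overlapping
    redexes. *)
Lemma overlap_context :
  [/\ perm_eq (lefts (unzip2 js)) BT, perm_eq (lefts (unzip1 js)) BH,
      degree_ok (rights (unzip2 js)) (unzip1 R), degree_ok (rights (unzip1 js)) (unzip2 R) &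
      (m + size R <= n + size js)%N].
Proof.
have lefts_map (f : nat -> nat) s : lefts [seq (inl (f i) : nat + nat) | i <- s] = map f s.
  by elim: s => //= x s ->.
have lefts_inr (f : nat -> nat) s : lefts [seq (inr (f i) : nat + nat) | i <- s] = [::].
  by elim: s => //= x s ->.
have rights_map (f : nat -> nat) s : rights [seq (inr (f i) : nat + nat) | i <- s] = map f s.
  by elim: s => //= x s ->.
have rights_inl (f : nat -> nat) s : rights [seq (inl (f i) : nat + nat) | i <- s] = [::].
  by elim: s => //= x s ->.
have pcat X Y (h : X + Y -> option X) := fun s1 s2 : seq (X + Y) => pmap_cat h s1 s2.
have e2 : unzip2 js = [seq inr (nth 0%N us i) | i <- lt] ++ [seq inl (10 + i)%N | i <- lh].
  by rewrite /leg_joins /unzip2 map_cat -!map_comp.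
have e1 : unzip1 js = [seq inl (10 + i)%N | i <- lt] ++ [seq inr (nth 0%N ws i) | i <- lh].
  by rewrite /leg_joins /unzip1 map_cat -!map_comp.
rewrite e1 e2 /lefts /rights !pmap_cat -!/(lefts _) -!/(rights _).
rewrite !lefts_map !lefts_inr !rights_map !rights_inl !cats0; split=> //.
- exact: degree_ok_legs.
- exact: degree_ok_legs.
- rewrite -sLR /leg_joins !size_cat !size_map -!addnA leq_add2l.
  by rewrite addnA addnC.
Qed.

Lemma placed_redex s : shape_ok s ->
  perm_eq L (shape_edges s ++ remove_edges (shape_edges s) L) ->
  redex A (place (shape_edges s))
    [seq (o.1, relabel_joins (nth 0%N us) (nth 0%N ws) o.2) | o <- shape_outs s].
Proof.
case: s => [u v _ _|u1 w1 u2 w2 /andP[uu ww] pL]; first exact: BigonRedex.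
have inL e : e \in shape_edges (QuadShape u1 w1 u2 w2) -> (e.1 < size us)%N && (e.2 < size ws)%N.
  move=> ee; have eL : e \in L by rewrite (perm_mem pL) mem_cat ee.
  by rewrite (allP Lu) ?(allP Lw) // map_f.
have /andP[a1 b1] := inL (u1, w1) (mem_head _ _).
have [|a2 b2] := andP (inL (u2, w2) _); first by rewrite !inE eqxx !orbT.
by apply: QuadRedex; rewrite nth_uniq.
Qed.

(** Resolving in the whole web is resolving in the piece, where it can be
    computed. *)
Lemma overlap_value s : shape_ok s ->
  perm_eq L (shape_edges s ++ remove_edges (shape_edges s) L) ->
  all (local_open m BT BH (remove_edges (shape_edges s) L ++ leg_stubs lt lh)) (shape_joins s) ->
  resolution_value [seq (o.1, relabel_joins (nth 0%N us) (nth 0%N ws) o.2) | o <- shape_outs s]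
    (place (remove_edges (shape_edges s) L) ++ R) =
  terms_value A V (shape_terms s (remove_edges (shape_edges s) L ++ leg_stubs lt lh)).
Proof.
set L1 := remove_edges _ _ => oks pL lo; have [c1 c2 c3 c4 c5] := overlap_context.
rewrite shape_terms_value /resolution_value big_map; apply: eq_big_seq => o oo /=; congr (_ *: _).
have oj := shape_outs_joins oo.
have r := shape_redex oks.
have [/allP Lu' /allP Lw'] := (Lu, Lw).
have tL i : i \in unzip1 L -> (i < size us)%N by exact: Lu'.
have hL i : i \in unzip2 L -> (i < size ws)%N by exact: Lw'.
have L1t i : i \in unzip1 L1 -> (i < size us)%N.
  by move=> iL; apply: tL; rewrite (perm_mem (perm_map _ pL)) /= map_cat mem_cat iL orbT.
have L1h i : i \in unzip2 L1 -> (i < size ws)%N.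
  by move=> iL; apply: hL; rewrite (perm_mem (perm_map _ pL)) /= map_cat mem_cat iL orbT.
have jL j : j \in o.2 -> (j.2 < size us)%N /\ (j.1 < size ws)%N.
  move=> jo; have [e1 e2] := shape_joins_ends oj jo.
  by split; [apply: tL | apply: hL];
     rewrite (perm_mem (perm_map _ pL)) /= map_cat mem_cat (e1, e2).
have nthI (ns : seq nat) i j : uniq ns -> (i < size ns)%N -> (j < size ns)%N ->
    nth 0%N ns i = nth 0%N ns j -> i = j.
  by move=> un il jl /eqP; rewrite nth_uniq // => /eqP.

have fR : fits n (place L1 ++ R) (relabel_joins (nth 0%N us) (nth 0%N ws) o.2).
  have r' := placed_redex oks pL.
  have pE : perm_eq (place L ++ R) (place (shape_edges s) ++ (place L1 ++ R)).
    by rewrite catA -relabel_cat perm_cat2r; exact: perm_map.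
  apply/andP; split.
    rewrite -[relabel_joins _ _ _]cats0.
    apply: (open_web_redex (o := (o.1, _)) r'); first by apply/mapP; exists o.
    by rewrite -(open_web_perm pE (perm_refl _)) -trivalent_open.
  have := perm_size pE; rewrite sLR => ->.
  rewrite (size_cat (place (shape_edges s))); apply: leq_trans (leq_addr _ _).
  by rewrite -[X in (X < _)%N]add0n ltn_add2r; case: (s).
rewrite -(open_value_relabel gP (@split_name_inj us) (@split_name_inj ws) fR).
have := fR; rewrite -(fits_relabel _ _ _ (@split_name_inj us) (@split_name_inj ws)).
have -> : relabel_joins (split_name us) (split_name ws) (relabel_joins (nth 0%N us) (nth 0%N ws) o.2)
    = relabel_joins inl inl o.2.
  rewrite /relabel_joins -map_comp; apply/eq_in_map => j /jL[j2 j1] /=.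
  by rewrite /split_name !mem_nth // !index_uniq.
move=> fS.
have cutP : same_web (joins js (glue R (L1 ++ leg_stubs lt lh), 0%N))
    (relabel (split_name us) (split_name ws) (place L1 ++ R), 0%N).
  apply: cut_legs; split=> //; rewrite ?filter_uniq ?iota_uniq //; try split; try exact/allP.
  - by apply/allP => i; rewrite mem_filter mem_iota => /andP[].
  - exact: count_place.
  - by apply/allP => i; rewrite mem_filter mem_iota => /andP[].
  - exact: count_place.
have lo' : local_open m BT BH (L1 ++ leg_stubs lt lh) o.2 by exact: (allP lo).
have fG := fits_glue_open c1 c2 c3 c4 c5 lo'.
rewrite -(open_value_glue A g R js (L1 ++ leg_stubs lt lh) o.2).
rewrite (open_value_perm gP fG (perm_refl _) (js' := relabel_joins inl inl o.2 ++ js)); last first.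
  by apply/permPl/perm_catC.
rewrite open_value_joins; case: cutP => pc ->; rewrite expr0 scale1r.
apply: (open_value_perm gP) => //; last by rewrite perm_sym.
Qed.
End Check.
End Overlap.

(** * Confluence of the bigon and quadrilateral relations *)

Lemma perm_cat_cancel (X : eqType) (a R R' E : seq X) :
  perm_eq E (a ++ R) -> perm_eq E (a ++ R') -> perm_eq R R'.
Proof. by move=> p p'; rewrite -(perm_cat2l a) -(permPl p). Qed.

Lemma disjoint_parts (X : eqType) (a b R1 R2 E : seq X) :
  perm_eq E (a ++ R1) -> perm_eq E (b ++ R2) -> (forall x, x \in a -> x \notin b) ->
  exists R, perm_eq R1 (b ++ R) /\ perm_eq R2 (a ++ R).
Proof.
move=> p1 p2 d; have [|R pR] := @submultiset _ a R2.
  move=> x; case: (boolP (x \in a)) => [xa|/count_memPn -> //].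
  have := seq.permP p2 (pred1 x); rewrite (seq.permP p1) !count_cat (count_memPn (d _ xa)).
  by rewrite add0n => <-; exact: leq_addr.
exists R; split=> //; apply: (perm_cat_cancel (a := a) p1).
by apply/seq.permP => x; rewrite (seq.permP p2) !count_cat (seq.permP pR) count_cat; clear; lia.
Qed.

(** The bigon lies on a side of the quadrilateral. *)
Lemma bigon_quad_check : overlap_check 2 2
  [:: (0,0);(0,0);(1,0);(1,1);(0,1)]%N (BigonShape 0 0) (QuadShape 0 0 1 1).
Proof. by vm_compute. Qed.

(** Two quadrilaterals with one side in common. *)
Lemma quad_quad_check11 : overlap_check 3 3
  [:: (0,0);(1,0);(1,1);(0,1);(2,0);(2,2);(0,2)]%N (QuadShape 0 0 1 1) (QuadShape 0 0 2 2).
Proof. by vm_compute. Qed.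

(** Two quadrilaterals with two sides in common, which end at the same sink. *)
Lemma quad_quad_check21 : overlap_check 2 3
  [:: (0,0);(1,0);(1,1);(0,1);(1,2);(0,2)]%N (QuadShape 0 0 1 1) (QuadShape 0 0 1 2).
Proof. by vm_compute. Qed.

(** Two quadrilaterals with two sides in common, which start at the same source. *)
Lemma quad_quad_check12 : overlap_check 3 2
  [:: (0,0);(1,0);(1,1);(0,1);(2,0);(2,1)]%N (QuadShape 0 0 1 1) (QuadShape 0 0 2 1).
Proof. by vm_compute. Qed.

Section Confluence.
Variables (K : comNzRingType) (A : int -> K) (M : comAlgType K) (irr : graph_class -> M).
Hypothesis (AD : {morph A : x y / x + y >-> x * y}) (A0 : A 0 = 1).
Variables (n : nat) (g : seq (nat * nat) -> M).
Hypothesis gP : valuation_below A irr n g.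
Notation rvalue := (resolution_value A g).

Section Fixed.
Variable E : seq (nat * nat).
Hypotheses (tE : trivalent E) (sE : size E = n).

Lemma fits_resolution es outs o R : redex A es outs -> o \in outs ->
  perm_eq E (es ++ R) -> fits n R o.2.
Proof.
move=> r oo pE; apply/andP; split.
  rewrite -[o.2]cats0; apply: (open_web_redex r oo).
  by rewrite -(open_web_perm pE (perm_refl _)) -trivalent_open.
rewrite -sE (perm_size pE) size_cat; apply: leq_trans (leq_addr _ _).
by rewrite -[X in (X < _)%N]add0n ltn_add2r; case: r.
Qed.

Lemma resolution_value_perm es outs R R' : redex A es outs ->
  perm_eq E (es ++ R) -> perm_eq E (es ++ R') -> rvalue outs R = rvalue outs R'.
Proof.
move=> r p p'; apply: eq_big_seq => o oo; congr (_ *: _).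
apply: (open_value_perm gP) => //; first exact: fits_resolution r oo p.
exact: perm_cat_cancel p p'.
Qed.

(** The check is made once for all on L; here it is used at the vertices us and
    ws of an arbitrary web. *)
Lemma overlap_confluent us ws L s1 s2 R1 R2 R :
  let place := relabel (nth 0%N us) (nth 0%N ws) in
  let outs s := [seq (o.1, relabel_joins (nth 0%N us) (nth 0%N ws) o.2) | o <- shape_outs A s] in
  overlap_check (size us) (size ws) L s1 s2 -> uniq us -> uniq ws ->
  perm_eq E (place L ++ R) ->
  perm_eq E (place (shape_edges s1) ++ R1) -> perm_eq E (place (shape_edges s2) ++ R2) ->
  rvalue (outs s1) R1 = rvalue (outs s2) R2.
Proof.
move=> place outs /and5P[su sw Lu Lw /and5P[cu cw /and3P[ok1 pL1 lo1] /and3P[ok2 pL2 lo2] van]] uu uw pE p1 p2.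
have tLR : trivalent (place L ++ R).
  by rewrite trivalent_open -(open_web_perm pE (perm_refl _)) -trivalent_open.
have sLR : size (place L ++ R) = n by rewrite -(perm_size pE).
have rest s : perm_eq L (shape_edges s ++ remove_edges (shape_edges s) L) ->
    perm_eq E (place (shape_edges s) ++ (place (remove_edges (shape_edges s) L) ++ R)).
  by move=> pL; rewrite (perm_trans pE) // catA -relabel_cat perm_cat2r; exact: perm_map.
have r1 := placed_redex A uu uw Lu Lw ok1 pL1.
have r2 := placed_redex A uu uw Lu Lw ok2 pL2.
rewrite (resolution_value_perm r1 p1 (rest _ pL1)) (resolution_value_perm r2 p2 (rest _ pL2)).
rewrite (overlap_value AD A0 gP) // (overlap_value AD A0 gP) //.
have [c1 c2 c3 c4 c5] := overlap_context uu uw Lu Lw cu cw tLR sLR.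
have VP := glue_local gP c1 c2 c3 c4 c5.
have := vanishesP AD VP van; rewrite terms_value_cat.
rewrite terms_value_opposite.
by move/eqP; rewrite subr_eq0 => /eqP.
Qed.

(** Both orders of resolution give the double sum over the joinings of both
    redexes. *)
Lemma redex_disjoint es1 es2 outs1 outs2 R1 R2 :
  redex A es1 outs1 -> redex A es2 outs2 ->
  perm_eq E (es1 ++ R1) -> perm_eq E (es2 ++ R2) ->
  (forall x, x \in unzip1 es1 -> x \notin unzip1 es2) ->
  rvalue outs1 R1 = rvalue outs2 R2.
Proof.
move=> r1 r2 p1 p2 d.
have [R [pR1 pR2]] : exists R, perm_eq R1 (es2 ++ R) /\ perm_eq R2 (es1 ++ R).
  apply: disjoint_parts p1 p2 _ => e e1; apply/negP => e2.
  by have := d e.1; rewrite !map_f // => /(_ isT).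
have step es es' outs outs' R' : redex A es outs -> redex A es' outs' ->
    perm_eq E (es ++ R') -> perm_eq R' (es' ++ R) ->
    rvalue outs R' = \sum_(o <- outs) \sum_(o' <- outs') o.1 *: (o'.1 *: open_value A g R (o'.2 ++ o.2)).
  move=> r r' p pR'; apply: eq_big_seq => o oo; have f := fits_resolution r oo p.
  rewrite (open_value_perm gP f pR' (perm_refl _)).
  have f' : fits n (es' ++ R) o.2.
    by case/andP: f => f1 f2; rewrite /fits -(open_web_perm pR' (perm_refl _)) f1 -(perm_size pR').
  by rewrite (open_value_redex gP r' f') scaler_sumr.
rewrite (step _ _ _ _ _ r1 r2 p1 pR1) (step _ _ _ _ _ r2 r1 p2 pR2) exchange_big /=.
apply: eq_big_seq => o2 oo2; apply: eq_big_seq => o1 oo1; rewrite scaler_swap; do 2 congr (_ *: _).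
apply: (open_value_perm gP) => //; last by apply/permPl/perm_catC.
have /andP[f1 f2] := fits_resolution r1 oo1 p1.
apply/andP; split.
  by apply: (open_web_redex r2 oo2); rewrite -(open_web_perm pR1 (perm_refl _)).
rewrite size_cat; apply: (@leq_ltn_trans (size R1)); last by apply: leq_trans f2 _; rewrite leq_add2l leq_addl.
by rewrite (perm_size pR1) size_cat leq_addl.
Qed.


Local Notation quad_edges u1 w1 u2 w2 := [:: (u1, w1); (u2, w1); (u2, w2); (u1, w2)].
Notation quad_outs u1 w1 u2 w2 :=
  [:: (1 : K, [:: (w1, u1); (w2, u2)]); (1 : K, [:: (w1, u2); (w2, u1)])].

Lemma quad_sources_sym u1 w1 u2 w2 R :
  rvalue (quad_outs u1 w1 u2 w2) R = rvalue (quad_outs u2 w1 u1 w2) R.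
Proof. by rewrite /resolution_value !big_cons !big_nil !addr0 addrC. Qed.

Lemma quad_sinks_sym u1 w1 u2 w2 R : u1 != u2 -> w1 != w2 ->
  perm_eq E (quad_edges u1 w1 u2 w2 ++ R) ->
  rvalue (quad_outs u1 w1 u2 w2) R = rvalue (quad_outs u1 w2 u2 w1) R.
Proof.
move=> uu ww pE; have r := QuadRedex A uu ww.
have sw (a b : nat * nat) : perm_eq [:: a; b] [:: b; a] by exact: perm_swap_head.
rewrite /resolution_value !big_cons !big_nil !addr0 addrC; congr (_ *: _ + _ *: _) => /=.
  apply: (open_value_perm gP) => //.
  by apply: (fits_resolution (o := (1, [:: (w1, u2); (w2, u1)])) r _ pE); rewrite !inE eqxx orbT.
apply: (open_value_perm gP) => //.
by apply: (fits_resolution (o := (1, [:: (w1, u1); (w2, u2)])) r _ pE); rewrite !inE eqxx.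
Qed.

Lemma bigon_quad_at u1 w1 u2 w2 R1 R2 : u1 != u2 -> w1 != w2 ->
  perm_eq E ([:: (u1, w1); (u1, w1)] ++ R1) -> perm_eq E (quad_edges u1 w1 u2 w2 ++ R2) ->
  rvalue [:: (bigon_value A, [:: (w1, u1)])] R1 = rvalue (quad_outs u1 w1 u2 w2) R2.
Proof.
move=> uu ww p1 p2.
have [R pR] : exists R, perm_eq R1 ([:: (u2, w1); (u2, w2); (u1, w2)] ++ R).
  apply: submultiset_uniq.
    by rewrite /= !inE !xpair_eqE !eqxx ?(eq_sym u2) ?(eq_sym w2) (negPf uu) (negPf ww) ?andbF.
  move=> e e3; have : e \in E by rewrite (perm_mem p2) mem_cat inE e3 ?orbT.
  rewrite (perm_mem p1) mem_cat => /orP[|//]; move: e3; rewrite !inE orbb.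
  by case/or3P=> /eqP->; rewrite !xpair_eqE ?(eq_sym u2) ?(eq_sym w2) ?(negPf uu) ?(negPf ww) ?andbF.
apply: (overlap_confluent (us := [:: u1; u2]) (ws := [:: w1; w2]) (R := R) bigon_quad_check _ _ _ p1 p2).
- by rewrite /= inE uu.
- by rewrite /= inE ww.
- by rewrite (perm_trans p1) //= !perm_cons.
Qed.

(** The vertices u1 and w1 form a common side; whether u3 = u2 or w3 = w2
    decides which check applies, and if both hold the quadrilaterals are equal. *)
Lemma quad_quad_at u1 w1 u2 w2 u3 w3 R1 R2 :
  u1 != u2 -> w1 != w2 -> u1 != u3 -> w1 != w3 ->
  perm_eq E (quad_edges u1 w1 u2 w2 ++ R1) -> perm_eq E (quad_edges u1 w1 u3 w3 ++ R2) ->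
  rvalue (quad_outs u1 w1 u2 w2) R1 = rvalue (quad_outs u1 w1 u3 w3) R2.
Proof.
move=> u12 w12 u13 w13 p1 p2.
have E1 e : e \in quad_edges u1 w1 u2 w2 -> e \in E by rewrite (perm_mem p1) mem_cat => ->.
have E2 e : e \in quad_edges u1 w1 u3 w3 -> e \in E by rewrite (perm_mem p2) mem_cat => ->.
have [e2|u23] := eqVneq u2 u3; have [f2|w23] := eqVneq w2 w3.
- rewrite e2 f2 in u12 w12 p1 *.
  exact: resolution_value_perm (QuadRedex A u12 w12) p1 p2.
- rewrite e2 in u12 p1 E1 *.
  have [||R pR] := @submultiset_uniq _ (relabel (nth 0%N [:: u1; u3]) (nth 0%N [:: w1; w2; w3])
    [:: (0,0);(1,0);(1,1);(0,1);(1,2);(0,2)]%N) E.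
  + rewrite /= !inE !xpair_eqE !eqxx ?(eq_sym u3) ?(eq_sym w2) ?(eq_sym w3).
    by rewrite (negPf u13) (negPf w12) (negPf w13) (negPf w23) ?andbF.
  + move=> e; rewrite /= !inE => /or4P[||| /or3P[]] /eqP->; first [apply: E1; rewrite !inE eqxx ?orbT // | apply: E2; rewrite !inE eqxx ?orbT //].
  apply: (overlap_confluent (us := [:: u1; u3]) (ws := [:: w1; w2; w3]) (R := R) quad_quad_check21 _ _ _ p1 p2) => //.
    by rewrite /= inE u13.
  by rewrite /= !inE negb_or w12 w13 w23.
- rewrite f2 in w12 p1 E1 *.
  have [||R pR] := @submultiset_uniq _ (relabel (nth 0%N [:: u1; u2; u3]) (nth 0%N [:: w1; w3])
    [:: (0,0);(1,0);(1,1);(0,1);(2,0);(2,1)]%N) E.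
  + rewrite /= !inE !xpair_eqE !eqxx ?(eq_sym u2) ?(eq_sym u3) ?(eq_sym w3).
    by rewrite (negPf u12) (negPf u13) (negPf w13) (negPf u23) ?andbF.
  + move=> e; rewrite /= !inE => /or4P[||| /or3P[]] /eqP->; first [apply: E1; rewrite !inE eqxx ?orbT // | apply: E2; rewrite !inE eqxx ?orbT //].
  apply: (overlap_confluent (us := [:: u1; u2; u3]) (ws := [:: w1; w3]) (R := R) quad_quad_check12 _ _ _ p1 p2) => //.
    by rewrite /= !inE negb_or u12 u13 u23.
  by rewrite /= inE w13.
- have [||R pR] := @submultiset_uniq _ (relabel (nth 0%N [:: u1; u2; u3]) (nth 0%N [:: w1; w2; w3])
    [:: (0,0);(1,0);(1,1);(0,1);(2,0);(2,2);(0,2)]%N) E.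
  + rewrite /= !inE !xpair_eqE !eqxx ?(eq_sym u2) ?(eq_sym u3) ?(eq_sym w2) ?(eq_sym w3).
    by rewrite (negPf u12) (negPf u13) (negPf w12) (negPf w13) (negPf u23) (negPf w23) ?andbF.
  + move=> e; rewrite /= !inE => /or4P[||| /or4P[]] /eqP->; first [apply: E1; rewrite !inE eqxx ?orbT // | apply: E2; rewrite !inE eqxx ?orbT //].
  apply: (overlap_confluent (us := [:: u1; u2; u3]) (ws := [:: w1; w2; w3]) (R := R) quad_quad_check11 _ _ _ p1 p2) => //.
    by rewrite /= !inE negb_or u12 u13 u23.
  by rewrite /= !inE negb_or w12 w13 w23.
Qed.

Lemma source_degree s R u : perm_eq E (s ++ R) -> (count_mem u (unzip1 s) <= 3)%N.
Proof.
move=> pE; have := tE; rewrite trivalent_open => /andP[/degree_okP[_ /(_ u)] /= h _].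
move: h; rewrite (seq.permP (perm_map _ pE)) map_cat count_cat => h.
apply: (leq_trans (leq_addr (count_mem u (map fst R)) _)); rewrite h.
by case: ifP => // _; case: ifP.
Qed.

(** Otherwise the two sets of edges would be disjoint, and the degree of u would
    exceed 3. *)
Lemma shared_source_edge es1 es2 R1 R2 u :
  perm_eq E (es1 ++ R1) -> perm_eq E (es2 ++ R2) ->
  (3 < count_mem u (unzip1 es1) + count_mem u (unzip1 es2))%N -> has (mem es2) es1.
Proof.
move=> p1 p2; apply: contraTT => /hasPn d; rewrite -leqNgt.
have [R [pR _]] := disjoint_parts p1 p2 d.
have pE : perm_eq E ((es1 ++ es2) ++ R) by rewrite (perm_trans p1) // -catA perm_cat2l.
by have := source_degree u pE; rewrite /unzip1 map_cat count_cat.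
Qed.

Lemma quad_edges_sources (u1 w1 u2 w2 : nat) (R : seq (nat * nat)) :
  perm_eq (quad_edges u1 w1 u2 w2 ++ R) (quad_edges u2 w1 u1 w2 ++ R).
Proof. by apply/seq.permP => a /=; clear; lia. Qed.

Lemma quad_edges_sinks (u1 w1 u2 w2 : nat) (R : seq (nat * nat)) :
  perm_eq (quad_edges u1 w1 u2 w2 ++ R) (quad_edges u1 w2 u2 w1 ++ R).
Proof. by apply/seq.permP => a /=; clear; lia. Qed.

Lemma bigon_quad_source u v w1 u2 w2 R1 R2 : u != u2 -> w1 != w2 ->
  perm_eq E ([:: (u, v); (u, v)] ++ R1) -> perm_eq E (quad_edges u w1 u2 w2 ++ R2) ->
  rvalue [:: (bigon_value A, [:: (v, u)])] R1 = rvalue (quad_outs u w1 u2 w2) R2.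
Proof.
move=> uu ww p1 p2.
have /hasP[e] : has (mem (quad_edges u w1 u2 w2)) [:: (u, v); (u, v)].
  by apply: (shared_source_edge (u := u) p1 p2); rewrite /= !eqxx (eq_sym u2) (negPf uu).
rewrite !inE orbb => /eqP-> /=; rewrite ?inE !xpair_eqE (negPf uu) eqxx /=.
case/orP => /eqP e'; first by rewrite e' in p1 *; exact: bigon_quad_at p1 p2.
rewrite e' in p1 *; rewrite (quad_sinks_sym uu ww p2).
by apply: (bigon_quad_at uu _ p1); [rewrite eq_sym|rewrite (perm_trans p2) // quad_edges_sinks].
Qed.

Lemma quad_quad_source u1 w1 u2 w2 u3 y1 y2 R1 R2 :
  u1 != u2 -> w1 != w2 -> u1 != u3 -> y1 != y2 ->
  perm_eq E (quad_edges u1 w1 u2 w2 ++ R1) -> perm_eq E (quad_edges u1 y1 u3 y2 ++ R2) ->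
  rvalue (quad_outs u1 w1 u2 w2) R1 = rvalue (quad_outs u1 y1 u3 y2) R2.
Proof.
move=> u12 w12 u13 y12 p1 p2.
have w21 : w2 != w1 by rewrite eq_sym.
have y21 : y2 != y1 by rewrite eq_sym.
have p1' : perm_eq E (quad_edges u1 w2 u2 w1 ++ R1).
  by rewrite (perm_trans p1) // quad_edges_sinks.
have p2' : perm_eq E (quad_edges u1 y2 u3 y1 ++ R2).
  by rewrite (perm_trans p2) // quad_edges_sinks.
have : [|| w1 == y1, w1 == y2, w2 == y1 | w2 == y2].
  have /hasP[[a b]] : has (mem (quad_edges u1 y1 u3 y2)) (quad_edges u1 w1 u2 w2).
    apply: (shared_source_edge (u := u1) p1 p2).
    by rewrite /= !eqxx (eq_sym u2) (eq_sym u3) (negPf u12) (negPf u13).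
  rewrite !inE !xpair_eqE => /or4P[] /andP[_ /eqP->] /or4P[] /andP[_ ->]; rewrite ?orbT //.
case/or4P => /eqP e.
- rewrite -e in y12 p2 *; exact: quad_quad_at p1 p2.
- rewrite (quad_sinks_sym u13 y12 p2); rewrite -e in y21 p2' *; exact: quad_quad_at p1 p2'.
- rewrite (quad_sinks_sym u12 w12 p1); rewrite -e in y12 p2 *; exact: quad_quad_at p1' p2.
- rewrite (quad_sinks_sym u12 w12 p1) (quad_sinks_sym u13 y12 p2).
  rewrite -e in y21 p2' *; exact: quad_quad_at p1' p2'.
Qed.

Lemma bigon_quad u v u1 w1 u2 w2 R1 R2 : u1 != u2 -> w1 != w2 ->
  perm_eq E ([:: (u, v); (u, v)] ++ R1) -> perm_eq E (quad_edges u1 w1 u2 w2 ++ R2) ->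
  rvalue [:: (bigon_value A, [:: (v, u)])] R1 = rvalue (quad_outs u1 w1 u2 w2) R2.
Proof.
move=> uu ww p1 p2.
have [e|nu1] := eqVneq u u1; first by rewrite -e in uu p2 *; exact: bigon_quad_source p1 p2.
have [e|nu2] := eqVneq u u2.
  rewrite -e in uu p2 *; rewrite quad_sources_sym.
  apply: (bigon_quad_source _ ww p1); first by rewrite eq_sym.
  by rewrite (perm_trans p2) // quad_edges_sources.
apply: (redex_disjoint (BigonRedex A u v) (QuadRedex A uu ww) p1 p2) => x /=.
by rewrite !inE orbb => /eqP->; rewrite (negPf nu1) (negPf nu2).
Qed.

Lemma quad_quad u1 w1 u2 w2 x1 y1 x2 y2 R1 R2 :
  u1 != u2 -> w1 != w2 -> x1 != x2 -> y1 != y2 ->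
  perm_eq E (quad_edges u1 w1 u2 w2 ++ R1) -> perm_eq E (quad_edges x1 y1 x2 y2 ++ R2) ->
  rvalue (quad_outs u1 w1 u2 w2) R1 = rvalue (quad_outs x1 y1 x2 y2) R2.
Proof.
move=> uu ww xx yy p1 p2.
have uu' : u2 != u1 by rewrite eq_sym.
have xx' : x2 != x1 by rewrite eq_sym.
have p1' : perm_eq E (quad_edges u2 w1 u1 w2 ++ R1).
  by rewrite (perm_trans p1) // quad_edges_sources.
have p2' : perm_eq E (quad_edges x2 y1 x1 y2 ++ R2).
  by rewrite (perm_trans p2) // quad_edges_sources.
have [e|n11] := eqVneq u1 x1.
  by rewrite -e in xx p2 *; exact: quad_quad_source p1 p2.
have [e|n12] := eqVneq u1 x2.
  rewrite [RHS]quad_sources_sym; rewrite -e in xx' p2' *.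
  exact: quad_quad_source p1 p2'.
have [e|n21] := eqVneq u2 x1.
  by rewrite quad_sources_sym; rewrite -e in xx p2 *; exact: quad_quad_source p1' p2.
have [e|n22] := eqVneq u2 x2.
  by rewrite quad_sources_sym [RHS]quad_sources_sym; rewrite -e in xx' p2' *;
    exact: quad_quad_source p1' p2'.
apply: (redex_disjoint (QuadRedex A uu ww) (QuadRedex A xx yy) p1 p2) => x /=.
by rewrite !inE => /or4P[] /eqP->; rewrite ?(negPf n11) ?(negPf n12) ?(negPf n21) ?(negPf n22).
Qed.

(** Two bigons with a common source are equal, because they share an edge. *)
Lemma redex_confluent es1 es2 outs1 outs2 R1 R2 :
  redex A es1 outs1 -> redex A es2 outs2 ->
  perm_eq E (es1 ++ R1) -> perm_eq E (es2 ++ R2) -> rvalue outs1 R1 = rvalue outs2 R2.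
Proof.
case=> [u v|u1 w1 u2 w2 uu ww]; case=> [u' v'|x1 y1 x2 y2 xx yy] p1 p2.
- have [e|nu] := eqVneq u u'; last first.
    apply: (redex_disjoint (BigonRedex A u v) (BigonRedex A u' v') p1 p2) => x /=.
    by rewrite !inE !orbb => /eqP->.
  rewrite -e in p2 *.
  have /hasP[x] : has (mem [:: (u, v'); (u, v')]) [:: (u, v); (u, v)].
    by apply: (shared_source_edge (u := u) p1 p2); rewrite /= !eqxx.
  rewrite !inE orbb => /eqP-> /=; rewrite ?inE orbb xpair_eqE eqxx => /eqP e'.
  by rewrite -e' in p2 *; exact: resolution_value_perm (BigonRedex A u v) p1 p2.
- exact: bigon_quad p1 p2.
- exact/esym/(bigon_quad _ _ p2 p1).
- exact: quad_quad p1 p2.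
Qed.

End Fixed.
End Confluence.

(** * Reductions of a web and their agreement *)

Lemma degree_ok_disjoint (X : eqType) (a b : seq X) : disjoint_names a b ->
  degree_ok [::] (a ++ b) = degree_ok [::] a && degree_ok [::] b.
Proof.
move=> /allP d.
have d' x : x \in a -> x \notin b by move=> xa; apply/negP => /d; rewrite xa.
apply/degree_okP/andP => [[_ h]|[/degree_okP[_ h1] /degree_okP[_ h2]]].
  split; apply/degree_okP; split=> // x; have := h x; rewrite !in_nil count_cat mem_cat.
    case: (boolP (x \in a)) => [/d'/count_memPn -> /=|/count_memPn -> //]; by rewrite addn0.
  by case: (boolP (x \in b)) => [/d/count_memPn -> /=|/count_memPn -> //]; rewrite ?add0n ?orbT.
split=> // x; rewrite count_cat mem_cat h1 h2 !in_nil.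
by case: (boolP (x \in a)) => [/d'/negPf ->|_] //=.
Qed.

Definition disjoint_webs (S T : eqType) (E F : seq (S * T)) :=
  disjoint_names (unzip1 E) (unzip1 F) && disjoint_names (unzip2 E) (unzip2 F).

Lemma trivalent_union E F : disjoint_webs E F -> trivalent (E ++ F) = trivalent E && trivalent F.
Proof.
case/andP=> d1 d2; rewrite !trivalent_open /open_web /= /unzip1 /unzip2 !map_cat.
by rewrite !degree_ok_disjoint // andbACA.
Qed.

Lemma disjoint_namesC (X : eqType) (a b : seq X) : disjoint_names a b = disjoint_names b a.
Proof.
by apply/allP/allP => h x xs; apply/negP => /h; rewrite xs.
Qed.

Lemma disjoint_websC (S T : eqType) (E F : seq (S * T)) : disjoint_webs E F = disjoint_webs F E.
Proof. by rewrite /disjoint_webs disjoint_namesC [X in _ && X]disjoint_namesC. Qed.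

Lemma disjoint_webs_sub (S T : eqType) (E E' F F' : seq (S * T)) :
  {subset unzip1 E' <= unzip1 E} -> {subset unzip2 E' <= unzip2 E} ->
  {subset unzip1 F' <= unzip1 F} -> {subset unzip2 F' <= unzip2 F} ->
  disjoint_webs E F -> disjoint_webs E' F'.
Proof.
move=> s1 s2 s3 s4 /andP[/allP d1 /allP d2]; apply/andP; split; apply/allP => x.
  by move/s3/d1; apply: contra; exact: s1.
by move/s4/d2; apply: contra; exact: s2.
Qed.

Lemma class_iso G H : graph_iso G H -> class G = class H.
Proof. by move=> GH; apply/eqmodP/asboolP. Qed.

Local Notation quad_edges u1 w1 u2 w2 := [:: (u1, w1); (u2, w1); (u2, w2); (u1, w2)].

Lemma relabel_id (S T : eqType) (E : seq (S * T)) : relabel id id E = E.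
Proof. by rewrite /relabel map_id_in // => -[]. Qed.

Section Candidates.
Variables (K : comNzRingType) (A : int -> K) (M : comAlgType K) (irr : graph_class -> M).
Hypothesis (AD : {morph A : x y / x + y >-> x * y}) (A0 : A 0 = 1).

(** The empty web, a redex, or a splitting into two nonempty parts without
    common vertices. *)
Inductive reduction (g : seq (nat * nat) -> M) (E : seq (nat * nat)) : M -> Prop :=
| ReduceNil of E = [::] : reduction g E 1
| ReduceRedex es outs R of redex A es outs & perm_eq E (es ++ R) :
    reduction g E (resolution_value A g outs R)
| ReduceUnion F1 F2 of perm_eq E (F1 ++ F2) & disjoint_webs F1 F2 & F1 != [::] & F2 != [::] :
    reduction g E (g F1 * g F2).

(** The values which the relations impose on a web, from the values of smaller
    ones. *)
Inductive candidate g E v : Prop :=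
| CandidateReduction of reduction g E v
| CandidateIrreducible G of irreducible_graph G & perm_eq E (edges G) & v = irr (class G).

(** A web that is not connected splits into the part which can be reached from a
    vertex and its complement. *)
Lemma irreducible_of_no_reduction g E (tE : trivalent E) :
  (forall v, ~ reduction g E v) -> irreducible_graph (Graph (web := (E, 0%N)) tE).
Proof.
move=> nored; have E0 : E != [::] by apply/negP => /eqP e; exact: nored (ReduceNil g e).
have noredex es outs R : redex A es outs -> perm_eq E (es ++ R) -> False.
  by move=> r p; exact: nored (ReduceRedex g r p).
have nounion F1 F2 : perm_eq E (F1 ++ F2) -> disjoint_webs F1 F2 -> F1 != [::] -> F2 != [::] -> False.
  by move=> p d n1 n2; exact: nored (ReduceUnion g p d n1 n2).
set G := Graph _; split; last first.
- move=> u1 w1 u2 w2; apply/negP => /and3P[uu ww /allP sE].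
  have [|R pR] := @submultiset_uniq _ [:: (u1, w1); (u2, w1); (u2, w2); (u1, w2)] E _ sE.
    by rewrite /= !inE !xpair_eqE !eqxx ?(eq_sym u2) ?(eq_sym w2) (negPf uu) (negPf ww) ?andbF.
  exact: noredex (QuadRedex A uu ww) pR.
- move=> u v; apply/negP => b.
  have [|R pR] := @submultiset _ [:: (u, v); (u, v)] E.
    by move=> e /=; case: eqP => [<-|_] //; rewrite addn0.
  exact: noredex (BigonRedex A u v) pR.
pose reach x z := `[< exists2 p, path (adjacent G) x p & last x p = z >].
have reach_step x y z : reach x y -> adjacent G y z -> reach x z.
  move=> /asboolP[p px <-] yz; apply/asboolP; exists (rcons p z); last by rewrite last_rcons.
  by rewrite rcons_path px.
have reach0 x : reach x x by apply/asboolP; exists [::].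
split=> // [|x y xG yG]; first by rewrite /vertices /edges /=; case: (E) E0.
apply/asboolP; rewrite -/(reach x y).
(* The part of the web in the component of x, its edges being recognized by
   their tails. *)
pose P (e : nat * nat) := reach x (inl e.1).
have PE e : e \in E -> reach x (inl e.1) = reach x (inr e.2).
  by case: e => u v eE; apply/idP/idP => h; apply: (reach_step _ _ _ h).
have pE : perm_eq E ([seq e <- E | P e] ++ [seq e <- E | predC P e]).
  by rewrite perm_sym; exact/permPl/perm_filterC.
have F1n : [seq e <- E | P e] != [::].
  rewrite -has_filter; apply/hasP; move: xG; rewrite mem_cat.
  case/orP => /mapP[z /mapP[e eE ->] xe]; exists e => //.
    by rewrite /P -xe; exact: reach0.
  by rewrite /P PE // -xe; exact: reach0.
case: (eqVneq [seq e <- E | predC P e] [::]) => [F2n|F2n]; last first.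
  exfalso; apply: (nounion _ _ pE _ F1n F2n).
  apply/andP; split; apply/allP => _ /mapP[e + ->]; rewrite mem_filter => /andP[/= Pe eE];
    apply/negP => /mapP[e']; rewrite mem_filter => /andP[Pe' eE'] ee.
    by move: Pe; rewrite /P ee -/(P e') Pe'.
  by move: Pe; rewrite /P PE // ee -PE // -/(P e') Pe'.
have allP e : e \in E -> P e.
  move=> eE; apply/negPn/negP => nP; move: F2n; apply/eqP; rewrite -has_filter.
  by apply/hasP; exists e.
move: yG; rewrite mem_cat => /orP[] /mapP[z /mapP[e eE ->] ->]; first exact: allP.
by rewrite -PE //; exact: allP.
Qed.

Lemma candidate_exists g E : trivalent E -> exists v, candidate g E v.
Proof.
move=> tE; case: (pselect (exists v, reduction g E v)) => [[v r]|nored]; first by exists v; left.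
exists (irr (class (Graph (web := (E, 0%N)) tE))); right with (Graph (web := (E, 0%N)) tE) => //.
by apply: (@irreducible_of_no_reduction g) => v r; apply: nored; exists v.
Qed.


Section Level.
Variables (n : nat) (g : seq (nat * nat) -> M).
Hypothesis gP : valuation_below A irr n g.

Lemma open_value_nat E js : fits n E js ->
  open_value A g E js = web_value A g (joins js (E, 0%N)).
Proof.
move=> fE; have := fits_joins (js := [::]) 0 fE; rewrite /open_value.
case: (joins js (E, 0%N)) => F k /= /andP[oF sF]; rewrite /web_value /=; congr (_ *: _).
have tF : trivalent F by rewrite trivalent_open.
apply: (valuation_iso gP tF) (perm_refl _); rewrite ?addn0 // in sF *.
all: exact: pickle_inj.
Qed.

Lemma valuation_perm E E' : trivalent E -> (size E < n)%N -> perm_eq E E' -> g E = g E'.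
Proof.
move=> tE sE pE; apply/esym/(valuation_iso gP (p := id) (q := id) tE sE) => //.
by rewrite relabel_id perm_sym.
Qed.

Lemma resolution_value_web E es outs R : trivalent E -> (size E <= n)%N ->
  redex A es outs -> perm_eq E (es ++ R) ->
  resolution_value A g outs R = \sum_(o <- outs) o.1 *: web_value A g (joins o.2 (R, 0%N)).
Proof.
move=> tE sE r pE; apply: eq_big_seq => o oo; rewrite open_value_nat //.
apply/andP; split.
  rewrite -[o.2]cats0; apply: (open_web_redex r oo).
  by rewrite -(open_web_perm pE (perm_refl _)) -trivalent_open.
apply: leq_trans (leq_addr _ _); apply: leq_trans sE.
by rewrite (perm_size pE) size_cat -[X in (X < _)%N]add0n ltn_add2r; case: r.
Qed.

Lemma valuation_reduction E v : trivalent E -> (size E < n)%N -> reduction g E v -> g E = v.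
Proof.
move=> tE sE [->|es outs R r p|F1 F2 p d _ _]; first exact: valuation_nil gP.
  rewrite (resolution_value_web tE (ltnW sE) r p) (valuation_perm tE sE p).
  apply: (valuation_redex gP r); last by rewrite -(perm_size p).
  by rewrite trivalent_open -(open_web_perm p (perm_refl _)) -trivalent_open.
have tU : trivalent (F1 ++ F2).
  by rewrite trivalent_open -(open_web_perm p (perm_refl _)) -trivalent_open.
rewrite (valuation_perm tE sE p); move: (tU); rewrite trivalent_union // => /andP[t1 t2].
by case/andP: d => d1 d2; apply: (valuation_union gP) => //; rewrite -(perm_size p).
Qed.

Section Fixed.
Variable E : seq (nat * nat).
Hypotheses (tE : trivalent E) (sE : size E = n).

Lemma parts_trivalent F1 F2 : perm_eq E (F1 ++ F2) -> disjoint_webs F1 F2 ->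
  trivalent F1 && trivalent F2.
Proof.
move=> p d; rewrite -(trivalent_union d) trivalent_open -(open_web_perm p (perm_refl _)).
by rewrite -trivalent_open.
Qed.

Lemma parts_size F1 F2 : perm_eq E (F1 ++ F2) -> F1 != [::] -> F2 != [::] ->
  (size F1 < n)%N && (size F2 < n)%N.
Proof.
move=> /perm_size; rewrite sE size_cat => -> ; rewrite -!size_eq0; clear; lia.
Qed.

(** The edges of a redex are connected. *)
Lemma redex_in_part es outs R F1 F2 : redex A es outs ->
  perm_eq E (es ++ R) -> perm_eq E (F1 ++ F2) -> disjoint_webs F1 F2 ->
  {subset es <= F1} \/ {subset es <= F2}.
Proof.
move=> r p p' /andP[/allP d1 /allP d2].
have inE' e : e \in es -> (e \in F1) || (e \in F2).
  by move=> ee; rewrite -mem_cat -(perm_mem p') (perm_mem p) mem_cat ee.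
have tail e e' : e \in F1 -> e' \in F2 -> e.1 != e'.1.
  move=> e1 e2; apply/negP => /eqP ee; have := d1 e'.1 (map_f _ e2).
  by rewrite -ee map_f.
have head e e' : e \in F1 -> e' \in F2 -> e.2 != e'.2.
  move=> e1 e2; apply/negP => /eqP ee; have := d2 e'.2 (map_f _ e2).
  by rewrite -ee map_f.
case: r p inE' => [u v|u1 w1 u2 w2 uu ww] p inE'.
  have /orP[h|h] := inE' (u, v) (mem_head _ _); [left|right] => e; by rewrite !inE orbb => /eqP->.
have i1 : (u1, w1) \in quad_edges u1 w1 u2 w2 by rewrite !inE eqxx.
have i2 : (u2, w1) \in quad_edges u1 w1 u2 w2 by rewrite !inE eqxx ?orbT.
have i3 : (u2, w2) \in quad_edges u1 w1 u2 w2 by rewrite !inE eqxx ?orbT.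
have i4 : (u1, w2) \in quad_edges u1 w1 u2 w2 by rewrite !inE eqxx ?orbT.
have /orP[h1|h1] := inE' _ i1; have /orP[h2|h2] := inE' _ i2;
  have /orP[h3|h3] := inE' _ i3; have /orP[h4|h4] := inE' _ i4;
  try (by left => e; rewrite !inE => /or4P[] /eqP->);
  try (by right => e; rewrite !inE => /or4P[] /eqP->);
  first [ by have := tail _ _ h1 h4; rewrite eqxx | by have := tail _ _ h4 h1; rewrite eqxx
        | by have := head _ _ h1 h2; rewrite eqxx | by have := head _ _ h2 h1; rewrite eqxx
        | by have := tail _ _ h2 h3; rewrite eqxx | by have := tail _ _ h3 h2; rewrite eqxx ].
Qed.

(** Resolving the redex inside F1 commutes with the multiplication by g F2. *)
Lemma redex_union_left es outs R F1 F2 : redex A es outs ->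
  perm_eq E (es ++ R) -> perm_eq E (F1 ++ F2) -> disjoint_webs F1 F2 -> F1 != [::] -> F2 != [::] ->
  {subset es <= F1} -> resolution_value A g outs R = g F1 * g F2.
Proof.
move=> r p p' d n1 n2 es1.
have /andP[t1 t2] := parts_trivalent p' d.
have /andP[s1 s2] := parts_size p' n1 n2.
have dF e : e \in F1 -> e \notin F2.
  move=> e1; apply/negP => e2; case/andP: d => /allP /(_ e.1 (map_f _ e2)).
  by rewrite map_f.
have [R' pR'] : exists R', perm_eq F1 (es ++ R').
  apply: submultiset => e; case: (boolP (e \in es)) => [/es1 e1|/count_memPn -> //].
  have := seq.permP p (pred1 e); rewrite (seq.permP p') !count_cat (count_memPn (dF _ e1)) addn0.
  by move=> ->; exact: leq_addr.
have pR : perm_eq R (R' ++ F2).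
  apply: (perm_cat_cancel p); rewrite (perm_trans p') // catA perm_cat2r.
  exact: pR'.
rewrite (resolution_value_perm gP tE sE r p (R' := R' ++ F2)); last first.
  by rewrite (perm_trans p) // perm_cat2l.
have pE : perm_eq E (es ++ (R' ++ F2)) by rewrite (perm_trans p) // perm_cat2l.
rewrite (resolution_value_web tE (eq_leq sE) r pE).
rewrite (valuation_reduction t1 s1 (ReduceRedex g r pR')) (resolution_value_web t1 (ltnW s1) r pR').
rewrite mulr_suml; apply: eq_big_seq => o oo; rewrite -scalerAl; congr (_ *: _).
have [_ _ e1 e2] := redex_ends r oo.
have oF j : j \in o.2 -> (j.2 \notin unzip1 F2) && (j.1 \notin unzip2 F2).
  move=> jo; case/andP: d => /allP d1 /allP d2; apply/andP; split; apply/negP.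
    move=> /d1; apply/negP/negPn; rewrite (perm_mem (perm_map _ pR')) map_cat mem_cat.
    by rewrite (perm_mem e1) mem_cat map_f.
  move=> /d2; apply/negP/negPn; rewrite (perm_mem (perm_map _ pR')) map_cat mem_cat.
  by rewrite (perm_mem e2) mem_cat map_f.
rewrite joins_cat // /web_value /= -scalerAl; congr (_ *: _).
have oR : open_web R' o.2.
  rewrite -[o.2]cats0; apply: (open_web_redex r oo).
  by rewrite -(open_web_perm pR' (perm_refl _)) -trivalent_open.
have [q1 q2] := joins_ends 0 (open_web_joinable oR).
have tJ : trivalent (joins o.2 (R', 0%N)).1.
  by rewrite trivalent_open; apply: (open_web_joins (js := [::])).
have dJ : disjoint_webs (joins o.2 (R', 0%N)).1 F2.
  apply: disjoint_webs_sub d => // x xJ; rewrite (perm_mem (perm_map _ pR')) map_cat mem_cat.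
    by rewrite -(perm_mem q1) mem_cat xJ !orbT.
  by rewrite -(perm_mem q2) mem_cat xJ !orbT.
case/andP: dJ => dJ1 dJ2; apply: (valuation_union gP) => //.
rewrite size_cat -sE (perm_size p') size_cat ltn_add2r (perm_size pR').
have := size_joins 0 (open_web_joinable oR); rewrite size_cat => <-.
rewrite addnCA -[X in (X < _)%N]addn0 ltn_add2l.
by case: r.
Qed.

Lemma redex_union es outs R F1 F2 : redex A es outs ->
  perm_eq E (es ++ R) -> perm_eq E (F1 ++ F2) -> disjoint_webs F1 F2 -> F1 != [::] -> F2 != [::] ->
  resolution_value A g outs R = g F1 * g F2.
Proof.
move=> r p p' d n1 n2; have [h|h] := redex_in_part r p p' d.
  exact: redex_union_left r p p' d n1 n2 h.
rewrite mulrC; apply: (redex_union_left r p _ _ n2 n1 h); last by rewrite disjoint_websC.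
by rewrite (perm_trans p') //; apply/permPl/perm_catC.
Qed.

Lemma disjoint_mem (F1 F2 : seq (nat * nat)) e : disjoint_webs F1 F2 -> e \in F1 -> e \notin F2.
Proof.
move=> /andP[/allP d _] e1; apply/negP => e2; have := d e.1 (map_f _ e2).
by rewrite map_f.
Qed.

Lemma union_split F F' F1 F2 : perm_eq E (F ++ F') -> F' != [::] -> F != [::] -> disjoint_webs F F' ->
  perm_eq E (F1 ++ F2) -> disjoint_webs F1 F2 ->
  g F = g [seq e <- F | e \in F1] * g [seq e <- F | e \in F2].
Proof.
move=> p n' n0 d p' d'; have /andP[tF _] := parts_trivalent p d; have /andP[sF _] := parts_size p n0 n'.
have pF : perm_eq F ([seq e <- F | e \in F1] ++ [seq e <- F | e \in F2]).
  rewrite (@eq_in_filter _ (fun e => e \in F2) (predC (fun e => e \in F1))).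
    by rewrite perm_sym; exact/permPl/perm_filterC.
  move=> e eF /=; have : e \in F1 ++ F2 by rewrite -(perm_mem p') (perm_mem p) mem_cat eF.
  rewrite mem_cat; case: (boolP (e \in F1)) => [/(disjoint_mem d')/negPf ->|_ /= ->] //.
have dF : disjoint_webs [seq e <- F | e \in F1] [seq e <- F | e \in F2].
  by apply: disjoint_webs_sub d' => x /mapP[e]; rewrite mem_filter => /andP[e1 _] ->; exact: map_f.
have tU : trivalent ([seq e <- F | e \in F1] ++ [seq e <- F | e \in F2]).
  by rewrite trivalent_open -(open_web_perm pF (perm_refl _)) -trivalent_open.
rewrite (valuation_perm tF sF pF); move: (tU); rewrite trivalent_union // => /andP[t1 t2].
by case/andP: dF => d1 d2; apply: (valuation_union gP) => //; rewrite -(perm_size pF).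
Qed.

(** Both products are the product of the values of the four intersections of the
    parts. *)
Lemma union_union F1 F2 F3 F4 :
  perm_eq E (F1 ++ F2) -> disjoint_webs F1 F2 -> F1 != [::] -> F2 != [::] ->
  perm_eq E (F3 ++ F4) -> disjoint_webs F3 F4 -> F3 != [::] -> F4 != [::] ->
  g F1 * g F2 = g F3 * g F4.
Proof.
move=> p d n1 n2 p' d' n3 n4.
have pC : perm_eq E (F2 ++ F1) by rewrite (perm_trans p) //; apply/permPl/perm_catC.
have pC' : perm_eq E (F4 ++ F3) by rewrite (perm_trans p') //; apply/permPl/perm_catC.
have dC : disjoint_webs F2 F1 by rewrite disjoint_websC.
have dC' : disjoint_webs F4 F3 by rewrite disjoint_websC.
rewrite (union_split p n2 n1 d p' d') (union_split pC n1 n2 dC p' d').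
rewrite (union_split p' n4 n3 d' p d) (union_split pC' n3 n4 dC' p d).
(* The intersection of X and Y is the same, whether it is cut out of X or of
   Y. *)
have swap X X' Y Y' : perm_eq E (X ++ X') -> disjoint_webs X X' -> X != [::] -> X' != [::] ->
    perm_eq E (Y ++ Y') -> disjoint_webs Y Y' ->
    g [seq e <- X | e \in Y] = g [seq e <- Y | e \in X].
  move=> pX dX nX nX' pY dY.
  have qX : perm_eq [seq e <- X | e \in Y] [seq e <- Y | e \in X].
    have q1 : perm_eq [seq e <- E | (e \in X) && (e \in Y)] [seq e <- X | e \in Y].
      rewrite (perm_trans (perm_filter _ pX)) // filter_cat.
      rewrite [X in _ ++ X](_ : _ = [::]) ?cats0; last first.
        apply/eqP; rewrite -[_ == _]negbK -has_filter; apply/hasPn => e eX'.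
        by move: dX; rewrite disjoint_websC => /disjoint_mem/(_ eX')/negPf ->.
      by rewrite (@eq_in_filter _ _ (fun e => e \in Y)) // => e ->.
    have q2 : perm_eq [seq e <- E | (e \in X) && (e \in Y)] [seq e <- Y | e \in X].
      rewrite (perm_trans (perm_filter _ pY)) // filter_cat.
      rewrite [X in _ ++ X](_ : _ = [::]) ?cats0; last first.
        apply/eqP; rewrite -[_ == _]negbK -has_filter; apply/hasPn => e eY'.
        by move: dY; rewrite disjoint_websC => /disjoint_mem/(_ eY')/negPf ->; rewrite andbF.
      by rewrite (@eq_in_filter _ _ (fun e => e \in X)) // => e ->; rewrite andbT.
    by rewrite -(permPl q1).
  have /andP[tX _] := parts_trivalent pX dX; have /andP[sX _] := parts_size pX nX nX'.
  apply: valuation_perm qX.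
    have pXf : perm_eq X ([seq e <- X | e \in Y] ++ [seq e <- X | predC (fun e => e \in Y) e]).
      by rewrite perm_sym; exact/permPl/perm_filterC.
    have dXf : disjoint_webs [seq e <- X | e \in Y] [seq e <- X | predC (fun e => e \in Y) e].
      apply: disjoint_webs_sub dY => x /mapP[e]; rewrite mem_filter => /andP[/= e1 e2] ->; apply: map_f => //.
        have : e \in Y ++ Y' by rewrite -(perm_mem pY) (perm_mem pX) mem_cat e2.
        by rewrite mem_cat (negPf e1).
      have : e \in Y ++ Y' by rewrite -(perm_mem pY) (perm_mem pX) mem_cat e2.
      by rewrite mem_cat (negPf e1).
    move: tX; rewrite trivalent_open (open_web_perm pXf (perm_refl _)) -trivalent_open.
    by rewrite (trivalent_union dXf) => /andP[].
  by apply: leq_ltn_trans sX; rewrite size_filter count_size.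
rewrite (swap F1 F2 F3 F4) // (swap F1 F2 F4 F3) // (swap F2 F1 F3 F4) // (swap F2 F1 F4 F3) //.
by rewrite mulrACA.
Qed.

Lemma reduction_confluent v v' : reduction g E v -> reduction g E v' -> v = v'.
Proof.
have nilE (F F' : seq (nat * nat)) : perm_eq E (F ++ F') -> F != [::] -> E <> [::].
  by move=> p n0 e; move/perm_size: p; rewrite e size_cat; case: (F) n0.
have redexE es outs R : redex A es outs -> perm_eq E (es ++ R) -> E <> [::].
  by move=> r p; apply: (nilE _ _ p); case: r.
case=> [e|es outs R r p|F1 F2 p d n1 n2]; case=> [e'|es' outs' R' r' p'|F3 F4 p' d' n3 n4] //.
- by case: (redexE _ _ _ r' p').
- by case: (nilE _ _ p').
- by case: (redexE _ _ _ r p).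
- exact: (redex_confluent AD A0 gP tE sE r r' p p').
- exact: redex_union r p p' d' n3 n4.
- by case: (nilE _ _ p).
- exact/esym/(redex_union r' p' p d n1 n2).
- exact: union_union p d n1 n2 p' d' n3 n4.
Qed.

End Fixed.

(** Connected webs do not split: the parts of a splitting are stable under
    adjacency. *)
Lemma irreducible_no_reduction E G v : irreducible_graph G -> perm_eq E (edges G) ->
  reduction g E v -> False.
Proof.
move=> [[_ G0 conn] nobigon noquad] pG [e|es outs R r p|F1 F2 p d n1 n2].
- move: G0; rewrite /vertices; move/perm_size: pG; rewrite e /=.
  by case: (edges G).
- case: r p => [u v'|u1 w1 u2 w2 uu ww] p.
    by have /negP := nobigon u v'; apply; rewrite /bigon -(seq.permP pG) (seq.permP p) /= eqxx.
  have /negP := noquad u1 w1 u2 w2; apply; apply/and3P; split=> //; apply/allP => e ee.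
  by rewrite /= -(perm_mem pG) (perm_mem p) mem_cat ee.
case: F1 n1 p d => // e1 F1 _; case: F2 n2 => // e2 F2 _ p d.
have inG e : e \in e1 :: F1 \/ e \in e2 :: F2 -> e \in edges G.
  by move=> h; rewrite -(perm_mem pG) (perm_mem p) mem_cat; apply/orP.
have v1 : inl e1.1 \in vertices G.
  by rewrite mem_cat; apply/orP; left; do 2 apply: map_f; apply: inG; left; exact: mem_head.
have v2 : inl e2.1 \in vertices G.
  by rewrite mem_cat; apply/orP; left; do 2 apply: map_f; apply: inG; right; exact: mem_head.
have [q qp ql] := conn _ _ v1 v2.
(* The vertices of the first part. *)
pose N (x : nat + nat) := match x with inl u => u \in unzip1 (e1 :: F1) | inr w => w \in unzip2 (e1 :: F1) end.
have /andP[/allP d1 /allP d2] := d.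
have Nadj x y : adjacent G x y -> N x -> N y.
  have split_e e : e \in edges G -> e \in e1 :: F1 \/ e \in e2 :: F2.
    by rewrite -(perm_mem pG) (perm_mem p) mem_cat => /orP.
  case: x y => [u|w] [u'|w'] //= /split_e[h|h] Nx; try exact: (map_f _ h).
  - by have := d1 _ (map_f _ h); rewrite Nx.
  - by have := d2 _ (map_f _ h); rewrite Nx.
have Nlast : N (last (inl e1.1) q).
  have : N (inl e1.1) by rewrite /N /= mem_head.
  elim: q (inl e1.1 : nat + nat) qp {ql} => //= y q IH x /andP[xy yq] Nx.
  by apply: IH yq _; exact: Nadj xy Nx.
move: Nlast; rewrite ql /N => h.
by have := d1 e2.1 (mem_head _ _); rewrite h.
Qed.

End Level.
End Candidates.

(** * Existence and uniqueness of the valuation *)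

Lemma perm_graph_class (G H : graph) (p q : nat -> nat) : bijective p -> bijective q ->
  perm_eq (edges H) (relabel p q (edges G)) -> circles H = circles G -> class H = class G.
Proof. by move=> bp bq pE cE; apply/esym/class_iso; exists p, q. Qed.

Section Existence.
Variables (K : comNzRingType) (A : int -> K) (M : comAlgType K) (irr : graph_class -> M).
Hypothesis (AD : {morph A : x y / x + y >-> x * y}) (A0 : A 0 = 1).
Notation valuation_below := (valuation_below A irr).
Notation candidate := (candidate A irr).
Notation reduction := (reduction A).

Section Step.
Variables (n : nat) (g : seq (nat * nat) -> M).
Hypothesis gP : valuation_below n g.

Lemma irreducible_circles G : irreducible_graph G -> circles G = 0%N.
Proof. by case=> [[]]. Qed.

Lemma candidate_confluent E v v' : trivalent E -> size E = n ->
  candidate g E v -> candidate g E v' -> v = v'.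
Proof.
move=> tE sE [r|G iG pG ->] [r'|G' iG' pG' ->].
- exact (reduction_confluent AD A0 gP tE sE r r').
- by case: (irreducible_no_reduction iG' pG' r).
- by case: (irreducible_no_reduction iG pG r').
congr irr; apply: (perm_graph_class (p := id) (q := id)); try by exists id.
  by rewrite relabel_id -(permPl pG).
by rewrite !irreducible_circles.
Qed.

Lemma trivalent_relabel_nat (p q : nat -> nat) E : injective p -> injective q ->
  trivalent (relabel p q E) = trivalent E.
Proof. by move=> pI qI; rewrite trivalent_relabel // -trivalent_open. Qed.

Lemma trivalent_perm E E' : perm_eq E E' -> trivalent E = trivalent E'.
Proof. by move=> pE; rewrite !trivalent_open (open_web_perm pE (perm_refl _)). Qed.

(** Reductions are transported along isomorphisms, so the new values are
    invariant. *)
Lemma reduction_iso E E' p q v : trivalent E -> size E = n -> injective p -> injective q ->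
  perm_eq E' (relabel p q E) -> reduction g E v -> reduction g E' v.
Proof.
move=> tE sE pI qI pE; have sE' : size E' = n by rewrite (perm_size pE) size_relabel.
have tE' : trivalent E' by rewrite (trivalent_perm pE) trivalent_relabel_nat.
case=> [e|es outs R r pes|F1 F2 p12 d n1 n2].
- by move: pE; rewrite e /= => /perm_nilP->; exact: ReduceNil.
- have r' := redex_relabel pI qI r.
  have p' : perm_eq E' (relabel p q es ++ relabel p q R).
    by rewrite (perm_trans pE) // -relabel_cat; exact: perm_map.
  suff -> : resolution_value A g outs R =
      resolution_value A g [seq (o.1, relabel_joins p q o.2) | o <- outs] (relabel p q R).
    exact: ReduceRedex r' p'.
  rewrite /resolution_value big_map; apply: eq_big_seq => o oo; congr (_ *: _) => /=.
  by rewrite (open_value_relabel gP pI qI (fits_resolution tE sE r oo pes)).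
have /andP[t1 t2] := parts_trivalent tE p12 d; have /andP[s1 s2] := parts_size sE p12 n1 n2.
rewrite -(valuation_iso gP t1 s1 pI qI (perm_refl _)) -(valuation_iso gP t2 s2 pI qI (perm_refl _)).
apply: ReduceUnion.
- by rewrite (perm_trans pE) // -relabel_cat; exact: perm_map.
- have dm (f : nat -> nat) a b : injective f -> disjoint_names (map f a) (map f b) = disjoint_names a b.
    by move=> fI; rewrite /disjoint_names all_map; apply: eq_all => x /=; rewrite mem_map.
  by move: d; rewrite /disjoint_webs !relabel_tails !relabel_heads !dm.
- by case: (F1) n1.
- by case: (F2) n2.
Qed.

Lemma candidate_iso E E' p q v v' : trivalent E -> size E = n -> injective p -> injective q ->
  perm_eq E' (relabel p q E) -> candidate g E v -> candidate g E' v' -> v = v'.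
Proof.
move=> tE sE pI qI pE.
have [p1 p1b p1E] := extend_to_bijection (in2W (@inj_id nat)) (s := unzip1 E) (in2W pI).
have [q1 q1b q1E] := extend_to_bijection (in2W (@inj_id nat)) (s := unzip2 E) (in2W qI).
have {p1E q1E pI qI}pE : perm_eq E' (relabel p1 q1 E) by rewrite (relabel_in p1E q1E).
have sE' : size E' = n by rewrite (perm_size pE) size_relabel.
have [[p2 p1K p2K] [q2 q1K q2K]] := (p1b, q1b).
have tE' : trivalent E' by rewrite (trivalent_perm pE) trivalent_relabel_nat //; exact: can_inj.
case=> [r|G iG pG ->].
  move=> c'; apply: candidate_confluent tE' sE' _ c'; left.
  exact: reduction_iso tE sE (can_inj p1K) (can_inj q1K) pE r.
case=> [r'|G' iG' pG' ->].
  have pE2 : perm_eq E (relabel p2 q2 E').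
    rewrite perm_sym (perm_trans (perm_map _ pE)) // -/(relabel _ _ _) relabel_comp.
    by rewrite (relabel_in (p' := id) (q' := id)) ?relabel_id // => x _ /=; rewrite ?p1K ?q1K.
  have := reduction_iso tE' sE' (can_inj p2K) (can_inj q2K) pE2 r'.
  by case/(irreducible_no_reduction iG pG).
congr irr; apply/esym; apply: (perm_graph_class p1b q1b).
  by rewrite -(permPl pG') (perm_trans pE) //; exact: perm_map.
by rewrite !irreducible_circles.
Qed.

Lemma resolution_size_lt E es outs o R : trivalent E -> (size E <= n)%N ->
  redex A es outs -> perm_eq E (es ++ R) -> o \in outs ->
  trivalent (joins o.2 (R, 0%N)).1 && (size (joins o.2 (R, 0%N)).1 < n)%N.
Proof.
move=> tE sE r p oo; have oR : open_web R o.2.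
  rewrite -[o.2]cats0; apply: (open_web_redex r oo).
  by rewrite -(open_web_perm p (perm_refl _)) -trivalent_open.
rewrite trivalent_open (open_web_joins (js := [::])) //=.
have := size_joins 0 (open_web_joinable oR) => sR.
apply: leq_trans sE; rewrite (perm_size p) size_cat -sR addnCA -[X in (X < _)%N]addn0 ltn_add2l.
by case: r.
Qed.

(** Any choice of a candidate for each web with n edges satisfies the relations,
    because all candidates agree. *)
Lemma valuation_extend : exists2 g', valuation_below n.+1 g' &
  forall E, (size E < n)%N -> g' E = g E.
Proof.
have /boolp.choice[h hP] : forall E, exists v, trivalent E -> candidate g E v.
  move=> E; case: (boolP (trivalent E)) => [/(candidate_exists A irr g)[v cv]|_]; first by exists v.
  by exists 0.
pose g' E := if (size E < n)%N then g E else h E.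
have g'E E : (size E < n)%N -> g' E = g E by rewrite /g' => ->.
have g'n E : size E = n -> g' E = h E by rewrite /g' => ->; rewrite ltnn.
have hE E v : trivalent E -> size E = n -> candidate g E v -> g' E = v.
  move=> tE sE c; rewrite g'n //; exact: candidate_confluent tE sE (hP E tE) c.
have cases (E : seq (nat * nat)) : (size E < n.+1)%N -> (size E < n)%N \/ size E = n.
  by rewrite ltnS leq_eqVlt => /orP[/eqP|]; [right|left].
exists g' => //; split.
- have [n0|/esym n0] := cases [::] isT; first by rewrite g'E // (valuation_nil gP).
  by apply: hE => //; left; exact: ReduceNil.
- move=> E E' p q tE /cases[sE|sE] pI qI pE.
    by rewrite !g'E ?(perm_size pE) ?size_relabel //; exact: (valuation_iso gP) pI qI pE.
  have sE' : size E' = n by rewrite (perm_size pE) size_relabel.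
  have tE' : trivalent E' by rewrite (trivalent_perm pE) trivalent_relabel_nat.
  by rewrite !g'n //; apply/esym; exact: candidate_iso tE sE pI qI pE (hP _ tE) (hP _ tE').
- move=> es outs R r tE sE.
  have -> : \sum_(o <- outs) o.1 *: web_value A g' (joins o.2 (R, 0%N)) =
      \sum_(o <- outs) o.1 *: web_value A g (joins o.2 (R, 0%N)).
    apply: eq_big_seq => o oo; have /andP[_ s] := resolution_size_lt tE sE r (perm_refl _) oo.
    by rewrite /web_value g'E.
  have [s|s] := cases _ sE; first by rewrite g'E //; exact: (valuation_redex gP r).
  rewrite -(resolution_value_web gP tE sE r (perm_refl _)); apply: hE => //; left.
  exact: ReduceRedex r (perm_refl _).
- move=> E F tE tF d1 d2 sEF; have [s|s] := cases _ sEF.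
    rewrite !g'E //; first exact: (valuation_union gP).
      by apply: leq_ltn_trans s; rewrite size_cat leq_addl.
    by apply: leq_ltn_trans s; rewrite size_cat leq_addr.
  have nilE : g' [::] = 1.
    have [n0|/esym n0] := cases [::] isT; first by rewrite g'E // (valuation_nil gP).
    by apply: hE => //; left; exact: ReduceNil.
  have d : disjoint_webs E F by rewrite /disjoint_webs d1.
  have [E0|E0] := eqVneq E [::]; first by rewrite E0 nilE mul1r.
  have [F0|F0] := eqVneq F [::]; first by rewrite F0 nilE mulr1 cats0.
  have /andP[s1 s2] := parts_size s (perm_refl _) E0 F0.
  rewrite [g' E]g'E // [g' F]g'E //; apply: hE => //; first by rewrite trivalent_union // tE.
  by left; exact: ReduceUnion (perm_refl _) d E0 F0.
- move=> G iG /cases[s|s]; first by rewrite g'E //; exact: (valuation_irreducible gP).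
  apply: hE => //; first exact: (valP G).
  by right with G.
Qed.

End Step.

Lemma valuation_below_exists n : exists g, valuation_below n g.
Proof.
elim: n => [|n [g gP]]; last by have [g' g'P _] := valuation_extend gP; exists g'.
by exists (fun=> 1); split.
Qed.

(** Induction on the number of edges, every web having a reduction or being
    irreducible. *)
Lemma valuation_unique n g g' : valuation_below n g -> valuation_below n g' ->
  forall E, trivalent E -> (size E < n)%N -> g E = g' E.
Proof.
move=> gP g'P E; have [k] := ubnP (size E); elim: k E => // k IH E /ltnSE sk tE sE.
have [v [r|G iG pG ev]] := candidate_exists A irr g tE.
  rewrite (valuation_reduction gP tE sE r); case: r => [e|es outs R r p|F1 F2 p d n1 n2].
  - by rewrite e (valuation_nil g'P).
  - rewrite (valuation_reduction g'P tE sE (ReduceRedex g' r p)).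
    rewrite (resolution_value_web gP tE (ltnW sE) r p) (resolution_value_web g'P tE (ltnW sE) r p).
    apply: eq_big_seq => o oo; congr (_ *: _); rewrite /web_value; congr (_ *: _).
    have /andP[t s] := resolution_size_lt tE (leqnn _) r p oo.
    by apply: IH => //; [exact: leq_trans s sk|exact: ltn_trans s sE].
  - rewrite (valuation_reduction g'P tE sE (ReduceUnion A g' p d n1 n2)).
    have /andP[t1 t2] := parts_trivalent tE p d; have /andP[s1 s2] := parts_size erefl p n1 n2.
    by congr (_ * _); apply: IH => //; by [exact: leq_trans sk|exact: ltn_trans sE].
rewrite (valuation_perm gP tE sE pG) (valuation_perm g'P tE sE pG).
by rewrite (valuation_irreducible gP) -?(perm_size pG) // (valuation_irreducible g'P) -?(perm_size pG).
Qed.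

Lemma valuation_below_ext n g g' : valuation_below n.+1 g ->
  (forall E, trivalent E -> (size E < n.+1)%N -> g' E = g E) -> valuation_below n.+1 g'.
Proof.
move=> gP h; split.
- by rewrite h // (valuation_nil gP).
- move=> E E' p q tE sE pI qI pE; rewrite !h ?(perm_size pE) ?size_relabel //.
    exact: (valuation_iso gP) pE.
  by rewrite (trivalent_perm pE) trivalent_relabel_nat.
- move=> es outs R r tE sE; rewrite h // (valuation_redex gP r) //.
  apply: eq_big_seq => o oo; rewrite /web_value h //.
    by have /andP[] := resolution_size_lt tE (leqnn _) r (perm_refl _) oo.
  have /andP[_ s] := resolution_size_lt tE (leqnn _) r (perm_refl _) oo.
  exact: ltn_trans s sE.
- move=> E F tE tF d1 d2 s; rewrite !h ?(valuation_union gP) //.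
  + by apply: leq_ltn_trans s; rewrite size_cat leq_addl.
  + by apply: leq_ltn_trans s; rewrite size_cat leq_addr.
  + by rewrite trivalent_union ?tE // /disjoint_webs d1.
- by move=> G iG s; rewrite h ?(valuation_irreducible gP) //; exact: (valP G).
Qed.

Lemma valuation_below_leq m n g : (m <= n)%N -> valuation_below n g -> valuation_below m g.
Proof.
move=> mn gP; split; first exact: valuation_nil gP.
- move=> E E' p q tE sE; apply: (valuation_iso gP) => //; exact: leq_trans mn.
- move=> es outs R r tE sE; apply: (valuation_redex gP) => //; exact: leq_trans mn.
- move=> E F tE tF d1 d2 sE; apply: (valuation_union gP) => //; exact: leq_trans mn.
- move=> G iG sG; apply: (valuation_irreducible gP) => //; exact: leq_trans mn.
Qed.

(** The valuations below all n are glued by their uniqueness. *)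
Theorem valuation_exists : exists g, forall n, valuation_below n g.
Proof.
have [f fP] := boolp.choice valuation_below_exists.
(* The value of E is taken from a valuation which covers the size of E. *)
exists (fun E => f (size E).+1 E) => n.
apply: (valuation_below_leq (leqnSn n)); apply: (valuation_below_ext (fP n.+1)) => E tE sE.
apply: (valuation_unique (n := (size E).+1)) => //.
exact: valuation_below_leq (fP n.+1).
Qed.

End Existence.

(** * From valuations to Kuperberg evaluations *)

Lemma ApowD : {morph Apow : a b / a + b >-> a * b}.
Proof. by move=> a b; apply: val_inj; rewrite /= expfzDr // fracX_neq0. Qed.

Lemma Apow0 : Apow 0 = 1.
Proof. by apply: val_inj; rewrite /= expr0z. Qed.

Lemma graph_eq (G H : graph) : web G = web H -> G = H.
Proof. exact: val_inj. Qed.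

Lemma class_union (G G1 G2 : graph) :
  perm_eq (edges G) (edges G1 ++ edges G2) -> disjoint_webs (edges G1) (edges G2) ->
  circles G = (circles G1 + circles G2)%N -> class G = class (disjoint_union G1 G2).
Proof.
move=> pG /andP[d1 d2] cG.
have sep (s t : seq nat) : disjoint_names s t ->
    exists2 h : nat -> nat, bijective h &
      {in s, forall x, h x = x.*2} /\ {in t, forall x, h x = x.*2.+1}.
  move=> /allP d; pose f x := if x \in s then x.*2 else x.*2.+1.
  have fI : injective f.
    by move=> x y; rewrite /f; case: ifP; case: ifP => _ _; clear; lia.
  have [h hb hE] := extend_to_bijection (in2W (@inj_id nat)) (s := s ++ t) (in2W fI).
  exists h => //; split=> x xs; rewrite hE ?mem_cat ?xs ?orbT // /f ?xs //.
  by rewrite (negPf (d x xs)).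
have [p pb [p1 p2]] := sep _ _ d1; have [q qb [q1 q2]] := sep _ _ d2.
apply/esym/(perm_graph_class pb qb) => //.
rewrite perm_sym (perm_trans (perm_map _ pG)) // map_cat; apply: perm_cat.
  by rewrite -[rename _ _ _](relabel_in p1 q1).
by rewrite -[rename _ _ _](relabel_in p2 q2).
Qed.

(** The variable of an irreducible class; 0 is a default value on the other
    classes. *)
Definition irreducible_value (c : graph_class) : value :=
  if insub c is Some t then var t else 0.

Lemma repr_class_iso (G : graph) : graph_iso (repr (class G)) G.
Proof.
by have /eqmodP/asboolP : class (repr (class G)) = class G by rewrite /class reprK.
Qed.

(** Stated for abstract coefficients and values: conversions between concrete
    Laurent polynomials would unfold their construction. *)
Lemma scaled_quad_sum (K : comNzRingType) (M : comAlgType K) (c : K) (X : Type) (a b : X) (f : X -> M) :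
  c *: (\sum_(o <- [:: (1 : K, a); (1 : K, b)]) o.1 *: f o.2) = c *: f a + c *: f b.
Proof. by rewrite big_cons big_seq1 !scale1r scalerDr. Qed.

Lemma quad_sum (K : comNzRingType) (M : comAlgType K) (X : Type) (a b : X) (f : X -> M) :
  \sum_(o <- [:: (1 : K, a); (1 : K, b)]) o.1 *: f o.2 = f a + f b.
Proof. by rewrite big_cons big_seq1 !scale1r. Qed.

Lemma irreducible_repr (G : graph) : irreducible_graph G -> irreducible_graph (repr (class G)).
Proof.
move=> iG; have [p [q [pb qb pE cE]]] := repr_class_iso G.
move: (repr (class G)) pE cE => H pE cE.
have [F FP] := valuation_exists irreducible_value ApowD Apow0.
have c0 : circles H = 0%N by rewrite -cE (irreducible_circles iG).
have tH := valP H.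
have -> : H = Graph (web := (edges H, 0%N)) tH.
  by apply: graph_eq; rewrite /= -c0; case: (H) => -[].
apply: (@irreducible_of_no_reduction _ Apow value F) => v r.
apply: (irreducible_no_reduction (g := F) iG (perm_refl _)).
exact: (reduction_iso (FP (size (edges H))) tH erefl (bij_inj pb) (bij_inj qb) pE r).
Qed.

Lemma scaled_one_mul (K : comNzRingType) (M : comAlgType K) (c : K) k :
  (c ^+ k *: 1) * (c *: 1) = c ^+ k.+1 *: (1 : M).
Proof. by rewrite -scalerAl mul1r scalerA exprSr. Qed.

Section Evaluation.
Variable F : seq (nat * nat) -> value.
Hypothesis FP : forall n, valuation_below Apow irreducible_value n F.

Definition evaluation (c : graph_class) : value := web_value Apow F (web (repr c)).

Lemma evaluation_class G : evaluation (class G) = web_value Apow F (web G).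
Proof.
have := repr_class_iso G; rewrite /evaluation; move: (repr _) => H [p [q [pb qb pE cE]]].
rewrite /web_value -/(edges _) -/(circles _) -/(edges G) -/(circles G) cE.
congr (_ *: _); apply/esym.
exact: (valuation_iso (FP (size (edges H)).+1) (valP H) _ (bij_inj pb) (bij_inj qb) pE).
Qed.

Lemma web_value_loops js E k :
  web_value Apow F (joins js (E, k)) = loop_value Apow ^+ k *: web_value Apow F (joins js (E, 0%N)).
Proof. by rewrite joins_loops /web_value /= exprD scalerA. Qed.

Lemma evaluation_kuperberg : kuperberg_evaluation evaluation.
Proof.
split.
- by rewrite evaluation_class /web_value /= expr0 scale1r (valuation_nil (FP 0)).
- move=> G H; rewrite !evaluation_class /web_value /=.
  have := union_trivalent G H; rewrite [rename double double _](_ : _ = relabel double double (edges G)) //.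
  rewrite [rename _ _ (edges H)](_ : _ = relabel (fun x => x.*2.+1) (fun x => x.*2.+1) (edges H)) //.
  set X := relabel double double _; set Y := relabel _ _ (edges H) => tXY.
  have dI : injective (fun x => x.*2.+1) by move=> x y; clear; lia.
  have odds (s t : seq nat) : disjoint_names (map double s) (map (fun x => x.*2.+1) t).
    by apply/allP => _ /mapP[x _ ->]; apply/mapP => -[y _]; clear; lia.
  have d1 : disjoint_names (unzip1 X) (unzip1 Y) by rewrite !relabel_tails.
  have d2 : disjoint_names (unzip2 X) (unzip2 Y) by rewrite !relabel_heads.
  move: tXY; rewrite trivalent_union /disjoint_webs ?d1 // => /andP[tX tY].
  rewrite (valuation_union (FP (size (X ++ Y)).+1)) //.
  rewrite (valuation_iso (FP (size (edges G)).+1) (valP G) (leqnn _) double_inj double_inj (perm_refl _)).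
  rewrite (valuation_iso (FP (size (edges H)).+1) (valP H) (leqnn _) dI dI (perm_refl _)).
  rewrite exprD -scalerAl -scalerAr scalerA.
  by [].
- move=> t; have := valP t; rewrite /irreducible_class => /asboolP iR.
  rewrite /evaluation /web_value (irreducible_circles iR : (web _).2 = 0%N) expr0 scale1r.
  rewrite (valuation_irreducible (FP (size (edges (repr (val t)))).+1) iR) //.
  by rewrite /irreducible_value /class reprK valK.
- rewrite evaluation_class /web_value /= expr1 (valuation_nil (FP 0)).
  by [].
- move=> G u v b; rewrite !evaluation_class.
  have pE := bigon_front b; have tE := valP G.
  have -> : web (resolve_bigon b) = joins [:: (v, u)] (remove_edges [:: (u, v); (u, v)] (edges G), circles G) by [].
  rewrite web_value_loops {1}/web_value -/(edges G) -/(circles G).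
  rewrite (valuation_reduction (FP (size (edges G)).+1) tE (leqnn _) (ReduceRedex F (BigonRedex Apow u v) pE)).
  rewrite (resolution_value_web (FP (size (edges G)).+1) tE (leqnSn _) (BigonRedex Apow u v) pE).
  rewrite big_seq1; exact: scaler_swap.
- move=> G u1 w1 u2 w2 q; rewrite !evaluation_class.
  have /and3P[uu ww sE] := q; have pE := quad_front uu ww sE; have tE := valP G.
  set R := remove_edges _ _ in pE.
  have -> : web (resolve_quad1 q) = joins [:: (w1, u1); (w2, u2)] (R, circles G) by [].
  have -> : web (resolve_quad2 q) = joins [:: (w1, u2); (w2, u1)] (R, circles G) by [].
  rewrite (web_value_loops [:: (w1, u1); _]) (web_value_loops [:: (w1, u2); _]) {1}/web_value -/(edges G) -/(circles G).
  rewrite (valuation_reduction (FP (size (edges G)).+1) tE (leqnn _) (ReduceRedex F (QuadRedex Apow uu ww) pE)).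
  rewrite (resolution_value_web (FP (size (edges G)).+1) tE (leqnSn _) (QuadRedex Apow uu ww) pE).
  exact: (scaled_quad_sum _ _ _ (fun js => web_value Apow F (joins js (R, 0%N)))).
Qed.
End Evaluation.

Section Uniqueness.
Variable g : graph_class -> value.
Hypothesis gP : kuperberg_evaluation g.

(** The given evaluation as a function of edge lists, to be compared with a
    valuation. *)
Definition graph_value (G : seq (nat * nat) * nat) : value :=
  if insub G is Some H then g (class H) else 0.

Lemma graph_valueE (G : graph) : graph_value (web G) = g (class G).
Proof. by rewrite /graph_value valK. Qed.

Lemma graph_value_same G H : trivalent G.1 -> same_web G H -> graph_value G = graph_value H.
Proof.
move=> tG [pG cG]; have tH : trivalent H.1 by rewrite -(trivalent_perm pG).
rewrite -[G]/(web (Graph tG)) -[H]/(web (Graph tH)) !graph_valueE; congr g.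
by apply: (perm_graph_class (p := id) (q := id)); rewrite ?relabel_id //; exists id.
Qed.

Lemma circle_value k : g (class (circle_graph k)) = loop_value Apow ^+ k *: 1.
Proof.
elim: k => [|k IH]; first by rewrite (eval_empty gP) expr0 scale1r.
have -> : class (circle_graph k.+1) = class (disjoint_union (circle_graph k) (circle_graph 1)).
  by apply: class_union; rewrite //= addn1.
rewrite (eval_union gP) IH (eval_loop gP) -/(loop_value Apow).
exact: scaled_one_mul.
Qed.

Lemma graph_value_circles E k : trivalent E ->
  graph_value (E, k) = loop_value Apow ^+ k *: graph_value (E, 0%N).
Proof.
move=> tE; pose G := Graph (web := (E, k)) tE; pose G0 := Graph (web := (E, 0%N)) tE.
rewrite -[(E, k)]/(web G) -[(E, 0%N)]/(web G0) !graph_valueE.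
have -> : class G = class (disjoint_union G0 (circle_graph k)).
  by apply: class_union; rewrite //= cats0.
by rewrite (eval_union gP) circle_value -scalerAr mulr1.
Qed.

(** An evaluation of graphs is a valuation, so uniqueness of valuations applies. *)
Lemma kuperberg_valuation n : valuation_below Apow irreducible_value n (fun E => graph_value (E, 0%N)).
Proof.
have webE E k : trivalent E -> web_value Apow (fun E => graph_value (E, 0%N)) (E, k) = graph_value (E, k).
  by move=> tE; rewrite graph_value_circles.
split.
- by rewrite -[([::], 0%N)]/(web (circle_graph 0)) graph_valueE (eval_empty gP).
- move=> E E' p q tE _ pI qI pE.
  have tE' : trivalent E' by rewrite (trivalent_perm pE) trivalent_relabel_nat.
  have [p1 p1b p1E] := extend_to_bijection (in2W (@inj_id nat)) (s := unzip1 E) (in2W pI).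
  have [q1 q1b q1E] := extend_to_bijection (in2W (@inj_id nat)) (s := unzip2 E) (in2W qI).
  pose G := Graph (web := (E, 0%N)) tE; pose G' := Graph (web := (E', 0%N)) tE'.
  rewrite -[(E, _)]/(web G) -[(E', _)]/(web G') !graph_valueE; congr g.
  by apply: (perm_graph_class p1b q1b) => //; rewrite (relabel_in p1E q1E).
- move=> es outs R r tE _.
  have outE o : o \in outs -> trivalent (joins o.2 (R, 0%N)).1.
    by move=> oo; have /andP[] := resolution_size_lt tE (leqnn _) r (perm_refl _) oo.
  have sameE js : trivalent (joins js (R, 0%N)).1 -> all_joinable js R ->
      graph_value (joins js (remove_edges es (es ++ R), 0%N)) =
      web_value Apow (fun E => graph_value (E, 0%N)) (joins js (R, 0%N)).
    move=> tJ ok; rewrite [joins js (R, 0%N)]surjective_pairing webE // -surjective_pairing.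
    apply/esym/graph_value_same => //; apply: joins_same_web => //; split=> //=.
    by rewrite perm_sym; apply: remove_edges_perm.
  have okE o : o \in outs -> all_joinable o.2 R.
    move=> oo; apply: open_web_joinable; rewrite -[o.2]cats0; apply: (open_web_redex r oo).
    by rewrite -trivalent_open.
  case: r tE outE sameE okE => [u v|u1 w1 u2 w2 uu ww] tE outE sameE okE;
    pose G := Graph (web := (_, 0%N)) tE; rewrite -[(_, 0%N)]/(web G) graph_valueE.
    have b : bigon G u v by rewrite /bigon /edges /G /= eqxx.
    rewrite (eval_bigon gP b) -/(bigon_value Apow) big_seq1 -graph_valueE; congr (_ *: _).
    have ou := mem_head (bigon_value Apow, [:: (v, u)]) [::].
    exact: sameE (outE _ ou) (okE _ ou).
  have q : quadrilateral G u1 w1 u2 w2.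
    rewrite /quadrilateral uu ww; apply/allP => e ee.
    have eE : e \in quad_edges u1 w1 u2 w2 ++ R by rewrite mem_cat ee.
    exact: eE.
  rewrite (eval_quad gP q) -!graph_valueE.
  rewrite (quad_sum _ _ (fun js => web_value Apow (fun E => graph_value (E, 0%N)) (joins js (R, 0%N)))).
  have o1 := mem_head (1 : laurent, [:: (w1, u1); (w2, u2)]) [:: (1, [:: (w1, u2); (w2, u1)])].
  have o2 : (1 : laurent, [:: (w1, u2); (w2, u1)]) \in
    [:: (1, [:: (w1, u1); (w2, u2)]); (1, [:: (w1, u2); (w2, u1)])] by rewrite !inE eqxx orbT.
  rewrite -(sameE _ (outE _ o1) (okE _ o1)) -(sameE _ (outE _ o2) (okE _ o2)).
  by [].
- move=> E F tE tF d1 d2 _.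
  have d : disjoint_webs E F by rewrite /disjoint_webs d1.
  have tU : trivalent (E ++ F) by rewrite trivalent_union ?tE.
  pose G := Graph (web := (E ++ F, 0%N)) tU.
  pose G1 := Graph (web := (E, 0%N)) tE; pose G2 := Graph (web := (F, 0%N)) tF.
  rewrite -[(E ++ F, _)]/(web G) -[(E, _)]/(web G1) -[(F, _)]/(web G2) !graph_valueE.
  by rewrite -(eval_union gP); congr g; exact: class_union.
move=> G iG _; have cG : (edges G, 0%N) = web G.
  by have := irreducible_circles iG; rewrite /circles /edges; case: (web G) => E k /= ->.
have iR : irreducible_class (class G) by apply/asboolP; exact: irreducible_repr.
rewrite cG graph_valueE /irreducible_value insubT.
by rewrite -(eval_irreducible gP) SubK.
Qed.

Lemma kuperberg_unique F : (forall n, valuation_below Apow irreducible_value n F) ->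
  g =1 evaluation F.
Proof.
move=> FP c; have tR : trivalent (web (repr c)).1 := valP (repr c).
have -> : g c = graph_value (web (repr c)) by rewrite graph_valueE /class reprK.
rewrite /evaluation.
move: (web (repr c)) tR => [E k] tE; rewrite (graph_value_circles k tE).
have h := valuation_unique (kuperberg_valuation (size E).+1) (FP (size E).+1) tE (leqnn _).
exact: (congr1 (fun x => loop_value Apow ^+ k *: x) h).
Qed.

End Uniqueness.

(** * Wirings with a tangle at each crossing *)

Local Close Scope ring_scope.






(** The oriented smoothing, the crossing strands going through, and the pair of
    vertices. *)
Inductive tangle := Oriented | Through | Unoriented.

Definition is_unoriented (t : tangle) := if t is Unoriented then true else false.
Definition is_oriented (t : tangle) := if t is Oriented then true else false.

Section Tangles.
Variable C : finType.
Notation side := (C * bool)%type.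
Notation name := (side + (side + C))%type.
Implicit Types (X : seq (side * side)) (t : C -> tangle).

(** The side through which the strand entering at side i leaves a tangle without
    vertices. *)
Definition exit t (i : side) : side := if is_oriented (t i.1) then i else (i.1, ~~ i.2).

Definition passes t : seq (side * side) :=
  [seq (i, exit t i) | i <- enum {: side} & ~~ is_unoriented (t i.1)].

(** The web of a state: the strands pass the crossings without vertices, and
    each unoriented crossing c has a source, a sink and the edge between them,
    all named c. *)
Definition resolved_web X l t : seq (C * C) * nat :=
  let G := joins (passes t) (X, l) in
  (relabel fst fst G.1 ++ [seq (c, c) | c <- enum C & is_unoriented (t c)], G.2).

(** Each side of each crossing is left by one edge and entered by one edge. *)
Definition wiring X := perm_eq (unzip1 X) (enum {: side}) /\ perm_eq (unzip2 X) (enum {: side}).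

(** Three kinds of names: ends of the wires, ends of the tangles (ports), and
    vertices. *)
Definition vertex (c : C) : name := inr (inr c).
Definition port (i : side) : name := inr (inl i).
Definition wire (i : side) : name := inl i.

Definition tangle_edges (c : C) (t : tangle) : seq (name * name) :=
  let T := (c, true) in let F := (c, false) in
  match t with
  | Oriented => [:: (port T, port T); (port F, port F)]
  | Through => [:: (port T, port F); (port F, port T)]
  | Unoriented => [:: (port T, vertex c); (port F, vertex c); (vertex c, port T);
                      (vertex c, port F); (vertex c, vertex c)]
  end.

Definition sides (cs : seq C) : seq side := flatten [seq [:: (c, true); (c, false)] | c <- cs].

(** The tangles and the wires of the state before they are plugged together,
    which makes the tangle at a crossing a piece in a fixed surrounding. *)
Definition open_edges X t : seq (name * name) :=
  flatten [seq tangle_edges c (t c) | c <- enum C] ++ relabel wire wire X.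

Definition port_joins : seq (name * name) :=
  [seq (wire i, port i) | i <- sides (enum C)] ++ [seq (port o, wire o) | o <- sides (enum C)].

Lemma mem_sides cs i : (i \in sides cs) = (i.1 \in cs).
Proof.
elim: cs => [|c cs IH] //=; rewrite !inE IH orbA; congr (_ || _).
by case: i {IH} => d [] /=; rewrite !xpair_eqE ?andbT ?andbF ?orbF.
Qed.

Lemma sides_uniq cs : uniq cs -> uniq (sides cs).
Proof.
elim: cs => //= c cs IH /andP[cc /IH ->]; rewrite inE !mem_sides /= (negPf cc) orbF andbT.
by rewrite xpair_eqE andbF.
Qed.

Definition target t (i : side) : name :=
  if is_unoriented (t i.1) then vertex i.1 else port (exit t i).

Lemma tangle_edges_perm t cs : perm_eq (flatten [seq tangle_edges c (t c) | c <- cs])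
  ([seq (port i, target t i) | i <- sides cs] ++
   [seq (vertex o.1, port o) | o <- sides cs & is_unoriented (t o.1)] ++
   [seq (vertex c, vertex c) | c <- cs & is_unoriented (t c)]).
Proof.
elim: cs => [|c cs IH] //.
have sE : sides (c :: cs) = [:: (c, true); (c, false)] ++ sides cs by [].
apply/seq.permP => a; have := seq.permP IH a.
rewrite sE filter_cat [flatten _]/= !map_cat !count_cat => ->.
rewrite /target /exit /=.
by case: (t c) => /=; rewrite ?count_cat /=; clear; lia.
Qed.

Lemma exit_crossing t i : (exit t i).1 = i.1.
Proof. by rewrite /exit; case: is_oriented. Qed.

Lemma exitK t : involutive (exit t).
Proof. by move=> [c b]; rewrite /exit /=; case cl: (is_oriented (t c)); rewrite /= cl ?negbK. Qed.

Lemma count_sides_at c : count (fun o : side => o.1 == c) (sides (enum C)) = 2.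
Proof.
rewrite -size_filter.
have /perm_size -> // : perm_eq [seq o <- sides (enum C) | o.1 == c] [:: (c, true); (c, false)].
apply: uniq_perm => [||[d b]]; rewrite ?filter_uniq ?sides_uniq ?enum_uniq //.
  by rewrite /= inE xpair_eqE andbF.
rewrite mem_filter mem_sides mem_enum andbT !inE !xpair_eqE /=.
by case: b; rewrite ?andbT ?andbF ?orbF.
Qed.

Lemma count_if (X : Type) (b : bool) (a : pred X) s :
  count (fun x => b && a x) s = b * count a s.
Proof. by case: b; rewrite ?mul1n //= count_pred0. Qed.

Lemma count_side i : count_mem i (sides (enum C)) = 1.
Proof. by rewrite count_uniq_mem ?sides_uniq ?enum_uniq // mem_sides mem_enum. Qed.

Lemma open_edges_tails X t x : wiring X ->
  count_mem x (unzip1 (open_edges X t)) =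
    if x is inr (inr c) then 3 * is_unoriented (t c) else 1.
Proof.
move=> [p1 _]; rewrite /open_edges /unzip1 map_cat count_cat.
rewrite (seq.permP (perm_map _ (tangle_edges_perm t _))) !map_cat !count_cat -!map_comp !count_map.
rewrite [count _ X](_ : _ = if x is inl o then 1 else 0); last first.
  case: x => [o|x]; last by rewrite (eq_count (a2 := pred0)) ?count_pred0.
  transitivity (count_mem o (unzip1 X)).
    by rewrite /unzip1 count_map; apply: eq_count => e /=; rewrite inj_eq //; exact: inl_inj.
  by rewrite (seq.permP p1) count_uniq_mem ?enum_uniq // mem_enum.
case: x => [o|[i|c]].
- by rewrite !(eq_count (a2 := pred0)) ?count_pred0.
- rewrite (eq_count (a2 := pred1 i)) ?count_side; last first.
    by move=> e /=; rewrite /port (inj_eq inr_inj) (inj_eq inl_inj).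
  by rewrite !(eq_count (a2 := pred0)) ?count_pred0.
rewrite (eq_count (a2 := pred0)) ?count_pred0 // 2!count_filter.
rewrite (eq_count (a2 := fun o : side => is_unoriented (t c) && (o.1 == c))); last first.
  move=> o /=; rewrite /vertex !(inj_eq inr_inj) andbC.
  by case: eqP => [->|]; rewrite ?andbF.
rewrite [X in (_ + (_ + X) + _)%N](eq_count (a2 := fun d => is_unoriented (t c) && (d == c))); last first.
  move=> d /=; rewrite /vertex !(inj_eq inr_inj).
  by case: eqP => [->|]; rewrite ?andbT ?andbF.
rewrite !count_if count_sides_at (count_uniq_mem c (enum_uniq C)) mem_enum.
by case: is_unoriented.
Qed.

Lemma open_edges_heads X t x : wiring X ->
  count_mem x (unzip2 (open_edges X t)) =
    if x is inr (inr c) then 3 * is_unoriented (t c) else 1.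
Proof.
move=> [_ p2]; rewrite /open_edges /unzip2 map_cat count_cat.
rewrite (seq.permP (perm_map _ (tangle_edges_perm t _))) !map_cat !count_cat -!map_comp !count_map.
rewrite [count _ X](_ : _ = if x is inl o then 1 else 0); last first.
  case: x => [o|x]; last by rewrite (eq_count (a2 := pred0)) ?count_pred0.
  transitivity (count_mem o (unzip2 X)).
    by rewrite /unzip2 count_map; apply: eq_count => e /=; rewrite inj_eq //; exact: inl_inj.
  by rewrite (seq.permP p2) count_uniq_mem ?enum_uniq // mem_enum.
case: x => [o|[i|c]].
- rewrite !(eq_count (a2 := pred0)) ?count_pred0 // => e /=.
  by rewrite /target; case: ifP.
- rewrite (eq_count (a2 := fun e => ~~ is_unoriented (t i.1) && (e == exit t i))); last first.
    move=> e /=; rewrite /target; case: ifP => h.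
      rewrite /vertex (inj_eq inr_inj); apply/esym/negbTE; rewrite negb_and negbK.
      by case: eqP => [ei|]; rewrite ?orbT // orbF -(exit_crossing t i) -ei h.
    rewrite /port (inj_eq inr_inj) (inj_eq inl_inj) (inv_eq (@exitK t)).
    by case: eqP => [ei|]; rewrite ?andbF // andbT -(exit_crossing t i) -ei h.
  rewrite [X in (_ + (X + _) + _)%N]count_filter.
  rewrite [X in (_ + (X + _) + _)%N](eq_count (a2 := fun e => is_unoriented (t i.1) && (e == i))); last first.
    move=> e /=; rewrite /port (inj_eq inr_inj) (inj_eq inl_inj) andbC.
    by case: eqP => [->|]; rewrite ?andbF.
  rewrite !count_if !count_side [X in (_ + (_ + X) + _)%N](eq_count (a2 := pred0)) ?count_pred0 //.
  by case: is_unoriented.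
rewrite (eq_count (a2 := fun o : side => is_unoriented (t c) && (o.1 == c))); last first.
  move=> o /=; rewrite /target; case: ifP => h.
    by rewrite /vertex !(inj_eq inr_inj); case: eqP => [<-|]; rewrite ?andbF // h.
  by apply/esym/negbTE/negP => /andP[+ /eqP oc]; rewrite -oc h.
rewrite [X in (_ + (X + _) + _)%N](eq_count (a2 := pred0)) ?count_pred0 //.
rewrite [X in (_ + (_ + X) + _)%N]count_filter.
rewrite [X in (_ + (_ + X) + _)%N](eq_count (a2 := fun d => is_unoriented (t c) && (d == c))); last first.
  move=> d /=; rewrite /vertex !(inj_eq inr_inj).
  by case: eqP => [->|]; rewrite ?andbT ?andbF.
rewrite !count_if count_sides_at (count_uniq_mem c (enum_uniq C)) mem_enum.
by case: is_unoriented.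
Qed.

Lemma open_edges_open X t : wiring X -> open_web (open_edges X t) port_joins.
Proof.
move=> wX.
have uS : uniq (sides (enum C)) by rewrite sides_uniq ?enum_uniq.
have deg ns bs : uniq bs -> (forall x, (x \in bs) = if x is inr (inr c) then false else true) ->
    (forall x, count_mem x ns = if x is inr (inr c) then 3 * is_unoriented (t c) else 1) ->
    degree_ok bs ns.
  move=> ub bE nE; apply/degree_okP; split=> // x; rewrite bE nE.
  have := nE x; case: x => [//|[//|c]].
  case: (boolP (inr (inr c) \in ns)); first by rewrite -has_pred1 has_count => + h; rewrite h; case: is_unoriented.
  by move/count_memPn ->.
have jE (x : name) : (x \in [seq port i | i <- sides (enum C)] ++ [seq wire o | o <- sides (enum C)])
    = if x is inr (inr c) then false else true.
  rewrite mem_cat; case: x => [o|[i|c]].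
  - by rewrite orbC (mem_map inl_inj) mem_sides mem_enum.
  - rewrite (mem_map (f := port)); last by move=> a b [].
    by rewrite mem_sides mem_enum.
  - by apply/negbTE/negP => /orP[] /mapP[].
have ju : uniq ([seq port i | i <- sides (enum C)] ++ [seq wire o | o <- sides (enum C)]).
  rewrite cat_uniq !map_inj_uniq ?uS //; [|by move=> a b []..].
  by rewrite andbT; apply/hasPn => _ /mapP[o _ ->]; apply/mapP => -[].
apply/andP; split; apply: deg => //.
- by rewrite /port_joins /unzip2 map_cat -!map_comp; exact: ju.
- by rewrite /port_joins /unzip2 map_cat -!map_comp; exact: jE.
- by move=> x; exact: open_edges_tails.
- by rewrite /port_joins /unzip1 map_cat -!map_comp uniq_catC; exact: ju.
- by move=> x; rewrite /port_joins /unzip1 map_cat -!map_comp mem_cat orbC -mem_cat; exact: jE.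
- by move=> x; exact: open_edges_heads.
Qed.

Local Open Scope ring_scope.

Section Value.
Variables (K : comNzRingType) (A : int -> K) (M : comAlgType K) (irr : graph_class -> M).
Variable F : seq (nat * nat) -> M.
Hypothesis FP : forall n, valuation_below A irr n F.

Definition wiring_value X l t : M :=
  web_value A F (code (resolved_web X l t).1, (resolved_web X l t).2).

Lemma passes_joinable X t : wiring X -> all_joinable (passes t) X.
Proof.
move=> [p1 p2].
have e1 : unzip1 (passes t) = [seq i <- enum {: side} | ~~ is_unoriented (t i.1)].
  by rewrite /unzip1 -map_comp map_id.
have e2 : unzip2 (passes t) = map (exit t) [seq i <- enum {: side} | ~~ is_unoriented (t i.1)].
  by rewrite /unzip2 -map_comp.
apply/and3P; split.
- by rewrite e1 filter_uniq ?enum_uniq.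
- by rewrite e2 map_inj_uniq; [rewrite filter_uniq ?enum_uniq|exact: inv_inj (@exitK t)].
- apply/allP => j _; rewrite /joinable (seq.permP p1) (seq.permP p2).
  by rewrite !count_uniq_mem ?enum_uniq // !mem_enum.
Qed.

(** Plugging in absorbs the wires into the tangles: joining the incoming ports
    renames the heads of the wires into the heads which the tangles send them
    to, and then the outgoing ports either continue a strand or start at a
    vertex. *)
Lemma resolved_web_open X t l : wiring X ->
  same_web (joins port_joins (open_edges X t, l))
    (relabel vertex vertex (resolved_web X l t).1, (resolved_web X l t).2).
Proof.
move=> wX; have [p1 p2] := wX.
set S := sides (enum C); have uS : uniq S by rewrite sides_uniq ?enum_uniq.
set Hout := [seq (vertex o.1, port o) | o <- S & is_unoriented (t o.1)].
set HH := [seq (vertex c, vertex c) | c <- enum C & is_unoriented (t c)].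
set J1 := [seq (wire i, port i) | i <- S]; set J2 := [seq (port o, wire o) | o <- S].
set E1 := Hout ++ HH ++ relabel wire wire X.
have pE : perm_eq ([seq (port i, target t i) | i <- S] ++ E1) (open_edges X t).
  by rewrite perm_sym /open_edges /E1 !catA perm_cat2r -catA; exact: tangle_edges_perm.
have okE := open_web_joinable (open_edges_open t wX).
have okE' : all_joinable (J2 ++ J1) ([seq (port i, target t i) | i <- S] ++ E1).
  rewrite (all_joinable_perm _ pE) (all_joinable_permj _ (js' := port_joins)) //.
  by apply/permPl/perm_catC.
have [ok1 ok2] := all_joinable_cat l okE'.
apply: (same_web_trans (H := joins (J2 ++ J1) ([seq (port i, target t i) | i <- S] ++ E1, l))).
  apply: (same_web_trans (H := joins port_joins ([seq (port i, target t i) | i <- S] ++ E1, l))).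
    by apply: joins_same_web => //; split=> //; rewrite perm_sym.
  apply: joins_perm_eq; first by apply/permPl/perm_catC.
  by rewrite (all_joinable_perm _ pE).
rewrite joins_catl.
have S_all o : o \in S by rewrite mem_sides mem_enum.
(* The first half of the joinings lets each wire end at the target of the
   port it enters. *)
pose q (z : name) : name := if z is inl i then target t i else z.
have eq1 : relabel id q E1 = Hout ++ HH ++ relabel wire (target t) X.
  rewrite /E1 !relabel_cat /relabel -!map_comp; congr (_ ++ (_ ++ _)).
have c1 : same_web (joins J1 ([seq (port i, target t i) | i <- S] ++ E1, l)) (relabel id q E1, l).
  apply: absorb_heads => [||i _|[o|z]] //.
  - by rewrite map_inj_uniq // => a b [].
  - by rewrite map_inj_uniq // => a b [].
  - split=> //.
    + rewrite /E1 /unzip1 !map_cat !mem_cat -!map_comp !negb_or.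
      by apply/and3P; split; apply/mapP => -[e].
    + rewrite /E1 /unzip2 !map_cat !count_cat -!map_comp !count_map.
      rewrite !count_pred0 !add0n.
      transitivity (count_mem i (unzip2 X)).
        by rewrite /unzip2 count_map; apply: eq_count => e /=; rewrite inj_eq //; exact: inl_inj.
      by rewrite (seq.permP p2) count_uniq_mem ?enum_uniq // mem_enum.
    + by apply/mapP => -[o _]; rewrite /target; case: ifP.
  - by rewrite (mem_map (f := wire)) ?S_all // => a b [].
apply: same_web_trans (joins_same_web ok2 c1) _; rewrite eq1.
have {ok2} ok2 : all_joinable J2 (Hout ++ HH ++ relabel wire (target t) X).
  by case: c1; rewrite eq1 => /all_joinable_perm <-.
(* The second half is treated separately at the crossings with and without
   vertices. *)
set U := [seq o <- S | is_unoriented (t o.1)].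
pose Ju : seq (name * name) := [seq (port o, wire o) | o <- U].
have exit_unoriented o : is_unoriented (t (exit t o).1) = is_unoriented (t o.1).
  by rewrite exit_crossing.
have pJ : perm_eq J2 (Ju ++ relabel_joins wire (target t) (passes t)).
  set W := [seq i <- enum {: side} | ~~ is_unoriented (t i.1)].
  have -> : relabel_joins wire (target t) (passes t) =
      [seq (port o, wire o) | o <- [seq exit t i | i <- W]].
    rewrite /passes /relabel_joins -!map_comp; apply/eq_in_map => i.
    by rewrite mem_filter => /andP[/negbTE iU _] /=; rewrite /target iU.
  rewrite /Ju -map_cat; apply: perm_map; apply: uniq_perm => // [|o].
    rewrite cat_uniq filter_uniq // map_inj_uniq; last exact: inv_inj (@exitK t).
    rewrite filter_uniq -?enumT ?enum_uniq // andbT; apply/hasPn => x /mapP[i]; rewrite mem_filter => /andP[iU _] xi.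
    by rewrite xi /= mem_filter exit_unoriented (negbTE iU).
  have oW : (o \in [seq exit t i | i <- W]) = ~~ is_unoriented (t o.1).
    rewrite -[o in o \in _](@exitK t) mem_map; last exact: inv_inj (@exitK t).
    by rewrite mem_filter exit_unoriented mem_enum andbT.
  by rewrite mem_cat mem_filter (S_all o) oW andbT orbN.
set G2 := Hout ++ HH ++ _ in ok2 *.
have pG2 : perm_eq G2 (relabel wire (target t) X ++ (Hout ++ HH)).
  by rewrite /G2 catA; apply/permPl/perm_catC.
rewrite (all_joinable_permj _ pJ) in ok2.
have sJ : same_web (joins J2 (G2, l))
    (joins (Ju ++ relabel_joins wire (target t) (passes t))
      (relabel wire (target t) X ++ (Hout ++ HH), l)).
  apply: same_web_trans (joins_perm_eq pJ _) _; first by rewrite (all_joinable_permj _ pJ).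
  exact: joins_same_web.
rewrite (all_joinable_perm _ pG2) in ok2; have [_] := all_joinable_cat l ok2.
move=> ok4; apply: same_web_trans sJ _; rewrite joins_catl; move: ok4; rewrite joins_cat; last first.
  move=> _ /mapP[j jj ->]; rewrite /unzip1 /unzip2 !map_cat -!map_comp !mem_cat !negb_or.
  move: jj => /mapP[o]; rewrite mem_filter => /andP[oU _] -> /=.
  apply/andP; split; apply/andP; split; apply/mapP => -[o'] //.
    rewrite /target (negPf oU) mem_filter => /andP[o'U _] [eo'].
    by move: o'U; rewrite -eo' exit_crossing (negPf oU).
  by rewrite /target (negPf oU).
rewrite relabel_joins_web; last first.
  move=> j /mapP[i]; rewrite mem_filter => /andP[iU _] -> /=; split; first by move=> x [].
  move=> y; rewrite /target (negPf iU); case: ifP => // _ [] /(inv_inj (@exitK t)).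
  by [].
rewrite /resolved_web; have [e1 e2] := joins_ends l (passes_joinable t wX).
case: (joins (passes t) (X, l)) e1 e2 => Y l' /= e1 e2 okY.
have in_passes o : (o \in unzip1 (passes t)) = ~~ is_unoriented (t o.1).
  by rewrite /unzip1 -map_comp map_id mem_filter mem_enum andbT.
have in_passes2 o : (o \in unzip2 (passes t)) = ~~ is_unoriented (t o.1).
  rewrite -[o in o \in _](@exitK t) /unzip2 -map_comp mem_map; last exact: inv_inj (@exitK t).
  by rewrite mem_filter mem_enum exit_unoriented andbT.
have Y1 o : count_mem o (unzip1 Y) = is_unoriented (t o.1).
  have := seq.permP (perm_trans e1 p1) (pred1 o); rewrite count_cat [X in _ = X -> _]count_uniq_mem ?enum_uniq //.
  have /and3P[_ u2 _] := passes_joinable t wX.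
  rewrite (count_uniq_mem _ u2) in_passes2 mem_enum inE; case: is_unoriented => //=.
  by rewrite add1n => -[].
have Y2 o : o \in unzip2 Y -> is_unoriented (t o.1).
  have := seq.permP (perm_trans e2 p2) (pred1 o); rewrite count_cat [X in _ = X -> _]count_uniq_mem ?enum_uniq //.
  have /and3P[u1 _ _] := passes_joinable t wX.
  rewrite (count_uniq_mem _ u1) in_passes mem_enum inE; case: is_unoriented => //=.
  rewrite add1n => -[/eqP].
  by rewrite eqn0Ngt -has_count has_pred1 => /negbTE ->.
(* At an unoriented crossing the outgoing wires start at its vertex. *)
pose p (z : name) : name := if z is inl o then (if is_unoriented (t o.1) then vertex o.1 else z) else z.
have sT : same_web (joins Ju (Hout ++ (HH ++ relabel wire (target t) Y), l'))
    (relabel p id (HH ++ relabel wire (target t) Y), l').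
  apply: absorb_tails => [||o|[o|z]] //.
  - by rewrite map_inj_uniq ?filter_uniq // => a b [].
  - by rewrite map_inj_uniq ?filter_uniq // => a b [].
  - rewrite mem_filter => /andP[oU _]; split=> //.
    + rewrite /unzip2 !map_cat !mem_cat -!map_comp !negb_or.
      apply/andP; split; apply/mapP => -[e] // eY /=.
      by rewrite /target (Y2 e.2) //; exact: map_f.
    + rewrite /unzip1 !map_cat !count_cat -!map_comp !count_map.
      rewrite count_pred0 add0n -[RHS](_ : nat_of_bool true = 1) // -oU -Y1.
      by rewrite /unzip1 count_map; apply: eq_count => e /=; rewrite inj_eq //; exact: inl_inj.
    + by apply/mapP => -[].
    + by rewrite /p /= oU.
  - rewrite (mem_map (f := wire)); last by move=> a b [].
    by rewrite mem_filter S_all andbT /p /= => /negbTE ->.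
apply: (same_web_trans (H := joins Ju (Hout ++ (HH ++ relabel wire (target t) Y), l'))).
  by apply: joins_same_web => //; split=> //=; rewrite [X in perm_eq _ X]catA; apply/permPl/perm_catC.
apply: same_web_trans sT _; split=> //=.
rewrite !relabel_cat; set Y' := relabel p id (relabel wire (target t) Y).
have -> : Y' = relabel vertex vertex (relabel fst fst Y).
  rewrite /Y' !relabel_comp; apply: relabel_in => o oY /=; last by rewrite /target Y2.
  by move: oY; rewrite -has_pred1 has_count Y1 /p /=; case: is_unoriented.
have -> : relabel p id HH = HH by rewrite /relabel -map_comp.
have -> : relabel vertex vertex [seq (c, c) | c <- enum C & is_unoriented (t c)] = HH.
  by rewrite /relabel -map_comp.
by apply/permPl/perm_catC.
Qed.
Lemma relabelled_value n (S T S' T' : countType) (p : S -> S') (q : T -> T')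
    (G : seq (S' * T') * nat) (H : seq (S * T) * nat) :
  injective p -> injective q -> fits n G.1 [::] -> same_web G (relabel p q H.1, H.2) ->
  web_value A F (code G.1, G.2) = web_value A F (code H.1, H.2).
Proof.
case: H => H k pI qI fG sG; rewrite (same_web_value (FP n) fG sG).
have fH : fits n H [::].
  case: sG fG => /= pG _; rewrite -(fits_relabel n H [::] pI qI) /fits (open_web_perm pG (perm_refl _)).
  by rewrite (perm_size pG).
have := open_value_relabel (FP n) pI qI fH; rewrite /open_value /joins /= /web_value !expr0 !scale1r /=.
by move=> ->.
Qed.

Lemma wiring_valueE X l t : wiring X ->
  wiring_value X l t = loop_value A ^+ l *: open_value A F (open_edges X t) port_joins.
Proof.
move=> wX; have sw := resolved_web_open t l wX.
have vI : injective vertex by move=> c d [].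
pose n := (size (open_edges X t)).+1.
have fE : fits n (open_edges X t) port_joins.
  by rewrite /fits (open_edges_open t wX) /n ltn_addr.
have := fits_joins (js := [::]) 0 fE; rewrite joins_loops in sw.
move=> fG; rewrite /wiring_value -(relabelled_value (G := (_, (l + _)%N)) vI vI fG sw) /open_value /web_value /=.
by rewrite exprD scalerA.
Qed.

Lemma resolved_open X l t : wiring X -> open_web (resolved_web X l t).1 [::].
Proof.
move=> wX; have [pG _] := resolved_web_open t l wX.
have vI : injective vertex by move=> c d [].
rewrite -(open_web_relabel _ [::] vI vI) -(open_web_perm pG (perm_refl _)).
by apply: open_web_joins; exact: open_edges_open.
Qed.
End Value.
End Tangles.

(** * Forgetting crossings whose strands go through *)

Local Open Scope ring_scope.

Section Forget.
Variables (K : comNzRingType) (A : int -> K) (M : comAlgType K) (irr : graph_class -> M).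
Variable F : seq (nat * nat) -> M.
Hypothesis FP : forall n, valuation_below A irr n F.

(** The joinings of [forget]: on each side the strand leaves on the other one. *)
Definition through (C : finType) (P : pred C) : seq ((C * bool) * (C * bool)) :=
  [seq (i, (i.1, ~~ i.2)) | i <- enum {: C * bool} & P i.1].

Definition on_sides (C C' : finType) (f : C' -> C) (i : C' * bool) : C * bool := (f i.1, i.2).

Lemma on_sides_inj (C C' : finType) (f : C' -> C) : injective f -> injective (on_sides f).
Proof. by move=> fI [c b] [d e] [/fI -> ->]. Qed.

(** Joinings may be done in any order, so those at the crossings of P come
    first; what remains is the wiring on the other crossings, which are renamed
    by f. *)
Lemma wiring_value_forget (C C' : finType) (P : pred C) (f : C' -> C) X l X' l' t :
  injective f -> (forall c, P c = (c \notin codom f)) -> (forall c, P c -> t c = Through) ->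
  wiring X -> wiring X' ->
  same_web (joins (through P) (X, l)) (relabel (on_sides f) (on_sides f) X', l') ->
  wiring_value A F X l t = wiring_value A F X' l' (t \o f).
Proof.
move=> fI PE tP wX wX' sX.
have gI := on_sides_inj fI; set g := on_sides f in gI sX *.
pose e (i : C * bool) := (i, exit t i).
have pN : perm_eq (passes t) (relabel_joins g g (passes (t \o f)) ++ through P).
  have -> : through P = map e [seq i <- enum {: C * bool} | P i.1].
    by apply/eq_in_map => i; rewrite mem_filter => /andP[/tP ti _]; rewrite /e /exit ti.
  have -> : relabel_joins g g (passes (t \o f)) =
      map e [seq g i | i <- enum {: C' * bool} & ~~ is_unoriented ((t \o f) i.1)].
    by rewrite /passes /relabel_joins -!map_comp; apply: eq_map => i; rewrite /e /exit /=; case: is_oriented.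
  rewrite -map_cat; apply: perm_map; apply: uniq_perm => [||i].
  - by rewrite filter_uniq ?enum_uniq.
  - rewrite cat_uniq (map_inj_uniq gI) !(filter_uniq _ (enum_uniq _)) andbT.
    apply/hasPn => x; rewrite mem_filter PE => /andP[xf _]; apply/mapP => -[y _ xy].
    by move: xf; rewrite xy /g /= codom_f.
  rewrite mem_cat mem_filter mem_enum [X in _ || X]mem_filter mem_enum !andbT; case: (boolP (P i.1)) => Pi.
    by rewrite tP ?orbT.
  rewrite orbF; have /codomP[c ic] : i.1 \in codom f by rewrite -[_ \in _]negbK -PE.
  have -> : i = g (c, i.2) by rewrite /g /on_sides -ic -surjective_pairing.
  by rewrite (mem_map gI) mem_filter mem_enum andbT.
have sR : same_web (resolved_web X l t)
    (relabel f f (resolved_web X' l' (t \o f)).1, (resolved_web X' l' (t \o f)).2).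
  have := joins_perm_eq (G := (X, l)) pN (passes_joinable t wX).
  rewrite joins_catl => s1.
  have ok : all_joinable (relabel_joins g g (passes (t \o f))) (joins (through P) (X, l)).1.
    have : all_joinable (relabel_joins g g (passes (t \o f)) ++ through P) X.
      by rewrite -(all_joinable_permj _ pN) passes_joinable.
    by case/(all_joinable_cat l).
  have := same_web_trans s1 (joins_same_web ok sX).
  rewrite relabel_joins_web /resolved_web; last by move=> j _; split=> x /gI.
  case: (joins (passes t) _) => Y k; case: (joins (passes (t \o f)) _) => Y' k' [/= pY ->].
  split=> //=; rewrite relabel_cat; apply: perm_cat.
    by apply: perm_trans (perm_map _ pY) _; rewrite relabel_comp -[X in perm_eq X _]map_comp.
  have -> : relabel f f [seq (c, c) | c <- enum C' & is_unoriented ((t \o f) c)] =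
      [seq (c, c) | c <- [seq f c | c <- enum C' & is_unoriented ((t \o f) c)]].
    by rewrite /relabel -[LHS]map_comp -[RHS]map_comp; exact: eq_map.
  apply: perm_map; apply: uniq_perm => [||c].
  - by rewrite filter_uniq ?enum_uniq.
  - by rewrite (map_inj_uniq fI) filter_uniq ?enum_uniq.
  case: (boolP (c \in codom f)) => [/codomP[d ->]|cf].
    by rewrite (mem_map fI) mem_filter mem_enum mem_filter mem_enum.
  rewrite mem_filter tP ?PE //=; apply/esym/mapP => -[d _ cd].
  by rewrite cd codom_f in cf.
pose n := (size (resolved_web X l t).1).+1.
rewrite /wiring_value (relabelled_value FP (n := n) fI fI _ sR) //.
by rewrite /fits (resolved_open _ _ wX) /n addn0 ltnSn.
Qed.

End Forget.

(** * Sums over states *)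

Section StateSum.
Variables (K : comNzRingType) (M : lmodType K).

(** A sum over the subsets s of cl, where w c b is the weight of c according to
    its membership b in s. *)
Definition state_sum (C : finType) (w : C -> bool -> K) (cl : {set C}) (h : {set C} -> M) : M :=
  \sum_(s : {set C} | s \subset cl) (\prod_(c in cl) w c (c \in s)) *: h s.

Lemma eq_state_sum (C : finType) (w w' : C -> bool -> K) (cl : {set C}) (h h' : {set C} -> M) :
  w =2 w' -> (forall s : {set C}, s \subset cl -> h s = h' s) -> state_sum w cl h = state_sum w' cl h'.
Proof.
move=> ww hh; apply: eq_bigr => s scl; rewrite hh //; congr (_ *: _).
by apply: eq_bigr => c _; exact: ww.
Qed.

(** States are grouped by the choice made at c. *)
Lemma state_sum_split (C : finType) (w : C -> bool -> K) (cl : {set C}) (h : {set C} -> M) c : c \in cl ->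
  state_sum w cl h =
    state_sum w (cl :\ c) (fun s => w c false *: h s + w c true *: h (c |: s)).
Proof.
move=> ccl; rewrite /state_sum (bigID (fun s : {set C} => c \in s)) /= addrC.
under [RHS]eq_bigr do rewrite scalerDr.
rewrite big_split /=; congr (_ + _).
  apply: eq_big => [s|s /andP[_ cs]]; first by rewrite subsetD1.
  rewrite (big_setD1 c) //= (negPf cs) mulrC -scalerA.
  by [].
rewrite (reindex_onto (fun s => c |: s) (fun s => s :\ c)) /=; last first.
  by move=> s /andP[_ cs]; rewrite setD1K.
apply: eq_big => [s|s /andP[/andP[_ _] /eqP cs]].
  rewrite subUset sub1set ccl setU11 andbT subsetD1 /=; congr (_ && _).
  apply/eqP/idP => [<-|cs]; first by rewrite !inE eqxx.
  by rewrite setU1K.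
rewrite (big_setD1 c) //= setU11 mulrC -scalerA; congr (_ *: _).
apply: eq_bigr => d; rewrite !inE => /andP[/negPf -> _].
by [].
Qed.

(** Renaming crossings by an injection f. *)
Lemma state_sum_imset (C C' : finType) (f : C' -> C) (w : C -> bool -> K) (cl : {set C'}) (h : {set C} -> M) : injective f ->
  state_sum w (f @: cl) h = state_sum (w \o f) cl (fun s => h (f @: s)).
Proof.
move=> fI; rewrite /state_sum (reindex_onto (fun s : {set C'} => f @: s) (fun s => f @^-1: s)); last first.
  move=> s scl; apply/setP => c; apply/imsetP/idP => [[d]|cs]; first by rewrite inE => ? ->.
  by have /imsetP[d _ cd] := subsetP scl _ cs; exists d; rewrite // inE -cd.
apply: eq_big => [s|s _].
  have fK (B : {set C'}) : f @^-1: (f @: B) = B by apply/setP => c; rewrite inE mem_imset.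
  by rewrite sub_imset_pre !fK eqxx andbT.
rewrite big_imset /=; last by move=> c d _ _; exact: fI.
by congr (_ *: _); apply: eq_bigr => c _; rewrite mem_imset.
Qed.

Definition update (C : finType) (t : C -> tangle) c T : C -> tangle :=
  fun d => if d == c then T else t d.

(** The crossings of P are forgotten; s is the set of unoriented crossings. *)
Definition state_tangle (C : finType) (k : C -> crossing) (P s : {set C}) (c : C) : tangle :=
  if c \in P then Through else if c \in s then Unoriented
  else if classical (k c) then Oriented else Through.

(** The weighted sum over the two tangles at c, as an operation on functions of
    all tangles. *)
Definition expand_crossing (C : finType) (w : C -> bool -> K) c (H : (C -> tangle) -> M) t : M :=
  w c false *: H (update t c Oriented) + w c true *: H (update t c Unoriented).

Lemma state_sum_expand (C : finType) (k : C -> crossing) w (cl P : {set C}) H c :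
  c \in cl -> c \notin P -> classical (k c) ->
  state_sum w cl (fun s => H (state_tangle k P s)) =
    state_sum w (cl :\ c) (fun s => expand_crossing w c H (state_tangle k P s)).
Proof.
move=> ccl cP kc; rewrite (state_sum_split _ _ ccl).
apply: eq_state_sum => // s; rewrite subsetD1 => /andP[_ cs].
rewrite /expand_crossing; congr (_ *: H _ + _ *: H _); apply/funext => d.
  rewrite /state_tangle /update; case: eqP => // ->.
  by rewrite (negPf cP) (negPf cs) kc.
rewrite /state_tangle /update !inE; case: eqP => //= ->.
by rewrite (negPf cP).
Qed.

Lemma state_sum_expand_all (C : finType) (k : C -> crossing) w (cl P : {set C}) H cs :
  uniq cs -> {subset cs <= cl} -> (forall c, c \in cs -> c \notin P /\ classical (k c)) ->
  state_sum w cl (fun s => H (state_tangle k P s)) =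
    state_sum w (cl :\: [set c in cs])
      (fun s => foldr (expand_crossing w) H cs (state_tangle k P s)).
Proof.
elim: cs H => [|c cs IH] H.
  by move=> _ _ _; congr (state_sum w _ _); apply/setP => c; rewrite !inE.
move=> /= /andP[ccs ucs] scl hcs; rewrite IH //; last first.
- by move=> d dcs; apply: hcs; rewrite inE dcs orbT.
- by move=> d dcs; apply: scl; rewrite inE dcs orbT.
have [cP kc] := hcs c (mem_head _ _).
rewrite (state_sum_expand _ _ (c := c)) //; last by rewrite !inE ccs scl ?mem_head.
congr (state_sum w _ _); apply/setP => d.
by rewrite !inE negb_or andbA.
Qed.

End StateSum.

(** * The bracket as a sum over states *)

Lemma wires_wiring (D : diagram) : wiring (wires D).1.
Proof.
split; first by rewrite /unzip1 -map_comp map_id.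
rewrite /unzip2 -map_comp; apply: uniq_perm; rewrite ?enum_uniq //.
  by rewrite map_inj_uniq ?enum_uniq //; exact: perm_inj.
move=> x; rewrite mem_enum; apply/mapP; exists ((succ D)^-1 x)%g; rewrite ?mem_enum //.
by rewrite /= permKV.
Qed.

Definition classical_set (D : diagram) : {set 'I_(ncross D)} := [set c | classical (kind c)].

Section DiagramSum.
Variables (K : comNzRingType) (A : int -> K) (M : comAlgType K) (irr : graph_class -> M).
Variable F : seq (nat * nat) -> M.
Hypothesis FP : forall n, valuation_below A irr n F.

Definition crossing_weight (k : crossing) (b : bool) : K :=
  if b then - A (- sign k) else A (2 * sign k).

Definition diagram_sum (D : diagram) : M :=
  state_sum (fun c => crossing_weight (kind c)) (classical_set D)
    (fun s => wiring_value A F (wires D).1 (loose D) (state_tangle (@kind D) set0 s)).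

(** The graph of a state names vertices by the numbers of the crossings while
    [wiring_value] uses their codes. *)
Lemma state_value (D : diagram) s : web_value A F (@state_web D s) =
  wiring_value A F (wires D).1 (loose D) (state_tangle (@kind D) set0 s).
Proof.
set t := state_tangle _ _ _.
have tU c : is_unoriented (t c) = (c \in s).
  by rewrite /t /state_tangle inE; case: (c \in s) => //; case: (classical _).
have tO i : i.1 \notin s -> exit t i = if classical (kind i.1) then i else (i.1, ~~ i.2).
  by move=> /negPf h; rewrite /exit /t /state_tangle inE h; case: (classical _).
have -> : state_web s = ([seq (val e.1.1, val e.2.1) | e <- (joins (passes t) (wires D)).1] ++
    [seq (val c, val c) | c <- enum s], (joins (passes t) (wires D)).2).
  have -> : passes t = smoothings s.
    rewrite /passes /smoothings (eq_filter (a2 := fun i => i.1 \notin s)); last by move=> i; rewrite tU.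
    by apply/eq_in_map => i; rewrite mem_filter => /andP[/tO -> _].
  by rewrite /state_web; case: (joins _ _).
rewrite /wiring_value /web_value; congr (_ *: _).
have := resolved_open (loose D) t (wires_wiring D); set G := resolved_web _ _ _ => oG.
apply: (valuation_relabel (FP (size G.1).+1) (p := pickle) (q := pickle) (p' := val) (q' := val) oG) => //.
- exact: in2W (@pickle_inj _).
- exact: in2W val_inj.
- exact: in2W (@pickle_inj _).
- exact: in2W val_inj.
rewrite [relabel _ _ _]map_cat; apply: perm_cat.
  by rewrite -[X in perm_eq _ X]map_comp.
rewrite -[X in perm_eq _ X]map_comp.
apply: perm_map; apply: uniq_perm => [||c]; rewrite ?(filter_uniq _ (enum_uniq _)) ?enum_uniq //.
by rewrite mem_enum mem_filter mem_enum tU andbT.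
Qed.

(** The crossings of W are those of D outside P, and the tangles of D let the
    strands through at P. *)
Lemma diagram_sum_forget (D W : diagram) P phi : @forgets D P W phi ->
  diagram_sum W = state_sum (fun c => crossing_weight (kind c)) (classical_set D :\: P)
    (fun s => wiring_value A F (wires D).1 (loose D) (state_tangle (@kind D) P s)).
Proof.
move=> [fI PE kE pX lE].
have -> : classical_set D :\: P = phi @: classical_set W.
  apply/setP => c; rewrite !inE PE negbK; apply/andP/imsetP.
    by move=> [/codomP[d ->] kc]; exists d; rewrite // inE -kE.
  by move=> [d]; rewrite inE => kd ->; rewrite codom_f kE.
rewrite state_sum_imset //; apply: eq_state_sum => [c b /=|s _].
  by rewrite kE.
have -> : state_tangle (@kind W) set0 s = state_tangle (@kind D) P (phi @: s) \o phi.
  apply/funext => c /=; rewrite /state_tangle inE PE codom_f /= kE.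
  by rewrite mem_imset.
apply/esym; apply: (wiring_value_forget FP (P := mem P) fI PE) => //.
- by move=> c cP; rewrite /state_tangle [c \in P]cP.
- exact: wires_wiring.
- exact: wires_wiring.
Qed.

End DiagramSum.

(** * Cutting out some crossings of a wiring *)

Local Close Scope ring_scope.






Local Notation slot := (nat * bool)%type.

(** Names of the k-th crossing in a piece: 5 k and 5 k + 1 for its wires, 5 k +
    2 and 5 k + 3 for its ports, and 5 k + 4 for its vertices. *)
Definition local_wire (x : slot) : nat := 5 * x.1 + x.2.
Definition local_port (x : slot) : nat := 5 * x.1 + 2 + x.2.
Definition local_vertex (k : nat) : nat := 5 * k + 4.

Definition local_tangle (k : nat) (T : tangle) : seq (nat * nat) :=
  let t := local_port (k, true) in let f := local_port (k, false) in
  let v := local_vertex k in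
  match T with
  | Oriented => [:: (t, t); (f, f)]
  | Through => [:: (t, f); (f, t)]
  | Unoriented => [:: (t, v); (f, v); (v, t); (v, f); (v, v)]
  end.

Fixpoint local_tangles k (Ts : seq tangle) : seq (nat * nat) :=
  if Ts is T :: Ts' then local_tangle k T ++ local_tangles k.+1 Ts' else [::].

Definition slots n : seq slot := [seq (k, b) | k <- iota 0 n, b <- [:: true; false]].

Definition local_wires (I : seq (slot * slot)) : seq (nat * nat) :=
  relabel local_wire local_wire I.

(** The ends of the wires in I, which connect crossings of the piece, are
    plugged inside; the other ports are free ends. *)
Definition local_joins (I : seq (slot * slot)) : seq (nat * nat) :=
  [seq (local_wire e.2, local_port e.2) | e <- I] ++
  [seq (local_port e.1, local_wire e.1) | e <- I].

(** The incoming ports which no wire of I enters. *)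
Definition boundary_tails n (I : seq (slot * slot)) : seq nat :=
  [seq local_port x | x <- slots n & x \notin unzip2 I].
Definition boundary_heads n (I : seq (slot * slot)) : seq nat :=
  [seq local_port x | x <- slots n & x \notin unzip1 I].

Lemma slots_uniq n : uniq (slots n).
Proof. by apply: allpairs_uniq => [||[a b] [c d] _ _ [-> ->]] //; exact: iota_uniq. Qed.

Lemma mem_slots n x : (x \in slots n) = (x.1 < n).
Proof.
case: x => k b; apply/allpairsP/idP => [[[a c] /= [+ _ [-> _]]]|kn]; first by rewrite mem_iota.
by exists (k, b); rewrite mem_iota /=; split=> //; case: (b).
Qed.

Lemma local_port_inj : injective local_port.
Proof. by move=> [a b] [c d]; rewrite /local_port /=; case: b; case: d => /= e; congr (_, _); lia. Qed.

Section Context.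
Variables (C : finType) (c0 : C) (cs : seq C).
Hypothesis cs_uniq : uniq cs.
Notation side := (C * bool)%type.
Notation name := (side + (side + C))%type.

Definition side_of (x : slot) : side := (nth c0 cs x.1, x.2).
Definition slot_of (i : side) : slot := (index i.1 cs, i.2).

Lemma side_ofK i : i.1 \in cs -> side_of (slot_of i) = i.
Proof. by case: i => c b ccs; rewrite /side_of /= nth_index. Qed.

Lemma slot_ofK x : x.1 < size cs -> slot_of (side_of x) = x.
Proof. by case: x => k b /= kn; rewrite /slot_of /= index_uniq. Qed.

(** Sends the names at the crossings cs to local names. A wire end counts as
    local only if it belongs to a wire inside the piece, hence the parameter S. *)
Definition localize (S : seq slot) (x : name) : nat + name :=
  match x with
  | inl i => if (i.1 \in cs) && (slot_of i \in S) then inl (local_wire (slot_of i)) else inr x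
  | inr (inl i) => if i.1 \in cs then inl (local_port (slot_of i)) else inr x
  | inr (inr c) => if c \in cs then inl (local_vertex (index c cs)) else inr x
  end.

Lemma localize_wire S x : x.1 < size cs -> x \in S ->
  localize S (wire (side_of x)) = inl (local_wire x).
Proof. by move=> xn xS; rewrite /localize /= -/(side_of x) slot_ofK // mem_nth // xS. Qed.

Lemma localize_port S x : x.1 < size cs ->
  localize S (port (side_of x)) = inl (local_port x).
Proof. by move=> xn; rewrite /localize /= -/(side_of x) slot_ofK // mem_nth. Qed.

(** Decodes local names; it proves that localizing is injective. *)
Definition unlocalize (y : nat + name) : name :=
  match y with
  | inr x => x
  | inl z => let c := nth c0 cs (z %/ 5) in let r := z %% 5 in
      if r < 2 then wire (c, r == 1) else if r < 4 then port (c, r == 3) else vertex c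
  end.

Lemma localizeK S : cancel (localize S) unlocalize.
Proof.
have d5 k r : r < 5 -> ((5 * k + r) %/ 5 = k) * ((5 * k + r) %% 5 = r).
  by move=> r5; split; move: r5; clear; lia.
move=> [[c b]|[[c b]|c]] /=; rewrite /slot_of /=; case: ifP => //=.
- move=> /andP[ccs _]; rewrite /local_wire /= !d5; try by case: b.
  by rewrite nth_index //; case: b.
- move=> ccs; rewrite /local_port /= -addnA !d5; try by case: b.
  by rewrite nth_index //; case: b.
- by move=> ccs; rewrite /local_vertex !d5 // nth_index.
Qed.

Lemma localize_inj S : injective (localize S).
Proof. exact: can_inj (localizeK S). Qed.

Lemma local_tanglesE (t : C -> tangle) :
  flatten [seq local_tangle (index c cs) (t c) | c <- cs] = local_tangles 0 (map t cs).
Proof.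
have gen k (s : seq C) : (forall i, i < size s -> index (nth c0 s i) cs = k + i) ->
    flatten [seq local_tangle (index c cs) (t c) | c <- s] = local_tangles k (map t s).
  elim: s k => [|c s IH] k //= h; rewrite (IH k.+1); first by have := h 0 isT; rewrite /= addn0 => ->.
  by move=> i si; have /= -> := h i.+1 si; rewrite addnS.
by apply: gen => i si; rewrite index_uniq.
Qed.

Variables (I : seq (slot * slot)) (X Xext : seq (side * side)).
Hypothesis I_slots : all (fun e : slot * slot => (e.1.1 < size cs) && (e.2.1 < size cs)) I.
Notation Iw := (relabel side_of side_of I).
Hypothesis X_split : perm_eq X (Iw ++ Xext).
Hypothesis X_wiring : wiring X.

Lemma mem_internal_tails x : x.1 < size cs -> (side_of x \in unzip1 Iw) = (x \in unzip1 I).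
Proof.
move=> xn; rewrite relabel_tails; apply/mapP/idP => [[y yI xy]|xI]; last by exists x.
suff -> : x = y by [].
rewrite -(slot_ofK xn) xy slot_ofK //.
by have /mapP[e eI ->] := yI; have /andP[] := allP I_slots _ eI.
Qed.

Lemma mem_internal_heads x : x.1 < size cs -> (side_of x \in unzip2 Iw) = (x \in unzip2 I).
Proof.
move=> xn; rewrite relabel_heads; apply/mapP/idP => [[y yI xy]|xI]; last by exists x.
suff -> : x = y by [].
rewrite -(slot_ofK xn) xy slot_ofK //.
by have /mapP[e eI ->] := yI; have /andP[] := allP I_slots _ eI.
Qed.

Lemma internal_tails_uniq : uniq (unzip1 (Iw ++ Xext)).
Proof.
case: X_wiring => p1 _; rewrite -(perm_uniq (perm_map _ X_split)).
by rewrite (perm_uniq p1) enum_uniq.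
Qed.

Lemma internal_heads_uniq : uniq (unzip2 (Iw ++ Xext)).
Proof.
case: X_wiring => _ p2; rewrite -(perm_uniq (perm_map _ X_split)).
by rewrite (perm_uniq p2) enum_uniq.
Qed.

Notation p := (localize (unzip1 I)).
Notation q := (localize (unzip2 I)).
Notation S := (sides (enum C)).

(** The plugging splits into the joinings along wires inside the piece and all
    the others. *)
Definition outer_joins : seq (name * name) :=
  [seq (wire i, port i) | i <- S & i \notin unzip2 Iw] ++
  [seq (port o, wire o) | o <- S & o \notin unzip1 Iw].

Definition inner_joins : seq (name * name) :=
  [seq (wire i, port i) | i <- unzip2 Iw] ++ [seq (port o, wire o) | o <- unzip1 Iw].

Lemma split_joins : perm_eq (port_joins C) (outer_joins ++ inner_joins).
Proof.
have uS : uniq S by rewrite sides_uniq ?enum_uniq.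
have part (s : seq side) : uniq s -> perm_eq S ([seq i <- S | i \notin s] ++ s).
  move=> us; apply: uniq_perm => // [|i].
    by rewrite cat_uniq filter_uniq // us andbT; apply/hasPn => i si; rewrite mem_filter si.
  by rewrite mem_cat mem_filter mem_sides mem_enum andbT orNb.
have u1 : uniq (unzip1 Iw) by have := internal_tails_uniq; rewrite /unzip1 map_cat cat_uniq => /and3P[].
have u2 : uniq (unzip2 Iw) by have := internal_heads_uniq; rewrite /unzip2 map_cat cat_uniq => /and3P[].
have := perm_cat (perm_map (fun i => (wire i, port i)) (part _ u2)) (perm_map (fun o => (port o, wire o)) (part _ u1)).
rewrite !map_cat => /perm_trans; apply.
by rewrite /outer_joins /inner_joins -!catA perm_cat2l perm_catCA.
Qed.

Lemma localize_inner : relabel_joins p q inner_joins = relabel_joins inl inl (local_joins I).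
Proof.
rewrite /relabel_joins !map_cat -!map_comp; congr (_ ++ _); apply/eq_in_map => e eI;
  have /andP[h1 h2] := allP I_slots _ eI.
  transitivity (q (wire (side_of e.2)), p (port (side_of e.2))) => //.
  by rewrite localize_wire ?localize_port //; exact: map_f.
transitivity (q (port (side_of e.1)), p (wire (side_of e.1))) => //.
by rewrite localize_wire ?localize_port //; exact: map_f.
Qed.

Lemma outer_uniq : uniq (lefts (unzip1 (relabel_joins p q outer_joins))) /\
  uniq (lefts (unzip2 (relabel_joins p q outer_joins))).
Proof.
have /andP[/and3P[u2 _ _] /and3P[u1 _ _]] := open_edges_open (fun=> Through) X_wiring.
have ul (s : seq (nat + name)) : uniq s -> uniq (lefts s) by rewrite uniq_sum => /andP[].
split; apply: ul; rewrite /unzip1 /unzip2 -map_comp.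
  rewrite (map_comp q fst) (map_inj_uniq (@localize_inj _)).
  by move: u1; rewrite (perm_uniq (perm_map _ split_joins)) map_cat cat_uniq => /and3P[].
rewrite (map_comp p snd) (map_inj_uniq (@localize_inj _)).
by move: u2; rewrite (perm_uniq (perm_map _ split_joins)) map_cat cat_uniq => /and3P[].
Qed.

Lemma localize_outer_tails : perm_eq (lefts (unzip2 (relabel_joins p q outer_joins)))
  (boundary_tails (size cs) I).
Proof.
apply: uniq_perm; first by have [] := outer_uniq.
  by rewrite (map_inj_uniq local_port_inj) filter_uniq // slots_uniq.
move=> z; rewrite mem_lefts /unzip2 /outer_joins /relabel_joins !map_cat -!map_comp mem_cat.
apply/orP/mapP => [[]|].
- move=> /mapP[i]; rewrite mem_filter => /andP[iI _] /=; case: ifP => // ics [->].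
  exists (slot_of i) => //; rewrite mem_filter mem_slots /= index_mem ics andbT.
  by rewrite -mem_internal_heads ?side_ofK // index_mem.
- move=> /mapP[i]; rewrite mem_filter => /andP[iI _] /=; case: ifP => // /andP[ics].
  by rewrite -mem_internal_tails ?index_mem // side_ofK // (negPf iI).
move=> [x]; rewrite mem_filter mem_slots => /andP[xI xn] ->; left.
apply/mapP; exists (side_of x).
  by rewrite mem_filter mem_internal_heads // xI mem_sides mem_enum.
by rewrite /= mem_nth // slot_ofK.
Qed.

Lemma localize_outer_heads : perm_eq (lefts (unzip1 (relabel_joins p q outer_joins)))
  (boundary_heads (size cs) I).
Proof.
apply: uniq_perm; first by have [] := outer_uniq.
  by rewrite (map_inj_uniq local_port_inj) filter_uniq // slots_uniq.
move=> z; rewrite mem_lefts /unzip1 /outer_joins /relabel_joins !map_cat -!map_comp mem_cat.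
apply/orP/mapP => [[]|].
- move=> /mapP[i]; rewrite mem_filter => /andP[iI _] /=; case: ifP => // /andP[ics].
  by rewrite -mem_internal_heads ?index_mem // side_ofK // (negPf iI).
- move=> /mapP[i]; rewrite mem_filter => /andP[iI _] /=; case: ifP => // ics [->].
  exists (slot_of i) => //; rewrite mem_filter mem_slots /= index_mem ics andbT.
  by rewrite -mem_internal_tails ?side_ofK // index_mem.
move=> [x]; rewrite mem_filter mem_slots => /andP[xI xn] ->; right.
apply/mapP; exists (side_of x).
  by rewrite mem_filter mem_internal_tails // xI mem_sides mem_enum.
by rewrite /= mem_nth // slot_ofK.
Qed.

(** The surrounding of the crossings cs: the tangles at the other crossings and
    the wires which are not inside the piece. *)
Definition outside (t : C -> tangle) : seq (name * name) :=
  flatten [seq tangle_edges c (t c) | c <- enum C & c \notin cs] ++ relabel (@wire C) (@wire C) Xext.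

Lemma localize_outside t : relabel p q (outside t) = relabel inr inr (outside t).
Proof.
rewrite /outside !relabel_cat; congr (_ ++ _).
  elim: (enum C) => //= c s IH; case: ifP => //= /negbTE ccs; rewrite !relabel_cat IH.
  by congr (_ ++ _); case: (t c); rewrite /relabel /= ccs.
rewrite !relabel_comp; apply: relabel_in => o oX /=; case: ifP => // /andP[ocs].
  rewrite -mem_internal_tails ?index_mem // side_ofK // => oI.
  move: internal_tails_uniq; rewrite /unzip1 map_cat cat_uniq => /and3P[_ /hasPn h _].
  by have := h _ oX; rewrite /= -/(unzip1 _) oI.
rewrite -mem_internal_heads ?index_mem // side_ofK // => oI.
move: internal_heads_uniq; rewrite /unzip2 map_cat cat_uniq => /and3P[_ /hasPn h _].
by have := h _ oX; rewrite /= -/(unzip2 _) oI.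
Qed.

(** Exchanges sides, acting by f on the ends of wires and by g on ports: with
    (SO, SI) for tails and (SI, SO) for heads, both ends of every joining are
    moved in the same way. *)
Definition rename_sides (f g : side -> side) (x : name) : name :=
  match x with inl o => inl (f o) | inr (inl i) => inr (inl (g i)) | _ => x end.

Lemma rename_sides_inj f g : injective f -> injective g -> injective (rename_sides f g).
Proof. by move=> fI gI [a|[a|a]] [b|[b|b]] //= [] // => [/fI ->|/gI ->]. Qed.

Section Swap.
Variables (SO SI : side -> side) (X' : seq (side * side)) (fT fH : nat -> nat).
Hypotheses (SO_inj : injective SO) (SI_inj : injective SI).
Hypothesis SO_off : forall i, i.1 \notin cs -> SO i = i.
Hypothesis SI_off : forall i, i.1 \notin cs -> SI i = i.
Hypothesis X'_X : perm_eq (relabel SO SI X') X.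
Hypothesis SO_local : forall i, i.1 \in cs -> q (port (SO i)) = inl (fH (local_port (slot_of i))).
Hypothesis SI_local : forall i, i.1 \in cs -> p (port (SI i)) = inl (fT (local_port (slot_of i))).
Hypothesis fT_vertex : forall c, c \in cs -> fT (local_vertex (index c cs)) = local_vertex (index c cs).
Hypothesis fH_vertex : forall c, c \in cs -> fH (local_vertex (index c cs)) = local_vertex (index c cs).
Notation P := (rename_sides SO SI).
Notation Q := (rename_sides SI SO).

Lemma swapped_joins : perm_eq (relabel_joins P Q (port_joins C)) (port_joins C).
Proof.
rewrite /relabel_joins /port_joins map_cat -!map_comp.
have sP (f : side -> side) : injective f -> perm_eq (map f S) S.
  move=> fI; have uS : uniq S by rewrite sides_uniq ?enum_uniq.
  apply: uniq_perm => // [|i]; first by rewrite map_inj_uniq.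
  rewrite mem_sides mem_enum; apply/mapP; exists (invF fI i); last by rewrite f_invF.
  by rewrite mem_sides mem_enum.
apply: perm_cat.
  have := perm_map (fun i : side => (wire i, port i)) (sP _ SI_inj).
  by rewrite -map_comp.
have := perm_map (fun i : side => (port i, wire i)) (sP _ SO_inj).
by rewrite -map_comp.
Qed.

(** After the sides are exchanged, a wiring X' which differs from X by the
    exchange becomes X itself, and only the tangles at cs are changed. *)
Lemma swapped_edges t t0 : (forall c, c \notin cs -> t c = t0 c) ->
  perm_eq (relabel p q (relabel P Q (open_edges X' t)))
    (relabel inl inl (relabel fT fH (local_tangles 0 (map t cs)) ++ local_wires I) ++
     relabel inr inr (outside t0)).
Proof.
move=> tt0; rewrite -(localize_outside t0) /open_edges /outside !relabel_cat.
have pC : perm_eq (enum C) (cs ++ [seq c <- enum C | c \notin cs]).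
  apply: uniq_perm; rewrite ?enum_uniq //.
    rewrite cat_uniq cs_uniq filter_uniq ?enum_uniq // andbT.
    by apply/hasPn => c; rewrite mem_filter => /andP[].
  by move=> c; rewrite mem_cat mem_filter mem_enum andbT orbN.
have pX : perm_eq (relabel p q (relabel P Q (relabel (@wire C) (@wire C) X')))
    (relabel inl inl (local_wires I) ++ relabel p q (relabel (@wire C) (@wire C) Xext)).
  have -> : relabel P Q (relabel (@wire C) (@wire C) X') = relabel (@wire C) (@wire C) (relabel SO SI X').
    by rewrite !relabel_comp.
  have := perm_map (fun e => (p (wire e.1), q (wire e.2))) (perm_trans X'_X X_split).
  rewrite map_cat -[map _ (relabel SO SI X')]/(relabel (p \o (@wire C)) (q \o (@wire C)) _) -relabel_comp.
  move=> /perm_trans; apply; rewrite -[map _ Xext]/(relabel (p \o (@wire C)) (q \o (@wire C)) _) -relabel_comp perm_cat2r.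
  have -> : [seq (p (wire e.1), q (wire e.2)) | e <- Iw] = relabel inl inl (local_wires I) => //.
  rewrite /local_wires /relabel -!map_comp; apply/eq_in_map => e eI.
  have /andP[h1 h2] := allP I_slots _ eI.
  transitivity (p (wire (side_of e.1)), q (wire (side_of e.2))) => //.
  by rewrite !localize_wire // ?map_f.
have flat (f : C -> seq (name * name)) p' q' (s : seq C) :
    relabel p' q' (flatten [seq f c | c <- s]) = flatten [seq relabel p' q' (f c) | c <- s] :> seq ((nat + name) * (nat + name)).
  by elim: s => //= c s <-; rewrite relabel_cat.
have flat' (f : C -> seq (name * name)) p' q' (s : seq C) :
    relabel p' q' (flatten [seq f c | c <- s]) = flatten [seq relabel p' q' (f c) | c <- s] :> seq (name * name).
  by elim: s => //= c s <-; rewrite relabel_cat.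
have flatn p' q' (s : seq C) (f : C -> seq (nat * nat)) :
    relabel p' q' (flatten [seq f c | c <- s]) = flatten [seq relabel p' q' (f c) | c <- s] :> seq (nat * nat).
  by elim: s => //= c s <-; rewrite relabel_cat.
have flatl (s : seq C) (f : C -> seq (nat * nat)) :
    relabel inl inl (flatten [seq f c | c <- s]) = flatten [seq relabel inl inl (f c) | c <- s] :> seq ((nat + name) * (nat + name)).
  by elim: s => //= c s <-; rewrite relabel_cat.
rewrite flat' !flat -local_tanglesE flatn flatl.
have pT : perm_eq (flatten [seq relabel p q (relabel P Q (tangle_edges c (t c))) | c <- enum C])
   (flatten [seq relabel inl inl (relabel fT fH (local_tangle (index c cs) (t c))) | c <- cs] ++
    flatten [seq relabel p q (tangle_edges c (t0 c)) | c <- enum C & c \notin cs]).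
  apply: perm_trans (perm_flatten (perm_map _ pC)) _.
  rewrite map_cat flatten_cat.
  have -> : [seq relabel p q (relabel P Q (tangle_edges c (t c))) | c <- cs] =
      [seq relabel inl inl (relabel fT fH (local_tangle (index c cs) (t c))) | c <- cs].
    apply/eq_in_map => c ccs.
    have so b : q (port (SO (c, b))) = inl (fH (local_port (index c cs, b))) by exact: SO_local.
    have si b : p (port (SI (c, b))) = inl (fT (local_port (index c cs, b))) by exact: SI_local.
    rewrite /= in so si.
    have vT := fT_vertex ccs; have vH := fH_vertex ccs.
    case: (t c); rewrite /relabel /= ?ccs ?so ?si ?vT ?vH //.
  rewrite perm_cat2l.
  have -> // : [seq relabel p q (relabel P Q (tangle_edges c (t c))) | c <- enum C & c \notin cs] =
      [seq relabel p q (tangle_edges c (t0 c)) | c <- enum C & c \notin cs].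
  apply/eq_in_map => c; rewrite mem_filter => /andP[ccs _].
  by rewrite (tt0 c ccs); case: (t0 c); rewrite /relabel /= ?SO_off ?SI_off.
apply: (perm_trans (perm_cat pT pX)).
by rewrite -!catA perm_cat2l perm_catCA.
Qed.
End Swap.

Local Open Scope ring_scope.
Variables (K : comNzRingType) (A : int -> K) (M : comAlgType K) (irr : graph_class -> M).
Variable F : seq (nat * nat) -> M.
Hypothesis FP : forall n, valuation_below A irr n F.

(** The value of a piece in the surrounding of the crossings cs. *)
Definition context_value (t0 : C -> tangle) (L : seq (nat * nat)) : M :=
  open_value A F (glue (outside t0) L) (relabel_joins p q outer_joins).

(** The bound 100 exceeds the number of edges of the pieces that occur. *)
Lemma context_local t0 :
  local_value A 100 (boundary_tails (size cs) I) (boundary_heads (size cs) I) (context_value t0).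
Proof.
have oE := open_edges_open t0 X_wiring.
have pE : perm_eq (relabel p q (relabel (rename_sides id id) (rename_sides id id) (open_edges X t0)))
    (relabel inl inl (relabel id id (local_tangles 0 (map t0 cs)) ++ local_wires I) ++
     relabel inr inr (outside t0)).
  apply: swapped_edges => //.
  - by rewrite /relabel; have -> : [seq (id e.1, id e.2) | e <- X] = X by rewrite -[RHS]map_id; apply: eq_map => -[].
  - by move=> i ics /=; rewrite ics.
  - by move=> i ics /=; rewrite ics.
move: oE; rewrite -(open_web_relabel _ _ (@localize_inj (unzip1 I)) (@localize_inj (unzip2 I))).
have rid : relabel (rename_sides id id) (rename_sides id id) (open_edges X t0) = open_edges X t0.
  by rewrite -[RHS]map_id; apply: eq_map => -[[a|[a|a]] [b|[b|b]]].
rewrite rid in pE; rewrite (open_web_perm pE (perm_map _ split_joins)).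
rewrite [map _ (_ ++ _)]map_cat -/(relabel_joins p q _) -/(relabel_joins p q inner_joins) localize_inner.
set L := _ ++ local_wires I; rewrite /open_web.
  have eu (a : seq (nat * nat)) (b : seq (name * name)) :
      unzip1 (relabel inl inl a ++ relabel inr inr b) = map inl (unzip1 a) ++ map inr (unzip1 b) :> seq (nat + name).
    by rewrite /unzip1 map_cat -!map_comp.
  have eu' (a : seq (nat * nat)) (b : seq (name * name)) :
      unzip2 (relabel inl inl a ++ relabel inr inr b) = map inl (unzip2 a) ++ map inr (unzip2 b) :> seq (nat + name).
    by rewrite /unzip2 map_cat -!map_comp.
  rewrite eu eu' !degree_ok_sum => /andP[/andP[_ r1] /andP[_ r2]].
  have er (a : seq (nat + name)) (b : seq nat) : rights (a ++ map inl b) = rights a.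
    by elim: a => [|[x|x] a IH] /=; rewrite ?IH //; elim: b.
  apply: (glue_local (FP (100 + size (outside t0))%N)).
  + exact: localize_outer_tails.
  + exact: localize_outer_heads.
  + have e : unzip2 (relabel_joins inl inl (local_joins I) : seq ((nat + name) * (nat + name))) = map inl (unzip2 (local_joins I)) :> seq (nat + name).
      by rewrite -[LHS]map_comp -[RHS]map_comp.
    by move: r1; rewrite /unzip2 map_cat -/(unzip2 (relabel_joins inl inl _)) e er.
  + have e : unzip1 (relabel_joins inl inl (local_joins I) : seq ((nat + name) * (nat + name))) = map inl (unzip1 (local_joins I)) :> seq (nat + name).
      by rewrite -[LHS]map_comp -[RHS]map_comp.
    by move: r2; rewrite /unzip1 map_cat -/(unzip1 (relabel_joins inl inl _)) e er.
  + by rewrite leq_addr.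
Qed.

(** The value of a state as a function of the tangles at the crossings cs alone.
    The wiring X' equals X up to an exchange of sides at cs; the trivial
    exchange is enough for the first two moves. *)
Lemma open_value_local (t0 t : C -> tangle) (SO SI : side -> side) (X' : seq (side * side)) (fT fH : nat -> nat) :
  injective SO -> injective SI ->
  (forall i, i.1 \notin cs -> SO i = i) -> (forall i, i.1 \notin cs -> SI i = i) ->
  wiring X' -> perm_eq (relabel SO SI X') X ->
  (forall i, i.1 \in cs -> q (port (SO i)) = inl (fH (local_port (slot_of i)))) ->
  (forall i, i.1 \in cs -> p (port (SI i)) = inl (fT (local_port (slot_of i)))) ->
  (forall c, c \in cs -> fT (local_vertex (index c cs)) = local_vertex (index c cs)) ->
  (forall c, c \in cs -> fH (local_vertex (index c cs)) = local_vertex (index c cs)) ->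
  (forall c, c \notin cs -> t c = t0 c) ->
  open_value A F (open_edges X' t) (port_joins C) =
    web_value A (context_value t0)
      (joins (local_joins I) (relabel fT fH (local_tangles 0 (map t cs)) ++ local_wires I, 0%N)).
Proof.
move=> SO_inj SI_inj SO_off SI_off wX' X'_X SO_local SI_local fT_vertex fH_vertex tt0.
have pE : perm_eq (relabel p q (relabel (rename_sides SO SI) (rename_sides SI SO) (open_edges X' t)))
    (relabel inl inl (relabel fT fH (local_tangles 0 (map t cs)) ++ local_wires I) ++
     relabel inr inr (outside t0)).
  exact: swapped_edges.
pose P := rename_sides SO SI; pose Q := rename_sides SI SO.
have PI : injective P by exact: rename_sides_inj.
have QI : injective Q by exact: rename_sides_inj.
pose n := (size (open_edges X' t)).+1.
have fE : fits n (open_edges X' t) (port_joins C).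
  by rewrite /fits (open_edges_open t wX') /n ltn_addr.
rewrite -(open_value_relabel (FP n) PI QI fE).
have {}fE : fits n (relabel P Q (open_edges X' t)) (relabel_joins P Q (port_joins C)).
  by rewrite fits_relabel.
have pj := perm_trans (swapped_joins SO_inj SI_inj) split_joins.
rewrite (open_value_perm (FP n) fE (perm_refl _) pj).
have {}fE : fits n (relabel P Q (open_edges X' t)) (outer_joins ++ inner_joins).
  by move: fE; rewrite /fits (open_web_perm (perm_refl _) pj) (perm_size pj).
rewrite -(open_value_relabel (FP n) (@localize_inj (unzip1 I)) (@localize_inj (unzip2 I)) fE).
rewrite -(fits_relabel n _ _ (@localize_inj (unzip1 I)) (@localize_inj (unzip2 I))) in fE.
rewrite (open_value_perm (FP n) fE pE (perm_refl _)).
rewrite [relabel_joins p q _]map_cat -/(relabel_joins p q _) -/(relabel_joins p q inner_joins) localize_inner.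
exact: open_value_glue.
Qed.

End Context.

(** * Linear relations between local tangles *)

Local Open Scope ring_scope.

(** Like [term], with the list of tangles at the crossings of the piece instead
    of a web. *)
Definition tangle_term := (bool * int * seq tangle)%type.

Definition prepend_tangle (b : bool) (e : int) (T : tangle) (x : tangle_term) : tangle_term :=
  (x.1.1 == b, x.1.2 + e, T :: x.2).

(** The expansion of a product of crossings with signs ks: weights A^(2 e) for
    the oriented tangle and - A^(- e) for the unoriented one. *)
Fixpoint tangle_states (ks : seq bool) : seq tangle_term :=
  if ks is k :: ks' then
    map (prepend_tangle true (if k then 2 else -2) Oriented) (tangle_states ks') ++
    map (prepend_tangle false (if k then -1 else 1) Unoriented) (tangle_states ks')
  else [:: (true, 0, [::])].

Lemma tangle_states_size ks : all (fun x : tangle_term => size x.2 == size ks) (tangle_states ks).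
Proof.
elim: ks => //= k ks IH; rewrite all_cat !all_map.
by apply/andP; split; apply: sub_all IH => x /= /eqP ->.
Qed.

(** The webs of the states of the piece, after the wires inside are plugged. *)
Definition closed_terms (I : seq (slot * slot)) (fT fH : nat -> nat) (ts : seq tangle_term) : seq term :=
  flatten [seq resolved x.1.1 x.1.2 (joins (local_joins I)
    (relabel fT fH (local_tangles 0 x.2) ++ local_wires I, 0%N)) | x <- ts].

Fixpoint set_tangles (C : finType) (t : C -> tangle) cs Ts : C -> tangle :=
  if cs is c :: cs' then
    if Ts is T :: Ts' then set_tangles (update t c T) cs' Ts' else t
  else t.

Lemma set_tangles_off (C : finType) (t : C -> tangle) cs Ts c : c \notin cs ->
  set_tangles t cs Ts c = t c.
Proof.
elim: cs Ts t => [|d cs IH] [|T Ts] t //=; rewrite inE negb_or => /andP[cd ccs].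
by rewrite IH // /update (negPf cd).
Qed.

Lemma map_set_tangles (C : finType) (t : C -> tangle) cs Ts : uniq cs -> size Ts = size cs ->
  map (set_tangles t cs Ts) cs = Ts.
Proof.
elim: cs Ts t => [|d cs IH] [|T Ts] t //= /andP[dcs ucs] [sT].
by rewrite IH // set_tangles_off // /update eqxx.
Qed.

Section Relation.
Variables (K : comNzRingType) (A : int -> K) (M : comAlgType K) (irr : graph_class -> M).
Hypothesis AD : {morph A : x y / x + y >-> x * y}.
Hypothesis A0 : A 0 = 1.
Variable F : seq (nat * nat) -> M.
Hypothesis FP : forall n, valuation_below A irr n F.

Definition tangle_value (H : seq tangle -> M) (x : tangle_term) : M :=
  (-1) ^+ (~~ x.1.1) *: (A x.1.2 *: H x.2).

Lemma expand_states (C : finType) (k : C -> crossing) (H : (C -> tangle) -> M) cs t :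
  (forall c, c \in cs -> classical (k c)) ->
  foldr (expand_crossing (fun c => crossing_weight A (k c))) H cs t =
    \sum_(x <- tangle_states [seq sign (k c) == 1 | c <- cs])
      tangle_value (fun Ts => H (set_tangles t cs Ts)) x.
Proof.
elim: cs t => [|c cs IH] t kc.
  by rewrite big_seq1 /tangle_value /= expr0 A0 !scale1r.
have kcs d : d \in cs -> classical (k d) by move=> dcs; apply: kc; rewrite inE dcs orbT.
rewrite [foldr _ _ _]/= -[LHS]/(expand_crossing _ c (foldr _ H cs) t) /expand_crossing !IH //.
rewrite [tangle_states _]/= big_cat !big_map /=.
rewrite !scaler_sumr; congr (_ + _); apply: eq_bigr => x _; rewrite /tangle_value /= AD;
  move: (H _) => y; have := kc c (mem_head _ _); case: (k c) => //= _; case: (x.1.1) => /=;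
  rewrite ?mulr1 ?expr0 ?expr1 ?scale1r ?scaleN1r ?scalerN ?scalerA.
all: try by rewrite ?mulN1r ?mulNr ?mulrN ?opprK ?scaleNr ?opprK [_ * A x.1.2]mulrC.
Qed.


Section Closing.
Variables (C : finType) (c0 : C) (cs : seq C) (I : seq (slot * slot)).
Variables (X X' Xext : seq ((C * bool) * (C * bool))) (SO SI : C * bool -> C * bool) (fT fH : nat -> nat).
Hypothesis cs_uniq : uniq cs.
Hypothesis I_slots : all (fun e : slot * slot => (e.1.1 < size cs)%N && (e.2.1 < size cs)%N) I.
Hypothesis X_split : perm_eq X (relabel (side_of c0 cs) (side_of c0 cs) I ++ Xext).
Hypotheses (X_wiring : wiring X) (X'_wiring : wiring X').
Hypotheses (SO_inj : injective SO) (SI_inj : injective SI).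
Hypothesis SO_off : forall i, i.1 \notin cs -> SO i = i.
Hypothesis SI_off : forall i, i.1 \notin cs -> SI i = i.
Hypothesis X'_X : perm_eq (relabel SO SI X') X.
Hypothesis SO_local : forall i, i.1 \in cs -> localize cs (unzip2 I) (port (SO i)) = inl (fH (local_port (slot_of cs i))).
Hypothesis SI_local : forall i, i.1 \in cs -> localize cs (unzip1 I) (port (SI i)) = inl (fT (local_port (slot_of cs i))).
Hypothesis fT_vertex : forall c, c \in cs -> fT (local_vertex (index c cs)) = local_vertex (index c cs).
Hypothesis fH_vertex : forall c, c \in cs -> fH (local_vertex (index c cs)) = local_vertex (index c cs).

Lemma closed_terms_value l t ts : all (fun x : tangle_term => size x.2 == size cs) ts ->
  \sum_(x <- ts) tangle_value (fun Ts => wiring_value A F X' l (set_tangles t cs Ts)) x =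
    loop_value A ^+ l *: terms_value A (context_value c0 cs I Xext A F t) (closed_terms I fT fH ts).
Proof.
elim: ts => [|x ts IH] /=; first by rewrite /terms_value !big_nil scaler0.
move=> /andP[/eqP sx sts]; rewrite big_cons IH // terms_value_cat scalerDr; congr (_ + _).
rewrite (terms_value_resolved AD) /tangle_value; lazy beta.
rewrite (wiring_valueE FP _ _ X'_wiring).
rewrite (open_value_local cs_uniq I_slots X_split X_wiring FP (t0 := t) (SO := SO) (SI := SI) (fT := fT) (fH := fH)) //; last first.
  by move=> c ccs; exact: set_tangles_off.
rewrite map_set_tangles //; move: (web_value _ _ _) => v.
by rewrite [RHS]scaler_swap (scaler_swap (A _)).
Qed.
End Closing.

Section Relate.
Variables (C : finType) (c0 : C) (cs : seq C) (I : seq (slot * slot)).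
Variables (X Xext : seq ((C * bool) * (C * bool))).
Hypothesis cs_uniq : uniq cs.
Hypothesis I_slots : all (fun e : slot * slot => (e.1.1 < size cs)%N && (e.2.1 < size cs)%N) I.
Hypothesis X_split : perm_eq X (relabel (side_of c0 cs) (side_of c0 cs) I ++ Xext).
Hypothesis X_wiring : wiring X.

Lemma unswapped_terms_value l t ts : all (fun x : tangle_term => size x.2 == size cs) ts ->
  \sum_(x <- ts) tangle_value (fun Ts => wiring_value A F X l (set_tangles t cs Ts)) x =
    loop_value A ^+ l *: terms_value A (context_value c0 cs I Xext A F t) (closed_terms I id id ts).
Proof.
apply: (closed_terms_value (SO := id) (SI := id) cs_uniq I_slots X_split X_wiring X_wiring) => //.
- by rewrite /relabel; have -> : [seq (id e.1, id e.2) | e <- X] = X by rewrite -[RHS]map_id; apply: eq_map => -[].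
- by move=> i ics /=; rewrite ics.
- by move=> i ics /=; rewrite ics.
Qed.

Lemma local_vanishing l t ts : all (fun x : tangle_term => size x.2 == size cs) ts ->
  vanishes 100 (boundary_tails (size cs) I) (boundary_heads (size cs) I) (closed_terms I id id ts) ->
  \sum_(x <- ts) tangle_value (fun Ts => wiring_value A F X l (set_tangles t cs Ts)) x = 0.
Proof.
move=> sts van; rewrite unswapped_terms_value //.
have cl := context_local cs_uniq I_slots X_split X_wiring FP t.
by rewrite (vanishesP AD cl van) scaler0.
Qed.

Lemma local_swapping X' SO SI fT fH l t ts ts' :
  injective SO -> injective SI ->
  (forall i, i.1 \notin cs -> SO i = i) -> (forall i, i.1 \notin cs -> SI i = i) ->
  wiring X' -> perm_eq (relabel SO SI X') X ->
  (forall i, i.1 \in cs -> localize cs (unzip2 I) (port (SO i)) = inl (fH (local_port (slot_of cs i)))) ->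
  (forall i, i.1 \in cs -> localize cs (unzip1 I) (port (SI i)) = inl (fT (local_port (slot_of cs i)))) ->
  (forall c, c \in cs -> fT (local_vertex (index c cs)) = local_vertex (index c cs)) ->
  (forall c, c \in cs -> fH (local_vertex (index c cs)) = local_vertex (index c cs)) ->
  all (fun x : tangle_term => size x.2 == size cs) ts ->
  all (fun x : tangle_term => size x.2 == size cs) ts' ->
  vanishes 100 (boundary_tails (size cs) I) (boundary_heads (size cs) I)
    (closed_terms I id id ts ++ map opposite_term (closed_terms I fT fH ts')) ->
  \sum_(x <- ts) tangle_value (fun Ts => wiring_value A F X l (set_tangles t cs Ts)) x =
  \sum_(x <- ts') tangle_value (fun Ts => wiring_value A F X' l (set_tangles t cs Ts)) x.
Proof.
move=> h1 h2 h3 h4 h5 h6 h7 h8 h9 h10 sts sts' van; rewrite unswapped_terms_value //.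
rewrite (closed_terms_value cs_uniq I_slots X_split X_wiring h5 h1 h2 h3 h4 h6 h7 h8 h9 h10 l t sts').
have cl := context_local cs_uniq I_slots X_split X_wiring FP t.
have := vanishesP AD cl van; rewrite terms_value_cat terms_value_opposite => /eqP.
by rewrite subr_eq0 => /eqP ->.
Qed.
End Relate.

End Relation.

(** * Computations in a monogon, a bigon and a triangle *)

Local Notation local_half := (nat * (bool * bool))%type.

(** The wire from the outgoing to the incoming one of two half-edges. *)
Definition local_edge (x y : local_half) : slot * slot :=
  if x.2.1 then ((x.1, x.2.2), (y.1, y.2.2)) else ((y.1, y.2.2), (x.1, x.2.2)).

Definition local_opposite (x : local_half) : local_half := (x.1, (~~ x.2.1, ~~ x.2.2)).

Definition transpose (T : eqType) (x y z : T) : T := if z == x then y else if z == y then x else z.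

Definition local_swap_ends (h m z : local_half) : local_half :=
  transpose h (local_opposite m) (transpose (local_opposite h) m z).

(** The wire from side s of the crossing back to side s of itself. *)
Definition monogon_edges (s : bool) : seq (slot * slot) := [:: ((0%N, s), (0%N, s))].

(** As for the triangle, o and s determine all four half-edges. *)
Definition bigon_sides (o s : bool) : seq (local_half * local_half) :=
  [:: ((0%N, (o, s)), (1%N, (~~ o, s))); ((1%N, (~~ s, ~~ o)), (0%N, (s, ~~ o)))].

(** The pairs of half-edges forming the sides of a face through three crossings;
    that the walk along the face closes up determines the half-edges at each
    corner from o, s and s2. *)
Definition triangle_sides (o s s2 : bool) : seq (local_half * local_half) :=
  [:: ((0%N, (o, s)), (1%N, (~~ o, s2))); ((1%N, (~~ s2, ~~ o)), (2%N, (s2, s)));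
      ((2%N, (~~ s, s2)), (0%N, (s, ~~ o)))].

Definition local_edges (hs : seq (local_half * local_half)) : seq (slot * slot) :=
  [seq local_edge x.1 x.2 | x <- hs].

(** The exchange of [swap_ends] for each side of the polygon, in order. *)
Definition local_swap (hs : seq (local_half * local_half)) (z : local_half) : local_half :=
  foldl (fun z x => local_swap_ends x.1 x.2 z) z hs.

Definition swap_slot (out : bool) hs (x : slot) : slot :=
  let y := local_swap hs (x.1, (out, x.2)) in (y.1, y.2.2).

Definition swap_ports (out : bool) hs (z : nat) : nat :=
  let r := (z %% 5)%N in
  if (r == 2) || (r == 3) then local_port (swap_slot out hs ((z %/ 5)%N, r == 3)) else z.

Definition vanishing_context n (I : seq (slot * slot)) (ts : seq term) : bool :=
  vanishes 100 (boundary_tails n I) (boundary_heads n I) ts.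

Definition bools := [:: true; false].

(** The kink equals A^(8 e) times the plain strand, e being the sign of the
    crossing. *)
Lemma monogon_vanishes p s :
  vanishing_context 1 (monogon_edges s) (closed_terms (monogon_edges s) id id
    (tangle_states [:: p] ++ [:: (false, if p then 8 else -8, [:: Through])])).
Proof. by move: p s => [] []; vm_compute. Qed.

(** Two crossings of opposite signs cancel, for all orientations of the bigon. *)
Lemma bigon_vanishes o s p : let I := local_edges (bigon_sides o s) in
  vanishing_context 2 I (closed_terms I id id
    (tangle_states [:: p; ~~ p] ++ [:: (false, 0, [:: Through; Through])])).
Proof. by move: o s p => [] [] []; vm_compute. Qed.

(** Both sides of the third move agree when the strand through the side h is
    over. The side h starts at half-edge (o, s) and its mate is on side s2; the
    signs of its two ends are then o == s and ~~ o == s2, and that of the third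
    crossing is free. *)
Lemma triangle_vanishes o s s2 p : let hs := triangle_sides o s s2 in let I := local_edges hs in
  let ts := tangle_states [:: o == s; ~~ o == s2; p] in
  vanishing_context 3 I (closed_terms I id id ts ++
    map opposite_term (closed_terms I (swap_ports false hs) (swap_ports true hs) ts)).
Proof. by move: o s s2 p => [] [] [] []; vm_compute. Qed.

(** * The first and second Reidemeister moves *)

Local Notation half_edge := Defs.half.

Lemma mate_out (D : diagram) (h : half_edge D) : (mate h).2.1 = ~~ h.2.1.
Proof. by case: h => c [[] b]. Qed.

(** Inverts the quarter turn: the half-edge at the other end of h, in terms of
    the next one along the face. *)
Lemma mate_of_face (D : diagram) (h g : half_edge D) : face h = g -> mate h = (g.1, (g.2.2, ~~ g.2.1)).
Proof. by rewrite /face => <-; case: (mate h) => c [o s]; rewrite /turn /= negbK. Qed.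

#[local] Arguments mate : simpl never.
#[local] Arguments face : simpl never.

Definition place (D : diagram) (c0 : 'I_(ncross D)) cs (x : local_half) : half_edge D :=
  (nth c0 cs x.1, x.2).

Lemma succ_of_mate (D : diagram) (c0 : 'I_(ncross D)) cs x y :
  mate (place c0 cs x) = place c0 cs y ->
  succ D (side_of c0 cs (local_edge x y).1) = side_of c0 cs (local_edge x y).2.
Proof.
case: x y => [k [[] b]] [k' [o b']]; rewrite /place /side_of /local_edge /mate /=.
  by case: (succ D _) => d e /= [-> _ ->].
case: ((succ D)^-1%g _) (permKV (succ D) (nth c0 cs k, b)) => d e /= <- [-> _ ->].
by [].
Qed.

Definition sides_mated (D : diagram) (c0 : 'I_(ncross D)) cs (hs : seq (local_half * local_half)) :=
  all (fun x => mate (place c0 cs x.1) == place c0 cs x.2) hs.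

(** The sides of the polygon are wires of the diagram, and they are distinct. *)
Lemma internal_wires (D : diagram) (c0 : 'I_(ncross D)) cs hs :
  uniq cs -> all (fun e : slot * slot => (e.1.1 < size cs)%N && (e.2.1 < size cs)%N) (local_edges hs) ->
  uniq (unzip1 (local_edges hs)) -> sides_mated c0 cs hs ->
  exists Xext, perm_eq (wires D).1 (relabel (side_of c0 cs) (side_of c0 cs) (local_edges hs) ++ Xext).
Proof.
move=> ucs sl uI /allP hm; set I := local_edges hs in sl uI *.
(* Distinct outgoing sides give distinct wires. *)
apply: submultiset_uniq.
  apply: (@map_uniq _ _ fst); rewrite -/(unzip1 _) relabel_tails map_inj_in_uniq // => x y.
  move=> /mapP[e eI ->] /mapP[e' e'I ->] /(congr1 (slot_of cs)).
  have /andP[h1 _] := allP sl _ eI; have /andP[h1' _] := allP sl _ e'I.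
  by rewrite !slot_ofK.
move=> _ /mapP[e /mapP[x xh ->] ->]; apply/mapP.
exists (side_of c0 cs (local_edge x.1 x.2).1); first by rewrite mem_enum.
by rewrite (succ_of_mate (eqP (hm _ xh))).
Qed.

Section Invariance.
Variables (K : comNzRingType) (A : int -> K) (M : comAlgType K) (irr : graph_class -> M).
Hypothesis AD : {morph A : x y / x + y >-> x * y}.
Hypothesis A0 : A 0 = 1.
Variable F : seq (nat * nat) -> M.
Hypothesis FP : forall n, valuation_below A irr n F.

Notation diagram_value D := (wiring_value A F (wires D).1 (loose D)).

Lemma state_tangle_through (C : finType) (k : C -> crossing) (s : {set C}) cs : uniq cs ->
  state_tangle k [set c in cs] s =
    set_tangles (state_tangle k set0 s) cs (nseq (size cs) Through).
Proof.
move=> ucs; apply/funext => c; case: (boolP (c \in cs)) => ccs.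
  have := map_set_tangles (state_tangle k set0 s) ucs (size_nseq (size cs) Through).
  move/(congr1 (fun Ts => nth Through Ts (index c cs))).
  rewrite (nth_map c) ?index_mem // nth_index // nth_nseq index_mem ccs => ->.
  by rewrite /state_tangle inE ccs.
by rewrite set_tangles_off // /state_tangle !inE (negPf ccs).
Qed.

Lemma state_sum_scale (C : finType) (w : C -> bool -> K) (cl : {set C}) (h : {set C} -> M) a :
  state_sum w cl (fun s => a *: h s) = a *: state_sum w cl h.
Proof.
rewrite /state_sum scaler_sumr; apply: eq_bigr => s _; exact: scaler_swap.
Qed.

(** Expands the crossings cs; the states of the others are summed outside. *)
Lemma state_sum_states (C : finType) (k : C -> crossing) (H : (C -> tangle) -> M) (cl : {set C}) cs :
  uniq cs -> {subset cs <= cl} -> (forall c, c \in cs -> classical (k c)) ->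
  state_sum (fun c => crossing_weight A (k c)) cl (fun s => H (state_tangle k set0 s)) =
    state_sum (fun c => crossing_weight A (k c)) (cl :\: [set c in cs])
      (fun s => \sum_(x <- tangle_states [seq sign (k c) == 1 | c <- cs])
         tangle_value A (fun Ts => H (set_tangles (state_tangle k set0 s) cs Ts)) x).
Proof.
move=> ucs scl kcs; rewrite (state_sum_expand_all (k := k) (P := set0) _ H ucs scl).
  by apply: eq_state_sum => // s _; exact: (expand_states AD A0).
by move=> c /kcs kc; rewrite inE.
Qed.

(** If in every surrounding the states at cs add up to A^e times the tangles
    with all strands going through, then D has the value of W times A^e, where W
    forgets cs. *)
Lemma diagram_sum_simplify (D W : diagram) (c0 : 'I_(ncross D)) cs hs P phi e :
  uniq cs -> (forall c, c \in cs -> classical (kind c)) -> P = [set c in cs] ->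
  all (fun e : slot * slot => (e.1.1 < size cs)%N && (e.2.1 < size cs)%N) (local_edges hs) ->
  uniq (unzip1 (local_edges hs)) -> sides_mated c0 cs hs ->
  vanishing_context (size cs) (local_edges hs) (closed_terms (local_edges hs) id id
    (tangle_states [seq sign (kind c) == 1 | c <- cs] ++ [:: (false, e, nseq (size cs) Through)])) ->
  @forgets D P W phi -> diagram_sum A F D = A e *: diagram_sum A F W.
Proof.
move=> ucs kcs -> sI uI mI van fW.
rewrite (diagram_sum_forget FP fW) -state_sum_scale /diagram_sum.
rewrite (state_sum_states (fun t => diagram_value D t) ucs _ kcs); last by move=> c /kcs; rewrite inE.
apply: eq_state_sum => // s _; rewrite state_tangle_through //.
have [Xext X_split] := internal_wires ucs sI uI mI.
have := local_vanishing AD FP ucs sI X_split (wires_wiring D) (loose D) (state_tangle (@kind D) set0 s) _ van.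
rewrite big_cat big_seq1 /tangle_value [(_, _).1]/= [(_, _).2]/= expr1 scaleN1r => /(_ _)/eqP.
rewrite subr_eq0 => h; apply/eqP/h.
rewrite all_cat /= size_nseq eqxx andbT.
have := tangle_states_size [seq sign (kind c) == 1 | c <- cs]; by rewrite size_map => ->.
Qed.

Lemma forgets_writhe (D W : diagram) P phi : @forgets D P W phi ->
  writhe W = \sum_(c | classical (kind c) && (c \notin P)) sign (kind c).
Proof.
move=> [fI PE kE _ _]; rewrite /writhe; under eq_bigr do rewrite -kE.
rewrite -(big_imset (h := phi) (A := [pred c | classical (kind c)]) (fun c => sign (kind c))) /=; last by move=> c d _ _; exact: fI.
apply: eq_bigl => c; rewrite PE negbK; apply/imsetP/andP => [[d]|[kc /codomP[d cd]]].
  by rewrite inE => kd ->; rewrite codom_f kE.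
by exists d; rewrite // inE -kE -cd.
Qed.

Definition normalized_sum (D : diagram) : M := A (- 8 * writhe D) *: diagram_sum A F D.

(** The orientation of the half-edges forces the monogon to enter and leave its
    crossing on the same side. *)
Lemma move1_invariant D W : @move1 D W -> normalized_sum D = normalized_sum W.
Proof.
move=> [h [phi [fh kh fW]]].
have := mate_of_face fh; have := mate_out h; case: h fh kh fW => c [o s] /= fh kh fW + mh.
rewrite mh /= => so; subst s.
pose hs : seq (local_half * local_half) := [:: ((0%N, (o, ~~ o)), (0%N, (~~ o, ~~ o)))].
have eI : local_edges hs = monogon_edges (~~ o) by rewrite /hs; case: (o).
rewrite /normalized_sum (@diagram_sum_simplify D W c [:: c] hs [set c] phi (8 * sign (kind c))) //.
- rewrite scalerA -AD; congr (A _ *: _); rewrite (forgets_writhe fW) /writhe (bigD1 c) //=.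
  rewrite (eq_bigr (fun c => sign (kind c))) //.
  rewrite [X in _ = - 8 * X](eq_bigl (fun i => classical (kind i) && (i != c))); last first.
    by move=> i; rewrite inE.
  by rewrite mulrDr mulNr addrAC addNr add0r.
- by move=> d; rewrite inE => /eqP ->.
- by apply/setP => d; rewrite !inE.
- by rewrite eI.
- by rewrite /sides_mated /= /place /= mh eqxx.
- rewrite eI; have -> : 8 * sign (kind c) = (if sign (kind c) == 1 then 8 else - 8) by case: (kind c) kh.
  exact: monogon_vanishes.
Qed.

(** The over-strand being the same at both ends, the signs of the two crossings
    are opposite; the face determines the other half-edges. *)
Lemma move2_invariant D W : @move2 D W -> normalized_sum D = normalized_sum W.
Proof.
move=> [h [phi /= [+ fh /andP[kh kh'] ov fW]]].
have := mate_of_face (erefl (face h)); have := mate_out h; have := mate_out (face h).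
have := mate_of_face fh; move: fh kh' fW ov kh.
case: (face h) => d [p r]; case: h => c [o s] /= fh kd fW ov kc md + + mc.
rewrite md mc /= => sp ro; have {sp} p_s : p = ~~ s by rewrite sp negbK.
subst p r; rewrite negbK in mc; move=> dc; rewrite mc /= in kd fW.
have kk : sign (kind d) = - sign (kind c).
  move: ov kd; rewrite mc /Defs.over /=; case: (kind c) kc => // _; by case: (kind d) => //; case: (o); case: (s) => /= /eqP.
pose hs := bigon_sides o s.
rewrite /normalized_sum (@diagram_sum_simplify D W c [:: c; d] hs [set c; d] phi 0) //.
- rewrite A0 scale1r; congr (A (_ * _) *: _); rewrite (forgets_writhe fW) /writhe.
  rewrite (bigD1 c) //= (bigD1 d) /=; last by rewrite kd.
  rewrite kk addrA subrr add0r; apply: eq_bigl => i.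
  by rewrite !inE negb_or andbA.
- by rewrite /= inE eq_sym dc.
- by move=> i; rewrite !inE => /orP[] /eqP ->.
- by apply/setP => i; rewrite !inE.
- by rewrite /hs; case: (o); case: (s).
- by rewrite /hs; case: (o); case: (s).
- by rewrite /sides_mated /= /place /= mc md /= !eqxx.
- have -> : [seq sign (kind i) == 1 | i <- [:: c; d]] =
      [:: sign (kind c) == 1; ~~ (sign (kind c) == 1)].
    by rewrite /= kk; case: (kind c) kc.
  exact: bigon_vanishes.
Qed.

End Invariance.

(** * The third Reidemeister move *)

Definition local_halves : seq local_half :=
  [seq (k, ob) | k <- iota 0 3, ob <- [seq (o, b) | o <- bools, b <- bools]].

(** The exchange keeps the three crossings and the directions of half-edges, and
    it is an involution. *)
Lemma triangle_swap_check o s s2 : let hs := triangle_sides o s s2 in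
  all (fun z => [&& ((local_swap hs z).1 < 3)%N, (local_swap hs z).2.1 == z.2.1 &
                    local_swap hs (local_swap hs z) == z]) local_halves.
Proof. by move: o s s2 => [] [] []; vm_compute. Qed.

Lemma triangle_swap o s s2 z : let hs := triangle_sides o s s2 in (z.1 < 3)%N ->
  [/\ ((local_swap hs z).1 < 3)%N, (local_swap hs z).2.1 = z.2.1 &
      local_swap hs (local_swap hs z) = z].
Proof.
move=> hs zn; have zI : z \in local_halves.
  apply/allpairsP; exists z; rewrite mem_iota /= -surjective_pairing; split=> //.
  by case: z {zn} => k [[] []].
by have /and3P[h1 /eqP h2 /eqP h3] := allP (triangle_swap_check o s s2) _ zI.
Qed.

Lemma swap_ports_port out hs x : swap_ports out hs (local_port x) = local_port (swap_slot out hs x).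
Proof.
case: x => k b; rewrite /swap_ports /local_port /=.
have -> : ((5 * k + 2 + b) %% 5 = 2 + b)%N by case: b; clear; lia.
have -> : ((5 * k + 2 + b) %/ 5 = k)%N by case: b; clear; lia.
by case: b.
Qed.

Lemma swap_ports_vertex out hs k : swap_ports out hs (local_vertex k) = local_vertex k.
Proof.
rewrite /swap_ports /local_vertex /=.
have -> // : ((5 * k + 4) %% 5 = 4)%N by clear; lia.
Qed.

Lemma perm_map_enum (T T' : finType) (f : T -> T') : bijective f ->
  perm_eq (map f (enum T)) (enum T').
Proof.
move=> fb; apply: uniq_perm => [||x]; rewrite ?enum_uniq //.
  by rewrite (map_inj_uniq (bij_inj fb)) enum_uniq.
by case: fb => g fK gK; rewrite mem_enum -(gK x) (mem_map (can_inj fK)) mem_enum.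
Qed.

Lemma wiring_relabel (C C' : finType) (f g : C * bool -> C' * bool) X :
  bijective f -> bijective g -> wiring X -> wiring (relabel f g X).
Proof.
move=> fb gb [p1 p2]; split; rewrite ?relabel_tails ?relabel_heads.
  exact: perm_trans (perm_map f p1) (perm_map_enum fb).
exact: perm_trans (perm_map g p2) (perm_map_enum gb).
Qed.

Lemma on_sides_bij (C C' : finType) (f : C -> C') : bijective f -> bijective (on_sides f).
Proof.
by move=> [g fK gK]; exists (on_sides g) => -[c b]; rewrite /on_sides /= ?fK ?gK.
Qed.

Section HalfSwap.
Variables (D W : diagram) (phi : 'I_(ncross D) -> 'I_(ncross W)) (psi : 'I_(ncross W) -> 'I_(ncross D)).
Hypotheses (phiK : cancel phi psi) (psiK : cancel psi phi).
Variable swap : {perm Defs.half D}.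
Hypothesis swapK : involutive swap.
Hypothesis swap_out : forall x, (swap x).2.1 = x.2.1.
Hypothesis mate_swap : forall x : Defs.half D, mate ((phi x.1, x.2) : Defs.half W) =
  (phi (swap (mate (swap x))).1, (swap (mate (swap x))).2).

(** The action of the exchange on outgoing and on incoming sides. *)
Definition swap_side (out : bool) (i : 'I_(ncross D) * bool) : 'I_(ncross D) * bool :=
  ((swap (i.1, (out, i.2))).1, (swap (i.1, (out, i.2))).2.2).

(** The wires of W, with the names of the crossings of D. *)
Definition pulled_wires := relabel (on_sides psi) (on_sides psi) (wires W).1.

Lemma swap_sideE out i : swap (i.1, (out, i.2)) = ((swap_side out i).1, (out, (swap_side out i).2)).
Proof.
rewrite /swap_side; have := swap_out (i.1, (out, i.2)).
by case: (swap _) => c [o b] /= ->.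
Qed.

Lemma swap_sideK out : involutive (swap_side out).
Proof.
move=> i; rewrite {1}/swap_side -swap_sideE swapK.
by case: i.
Qed.

Lemma pulled_wires_wiring : wiring pulled_wires.
Proof.
by apply: wiring_relabel (wires_wiring W); apply: on_sides_bij; exists phi.
Qed.

(** The hypothesis on mates says that W has the wires of D up to the exchange on
    both ends. *)
Lemma pulled_wires_perm :
  perm_eq (relabel (swap_side true) (swap_side false) pulled_wires) (wires D).1.
Proof.
pose e o := (o, succ D o); pose f := swap_side true \o on_sides psi.
have -> : relabel (swap_side true) (swap_side false) pulled_wires =
    map e (map f (enum {: 'I_(ncross W) * bool})).
  rewrite /pulled_wires relabel_comp /relabel -!map_comp; apply: eq_map => o.
  rewrite /e /f /=; congr (_, _); set i := on_sides psi o.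
  have oi : o = on_sides phi i by rewrite /i /on_sides psiK; case: (o).
  have mateE (D' : diagram) (x : 'I_(ncross D') * bool) :
      mate ((x.1, (true, x.2)) : Defs.half D') = ((succ D' x).1, (false, (succ D' x).2)).
    by rewrite /mate -surjective_pairing.
  have := mate_swap (i.1, (true, i.2)); rewrite swap_sideE mateE swap_sideE /=.
  have -> : (phi i.1, (true, i.2)) = (o.1, (true, o.2)) by rewrite oi.
  rewrite mateE; set j := succ D _; case: (succ W o) => c b [-> ->].
  by rewrite /on_sides /= phiK -[RHS](swap_sideK false).
apply: perm_map; apply: perm_map_enum; apply: bij_comp.
  exact: inv_bij (swap_sideK true).
by apply: on_sides_bij; exists phi.
Qed.

Section Value.
Variables (K : comNzRingType) (A : int -> K) (M : comAlgType K) (irr : graph_class -> M).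
Variable F : seq (nat * nat) -> M.
Hypothesis FP : forall n, valuation_below A irr n F.
Hypothesis phi_kind : forall c, kind (phi c) = kind c.

Lemma diagram_sum_pulled : diagram_sum A F W =
  state_sum (fun c => crossing_weight A (kind c)) (classical_set D)
    (fun s => wiring_value A F pulled_wires (loose W) (state_tangle (@kind D) set0 s)).
Proof.
have phiI := can_inj phiK; rewrite /diagram_sum.
have -> : classical_set W = phi @: classical_set D.
  apply/setP => c; rewrite -(psiK c) (mem_imset _ _ phiI) !inE.
  by rewrite phi_kind.
rewrite (state_sum_imset _ _ _ phiI); apply: eq_state_sum => [c b /=|s _].
  by rewrite phi_kind.
have -> : state_tangle (@kind D) set0 s = state_tangle (@kind W) set0 (phi @: s) \o phi.
  by apply/funext => c; rewrite /state_tangle /= !inE phi_kind (mem_imset _ _ phiI).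
apply: (wiring_value_forget FP (P := pred0) phiI) => //.
- by move=> c; rewrite -(psiK c) codom_f.
- exact: wires_wiring.
- exact: pulled_wires_wiring.
rewrite /through (eq_filter (a2 := pred0)) // filter_pred0; split=> //=.
rewrite /pulled_wires relabel_comp.
have -> // : relabel (on_sides phi \o on_sides psi) (on_sides phi \o on_sides psi) (wires W).1 = (wires W).1.
rewrite -[RHS]map_id; apply: eq_map => -[[a b] [c d]].
by rewrite /on_sides /= !psiK.
Qed.

End Value.

End HalfSwap.

Section Triangle.
Variables (D : diagram) (cs : seq 'I_(ncross D)) (c0 : 'I_(ncross D)).
Hypothesis cs_uniq : uniq cs.
Notation place := (place c0 cs).

Lemma place_eq x y : (x.1 < size cs)%N -> (y.1 < size cs)%N -> (place x == place y) = (x == y).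
Proof.
case: x y => [k ob] [k' ob'] /= xn yn; rewrite /place /= !xpair_eqE nth_uniq //.
Qed.

Lemma place_tperm x y z : (x.1 < size cs)%N -> (y.1 < size cs)%N -> (z.1 < size cs)%N ->
  tperm (place x) (place y) (place z) = place (transpose x y z).
Proof.
move=> xn yn zn; rewrite /transpose; case: (eqVneq z x) => [->|zx]; first by rewrite tpermL.
case: (eqVneq z y) => [->|zy]; first by rewrite tpermR.
by rewrite tpermD // eq_sym place_eq.
Qed.

Lemma place_swap_ends x y z : (x.1 < size cs)%N -> (y.1 < size cs)%N -> (z.1 < size cs)%N ->
  mate (place x) = place y -> swap_ends (place x) (place z) = place (local_swap_ends x y z).
Proof.
move=> xn yn zn mx; rewrite /swap_ends mx permM.
rewrite (place_tperm (x := local_opposite x)) // (place_tperm (y := local_opposite y)) //.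
by rewrite /transpose; case: ifP => // _; case: ifP.
Qed.

Lemma local_swap_ends_lt n x y z : (x.1 < n)%N -> (y.1 < n)%N -> (z.1 < n)%N ->
  ((local_swap_ends x y z).1 < n)%N.
Proof.
have tr a b c : (a.1 < n)%N -> (b.1 < n)%N -> (c.1 < n)%N -> ((transpose a b c : local_half).1 < n)%N.
  by move=> an bn cn; rewrite /transpose; do 2 case: ifP => // _.
by move=> xn yn zn; apply: (tr) => //; exact: tr.
Qed.

Lemma swap_ends_off (h : Defs.half D) x y : h = place x -> mate h = place y ->
  (x.1 < size cs)%N -> (y.1 < size cs)%N ->
  forall z : Defs.half D, z.1 \notin cs -> swap_ends h z = z.
Proof.
move=> -> mx xn yn z zcs; rewrite /swap_ends mx permM.
have off t : (t.1 < size cs)%N -> place t != z.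
  by move=> tn; apply: contraNneq zcs => <-; rewrite mem_nth.
rewrite [tperm (opposite _) _ z]tpermD ?tpermD //; first exact: off.
- by rewrite -[opposite _]/(place (local_opposite y)) off.
- by rewrite -[opposite _]/(place (local_opposite x)) off.
exact: off.
Qed.

End Triangle.

Section Invariance.
Variables (K : comNzRingType) (A : int -> K) (M : comAlgType K) (irr : graph_class -> M).
Hypothesis AD : {morph A : x y / x + y >-> x * y}.
Hypothesis A0 : A 0 = 1.
Variable F : seq (nat * nat) -> M.
Hypothesis FP : forall n, valuation_below A irr n F.

(** The faces determine the half-edges from o, s and s2. Both diagrams are then
    expanded at the three crossings and compared in the same surrounding. *)
Lemma move3_invariant D W : @move3 D W -> normalized_sum A F D = normalized_sum A F W.
Proof.
move=> [h [phi /= [[u fh] kh ov [phib phi_kind lW] mate_swap]]].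
have := mate_of_face (erefl (face h)); have := mate_out h.
have := mate_of_face (erefl (face (face h))); have := mate_out (face h).
have := mate_of_face fh; have := mate_out (face (face h)).
move: u kh ov mate_swap; clear fh.
case: (face (face h)) => e [p' r']; case: (face h) => d [p r]; case: h => c [o s] /=.
move=> u kh ov mate_swap + me; rewrite me /= => sp.
move=> + md; rewrite md /= => rp; move=> + mc; rewrite mc /= => ro.
have {sp} p'_s : p' = ~~ s by rewrite sp negbK.
have {rp} p_r : p = ~~ r' by rewrite rp negbK.
subst p' p r; rewrite ?negbK in mc md me ov; rename r' into s2.
rewrite mc md /= in u kh; rewrite mc in ov.
case: (phib) => psi phiK psiK.
pose cs := [:: c; d; e]; pose hs := triangle_sides o s s2.
have cs_uniq : uniq cs by exact: u.
have e0 : (c, (o, s)) = place c cs (0%N, (o, s)) by [].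
have e1 : (d, (~~ s2, ~~ o)) = place c cs (1%N, (~~ s2, ~~ o)) by [].
have e2 : (e, (~~ s, s2)) = place c cs (2%N, (~~ s, s2)) by [].
have n0 : mate (place c cs (0%N, (o, s))) = place c cs (1%N, (~~ o, s2)) by exact: mc.
have n1 : mate (place c cs (1%N, (~~ s2, ~~ o))) = place c cs (2%N, (s2, s)) by exact: md.
have n2 : mate (place c cs (2%N, (~~ s, s2))) = place c cs (0%N, (s, ~~ o)) by exact: me.
set swap := (_ * _ * _)%g in mate_swap.
have swap_on z : (z.1 < 3)%N -> swap (place c cs z) = place c cs (local_swap hs z).
  move=> zn; rewrite /swap 2!permM e0 e1 e2.
  rewrite (place_swap_ends cs_uniq _ _ _ n0) // (place_swap_ends cs_uniq _ _ _ n1) //; last exact: local_swap_ends_lt.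
  rewrite (place_swap_ends cs_uniq _ _ _ n2) //.
  by do 2 apply: local_swap_ends_lt => //.
have swap_off z : z.1 \notin cs -> swap z = z.
  move=> zcs; rewrite /swap 2!permM (swap_ends_off e0 n0) // (swap_ends_off e1 n1) //.
  by rewrite (swap_ends_off e2 n2).
have placed (z : Defs.half D) : z.1 \in cs -> exists2 x, (x.1 < 3)%N & z = place c cs x.
  move=> zcs; exists (index z.1 cs, z.2); first by move: zcs; rewrite -index_mem.
  by rewrite /place nth_index // -surjective_pairing.
have swapK : involutive swap.
  move=> z; case: (boolP (z.1 \in cs)) => [/placed[x xn ->]|zcs]; last by rewrite !swap_off.
  by have [h1 _ h3] := triangle_swap o s s2 xn; rewrite !swap_on // h3.
have swap_out z : (swap z).2.1 = z.2.1.
  case: (boolP (z.1 \in cs)) => [/placed[x xn ->]|zcs]; last by rewrite swap_off.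
  by have [_ h2 _] := triangle_swap o s s2 xn; rewrite swap_on.
pose ks := [:: o == s; ~~ o == s2; sign (kind e) == 1].
case/and4P: kh => kc kd ke _.
have ksE : [seq sign (kind i) == 1 | i <- cs] = ks.
  case/andP: ov; rewrite /Defs.over /ks /=.
  by case: (kind c) kc => // _; case: (kind d) kd => // _; case: (o); case: (s); case: (s2).
have kcs i : i \in cs -> classical (kind i) by rewrite !inE => /or3P[] /eqP ->.
have scl : {subset cs <= classical_set D} by move=> i /kcs; rewrite inE.
have writheE : writhe W = writhe D.
  rewrite /writhe (reindex phi) /=; last exact: onW_bij.
  by apply: eq_big => i *; rewrite phi_kind.
rewrite /normalized_sum writheE; congr (_ *: _).
rewrite (diagram_sum_pulled phiK psiK FP phi_kind) lW /diagram_sum.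
rewrite (state_sum_states AD A0 (fun t => wiring_value A F (wires D).1 (loose D) t) cs_uniq scl kcs).
rewrite (state_sum_states AD A0 (fun t => wiring_value A F (pulled_wires psi) (loose D) t) cs_uniq scl kcs).
apply: eq_state_sum => // st _; rewrite ksE.
have sI : all (fun x : slot * slot => (x.1.1 < size cs)%N && (x.2.1 < size cs)%N) (local_edges hs).
  by rewrite /hs; case: (o); case: (s); case: (s2).
have uI : uniq (unzip1 (local_edges hs)) by rewrite /hs; case: (o); case: (s); case: (s2).
have mI : sides_mated c cs hs.
  by rewrite /sides_mated /hs /= in n0 n1 n2 *; rewrite n0 n1 n2 !eqxx.
have [Xext X_split] := internal_wires cs_uniq sI uI mI.
have placed_slot i : i.1 \in cs -> ((slot_of cs i).1 < 3)%N /\ i = side_of c cs (slot_of cs i).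
  move=> ics; split; last by rewrite side_ofK.
  by move: ics; rewrite -index_mem.
have swap_slotE out x : (x.1 < 3)%N ->
    swap_side swap out (side_of c cs x) = side_of c cs (swap_slot out hs x) /\ ((swap_slot out hs x).1 < 3)%N.
  move=> xn; have [h1 _ _] := triangle_swap o s s2 (z := (x.1, (out, x.2))) xn.
  by split=> //; rewrite /swap_side [(_, (out, _))]/(place c cs (x.1, (out, x.2))) swap_on.
apply: (local_swapping AD FP cs_uniq sI X_split (wires_wiring D)
  (SO := swap_side swap true) (SI := swap_side swap false)
  (fT := swap_ports false hs) (fH := swap_ports true hs)).
- exact: inv_inj (swap_sideK swapK swap_out true).
- exact: inv_inj (swap_sideK swapK swap_out false).
- by move=> i ics; rewrite /swap_side swap_off //; case: (i).
- by move=> i ics; rewrite /swap_side swap_off //; case: (i).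
- exact: pulled_wires_wiring phiK psiK.
- exact: pulled_wires_perm.
- move=> i /placed_slot[xn ei]; rewrite swap_ports_port {1}ei.
  by have [-> h] := swap_slotE true _ xn; rewrite localize_port.
- move=> i /placed_slot[xn ei]; rewrite swap_ports_port {1}ei.
  by have [-> h] := swap_slotE false _ xn; rewrite localize_port.
- by move=> i _; exact: swap_ports_vertex.
- by move=> i _; exact: swap_ports_vertex.
- exact: tangle_states_size ks.
- exact: tangle_states_size ks.
exact: triangle_vanishes.
Qed.

End Invariance.

(** * Invariance under generalized Reidemeister moves *)

Section Invariance.
Variables (K : comNzRingType) (A : int -> K) (M : comAlgType K) (irr : graph_class -> M).
Hypothesis AD : {morph A : x y / x + y >-> x * y}.
Hypothesis A0 : A 0 = 1.
Variable F : seq (nat * nat) -> M.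
Hypothesis FP : forall n, valuation_below A irr n F.

(** The strands of virtual crossings go through in every state, so forgetting
    them changes nothing. *)
Lemma forget_virtual_invariant D W P phi : @forgets D P W phi ->
  (forall c, c \in P -> kind c = Virtual) -> normalized_sum A F D = normalized_sum A F W.
Proof.
move=> fW vP; have notP c : classical (kind c) -> c \notin P.
  by move=> kc; apply/negP => /vP kv; rewrite kv in kc.
rewrite /normalized_sum (forgets_writhe fW) (diagram_sum_forget FP fW) /writhe.
congr (A (_ * _) *: _).
  by apply: eq_bigl => c; apply/idP/andP => [kc|[]] //; split=> //; exact: notP.
have -> : classical_set D :\: P = classical_set D.
  apply/setP => c; rewrite !inE andb_idl //; exact: notP.
apply: eq_state_sum => // s /subsetP scl; congr (wiring_value A F _ _ _).
apply/funext => c; rewrite /state_tangle inE; case: (boolP (c \in P)) => // /vP kc.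
by rewrite kc; case: ifP => // /scl; rewrite inE kc.
Qed.

Lemma move_invariant (D W : virtual_diagram) : move D W -> normalized_sum A F D = normalized_sum A F W.
Proof.
case=> [[phi fW]|m|m|[m|[X [P [P' [phi [phi' [fP fP' vP vP' _]]]]]]]].
- by apply: (forget_virtual_invariant fW) => c; rewrite inE.
- exact: (move1_invariant AD A0 FP).
- exact: (move2_invariant AD A0 FP).
- exact: (move3_invariant AD A0 FP).
- by rewrite (forget_virtual_invariant fP vP) (forget_virtual_invariant fP' vP').
Qed.

Lemma virtually_equivalent_invariant (D W : virtual_diagram) : virtually_equivalent D W ->
  normalized_sum A F D = normalized_sum A F W.
Proof.
elim=> [X Y /move_invariant //|//|X Y _ -> //|X Y Z _ -> _ -> //].
Qed.

End Invariance.

Lemma normalized_bracket_sum (F : seq (nat * nat) -> value) (D : diagram) :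
  (forall n, valuation_below Apow irreducible_value n F) ->
  normalized_bracket D (evaluation F) = normalized_sum Apow F D.
Proof.
move=> FP; rewrite /normalized_bracket /normalized_sum.
apply: (congr1 (fun x => Apow (- 8 * writhe D) *: x)).
rewrite /bracket /diagram_sum /state_sum; apply: eq_big => [s|s _].
  by apply/subsetP/subsetP => h c /h; rewrite !inE.
rewrite (evaluation_class FP) -(state_value FP) /weight.
apply: (congr1 (fun a => a *: _)).
by apply: eq_bigl => c; rewrite inE.
Qed.

Theorem mainTheorem1 :
  exists f : graph_class -> value,
    [/\ kuperberg_evaluation f,
        forall g : graph_class -> value, kuperberg_evaluation g -> g =1 f &
        forall K K' : virtual_diagram, virtually_equivalent K K' ->
          normalized_bracket K f = normalized_bracket K' f].
Proof.
have [F FP] := valuation_exists irreducible_value ApowD Apow0.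
exists (evaluation F); split.
- exact: evaluation_kuperberg.
- by move=> g gP; exact: kuperberg_unique.
move=> K K' KK'.
have inv := virtually_equivalent_invariant ApowD Apow0 FP KK'.
exact (etrans (normalized_bracket_sum K FP) (etrans inv (esym (normalized_bracket_sum K' FP)))).
Qed.
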